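(* There exists a constant $c>0$ (depending only on $N$) such that for every nonempty open bounded set $\Omega\subset\mathbb{R}^N$ we have $$\frac{|\Omega|^{2/N}}{\mathcal{I}_\Omega^2}-\omega_N^{2/N}\ge c\,\mathcal{A}(\Omega)^2 .$$
   Context: $N\ge 2$; $|\cdot|$ is $N$-dimensional Lebesgue measure and $\omega_N$ is the measure of the unit ball of $\mathbb{R}^N$. Fraenkel asymmetry: $\mathcal{A}(\Omega)=\inf\left\{\frac{|\Omega\Delta B|}{|\Omega|}: B \text{ ball with } |B|=|\Omega|\right\}$. Harmonic radius $\mathcal{I}_\Omega$: let $\Gamma_N$ be the function on $(0,+\infty)$ given by $\Gamma_2(t)=-\log t$ and $\Gamma_N(t)=t^{2-N}$ for $N\ge 3$. For $x\in\Omega$, let $H^\Omega_x$ be the (generalized) solution of $\Delta H^\Omega_x=0$ in $\Omega$, $H^\Omega_x=\Gamma_N(|x-\cdot|)$ on $\partial\Omega$; that is, $H_x^\Omega$ is the regular part of the Green function $G^\Omega_x$ of $\Omega$ with singularity at $x$ ($-\Delta G^\Omega_x=\delta_x$ in $\Omega$, $G^\Omega_x=0$ on $\partial\Omega$), in the sense that $G^\Omega_x(y)=\varsigma_N\left(\Gamma_N(|x-y|)-H^\Omega_x(y)\right)$ with $\varsigma_2=\frac{1}{2\pi}$ and $\varsigma_N=\frac{1}{(N-2)N\omega_N}$ for $N\ge 3$. Then $$\mathcal{I}_\Omega:=\sup_{x\in\Omega}\Gamma_N^{-1}\left(H^\Omega_x(x)\right).$$ *)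

(* Defs.v *)
From HB Require Import structures.
From mathcomp Require Import all_boot all_order all_algebra.
From mathcomp Require Import all_classical all_reals all_analysis.

Set Implicit Arguments.
Unset Strict Implicit.
Unset Printing Implicit Defensive.

Import Order.TTheory GRing.Theory Num.Theory.
Import numFieldNormedType.Exports.

Local Open Scope classical_set_scope.
Local Open Scope ring_scope.

(** * Lebesgue measure on R^N *)

Section product_cons.
Context (R : realType) (n : nat).
Let Rm : measurableType _ := measurableTypeR R.
Variable m : {sigma_finite_measure set (n.-tuple Rm) -> \bar R}.

Definition tuple_cons (p : Rm * n.-tuple Rm) : n.+1.-tuple Rm :=
  [tuple of p.1 :: p.2].

Lemma measurable_tuple_cons : measurable_fun setT tuple_cons.
Proof. exact: measurable_cons. Qed.

(* The image of [lebesgue_measure \x m] under the identification of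
   R * R^n with R^n.+1. *)
Definition product_cons : set (n.+1.-tuple Rm) -> \bar R :=
  pushforward (@lebesgue_measure R \x m)%E tuple_cons.

Let pc0 : product_cons set0 = 0%E.
Proof. by rewrite /product_cons /pushforward preimage_set0 measure0. Qed.

Let pc_ge0 A : (0 <= product_cons A)%E.
Proof. by rewrite /product_cons /pushforward. Qed.

Let pc_sigma_additive : semi_sigma_additive product_cons.
Proof.
move=> F mF tF mUF; rewrite /product_cons /pushforward preimage_bigcup.
apply: measure_semi_sigma_additive.
- by move=> i; rewrite -[X in measurable X]setTI; exact: measurable_tuple_cons.
- apply/trivIsetP => /= i j _ _ ij; rewrite -preimage_setI.
  by move/trivIsetP : tF => /(_ _ _ _ _ ij) ->//; rewrite preimage_set0.
- rewrite -preimage_bigcup -[X in measurable X]setTI.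
  exact: measurable_tuple_cons.
Qed.

HB.instance Definition _ := isMeasure.Build _ _ _
  product_cons pc0 pc_ge0 pc_sigma_additive.

Let pc_sigma_finite : sigma_finite setT product_cons.
Proof.
have /sigma_finiteP[F [FT ndF mF]] := sigma_finiteT (@lebesgue_measure R).
have /sigma_finiteP[G [GT ndG mG]] := sigma_finiteT m.
pose u (t : n.+1.-tuple Rm) : Rm * n.-tuple Rm :=
  (tnth t ord0, [tuple of behead t]).
have mu : measurable_fun setT u.
  apply: measurable_fun_pair; first exact: measurable_tnth.
  exact: measurable_behead.
have uK q : u (tuple_cons q) = q.
  by case: q => a t; congr pair; apply: val_inj.
exists (fun i => u @^-1` (F i `*` G i)).
  apply/esym/seteqP; split => // t _.
  have [i _ Fi] : (\bigcup_i F i) (u t).1 by rewrite -FT.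
  have [j _ Gj] : (\bigcup_i G i) (u t).2 by rewrite -GT.
  exists (maxn i j) => //; split.
    by move: Fi; exact/subsetPset/ndF/leq_maxl.
  by move: Gj; exact/subsetPset/ndG/leq_maxr.
move=> i; have [mFi Fi] := mF i; have [mGi Gi] := mG i; split.
  by rewrite -[X in measurable X]setTI; apply: mu => //; exact: measurableX.
rewrite /product_cons /pushforward (_ : _ @^-1` _ = F i `*` G i).
  by rewrite product_measure1E// lte_mul_pinfty// ge0_fin_numE.
by rewrite -comp_preimage (_ : u \o tuple_cons = id)//; exact/funext.
Qed.

HB.instance Definition _ := Measure_isSigmaFinite.Build _ _ _
  product_cons pc_sigma_finite.

End product_cons.

Fixpoint lebesgue_tuple (R : realType) (n : nat) :
    {sigma_finite_measure set (n.-tuple (measurableTypeR R)) -> \bar R} :=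
  match n with
  | 0 => \d_([tuple] : 0.-tuple (measurableTypeR R))
  | n'.+1 => product_cons (lebesgue_tuple R n')
  end.

(* Sanity check: the measure of a product of measurable sets. *)
Lemma lebesgue_tuple_box (R : realType) (n : nat)
    (A : nat -> set (measurableTypeR R)) : (forall i, measurable (A i)) ->
  lebesgue_tuple R n [set t | forall i : 'I_n, A i (tnth t i)] =
  (\prod_(i < n) lebesgue_measure (A i))%E.
Proof.
elim: n A => [|n IHn] A mA.
  rewrite big_ord0 /= (_ : [set _ | _] = setT) ?diracT//.
  by apply/seteqP; split => // t _ [].
rewrite big_ord_recl /= /product_cons /pushforward.
rewrite -(IHn (A \o S))//; last by move=> i; exact: mA.
rewrite -product_measure1E//.
  congr (_ _); apply/seteqP; split => -[a t] /=.
    move=> H; split; first exact: (H ord0).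
    by move=> i; have := H (lift ord0 i); rewrite tnthS.
  move=> [Ha Ht] i; have [j ->|->] := unliftP ord0 i; last exact: Ha.
  by rewrite tnthS; exact: Ht.
have -> : [set t : n.-tuple (measurableTypeR R) |
            forall i : 'I_n, (A \o S) i (tnth t i)] =
    \bigcap_(i in [set: 'I_n]) ((@tnth n (measurableTypeR R) ^~ i) @^-1` A i.+1).
  by apply/seteqP; split => t /= H i; [move=> _|]; exact: H.
apply: fin_bigcap_measurable => // i _.
by rewrite -[X in measurable X]setTI; exact: measurable_tnth.
Qed.

Section harmonic_radius.
Context (R : realType) (N : nat).
Local Notation V := 'rV[R]_N.
Implicit Types (Omega U A : set V) (x y c : V) (r : R).

(* Only applied below to Borel sets of finite measure. *)
Definition vol A : R :=
  fine (lebesgue_tuple R N [set t | A (\row_(i < N) tnth t i)]).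

(* The library norm on ['rV[R]_N] is the sup norm; it has the same topology and
   the same bounded sets as the Euclidean one. *)
Definition enorm x : R := Num.sqrt (\sum_(i < N) x ord0 i ^+ 2).

Definition eball c r : set V := [set y | enorm (y - c) < r].
Definition eclosed_ball c r : set V := [set y | enorm (y - c) <= r].
Definition esphere c r : set V := [set y | enorm (y - c) = r].

Definition omegaN : R := vol (eball 0 1).

Definition fraenkel Omega : R :=
  inf [set a | exists c r, [/\ 0 < r, vol (eball c r) = vol Omega &
                 a = vol (Omega `+` eball c r) / vol Omega]].

(** * Harmonic functions and the generalized Dirichlet problem *)

Definition partial (i : 'I_N) (f : V -> R) : V -> R :=
  fun x => 'D_(delta_mx ord0 i) f x.

(* Meant for U open. *)
Fixpoint Ck_on (k : nat) U (f : V -> R) : Prop :=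
  (forall x, U x -> {for x, continuous f}) /\
  match k with
  | 0 => True
  | k'.+1 => forall i : 'I_N,
      (forall x, U x -> derivable f x (delta_mx ord0 i)) /\
      Ck_on k' U (partial i f)
  end.

Definition laplacian (f : V -> R) : V -> R :=
  fun x => \sum_(i < N) partial i (partial i f) x.

Definition harmonic_on U (h : V -> R) : Prop :=
  Ck_on 2 U h /\ forall x, U x -> laplacian h x = 0.

(* Subharmonicity of continuous functions as in Gilbarg-Trudinger, Section 2.8:
   comparison with harmonic functions on compactly contained balls. *)
Definition subharmonic_on U (u : V -> R) : Prop :=
  (forall x, U x -> {for x, continuous u}) /\
  forall c r (h : V -> R), 0 < r -> eclosed_ball c r `<=` U ->
    harmonic_on (eball c r) h -> {within eclosed_ball c r, continuous h} ->
    (forall z, esphere c r z -> u z <= h z) ->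
    forall z, eball c r z -> u z <= h z.

(* [closure U `\` U] is the topological boundary, U being open. *)
Definition subfunctions U (phi : V -> R) : set (V -> R) :=
  [set u | [/\ {within closure U, continuous u}, subharmonic_on U u &
               forall z, (closure U `\` U) z -> u z <= phi z]].

(* Perron's generalized solution of [laplacian h = 0] in U, [h = phi] on the
   boundary of U. *)
Definition perron U (phi : V -> R) : V -> R :=
  fun y => sup [set u y | u in subfunctions U phi].

(** * Harmonic radius *)

Definition gammaN (t : R) : R :=
  if N == 2 then - ln t else (t ^+ (N - 2))^-1.

Definition gammaN_inv (s : R) : R :=
  if N == 2 then expR (- s) else s `^ (- ((N - 2)%:R)^-1).

Lemma gammaNK (t : R) : (2 <= N)%N -> 0 < t -> gammaN_inv (gammaN t) = t.
Proof.
rewrite /gammaN_inv /gammaN => N2 t0.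
have [_|N2'] := eqVneq N 2; first by rewrite opprK lnK.
have k0 : (N - 2)%:R != 0 :> R.
  by rewrite pnatr_eq0 subn_eq0 -ltnNge ltn_neqAle eq_sym N2'.
rewrite -powR_mulrn ?(ltW t0)// -powRN -powRrM mulrNN divff//.
by rewrite powRr1// ltW.
Qed.

Definition regular_part Omega x : V -> R :=
  perron Omega (fun z => gammaN (enorm (x - z))).

Definition harmonic_radius Omega : R :=
  sup [set gammaN_inv (regular_part Omega x x) | x in Omega].

End harmonic_radius.

Arguments omegaN R N : clear implicits.

(* Main.v *)
(* Let 0 be in Omega, let B be the ball centred at 0 with |B| = |Omega|, of radius
   R, and let F = Gamma_N(|.|). The claim reduces to a lower bound for H_0(0).
   Let K be the complement of Omega in a large ball. The capacitary problem on K with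
   obstacle F is discretised: K is cut into small cells, and minimising a quadratic
   form over the charges of the cells, with densities in [0, lam], gives a Green
   potential P which is almost F + const on all cells but those with density lam,
   whose volume is O(1 / lam). Up to a small constant, P + const lies below F, and it
   satisfies the mean value inequality in Omega, so it is a Perron subfunction and
   H_0(0) >= P(0) + const - small.
   Smooth F to F_tau = gam(|x|^2 + tau^2) and test -Laplacian(F_tau), an approximate
   delta function, against (F_tau - P - T)^+, which vanishes outside Omega and the
   saturated cells; its integral is at most that of |grad F_tau|^2 over Omega, up to a
   small error. For B and (F_tau - F_tau(R))^+ the reverse inequality holds.
   Subtracting,
     C_N (P(0) + T - Gamma_N(R)) >= int_B |grad F|^2 - int_Omega |grad F|^2 - small,
   and since |grad F| is radially decreasing the right-hand side is at least
   c R^(2-N) (|Omega + B| / |Omega|)^2, + being the symmetric difference.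
   Laplacians and gradients are replaced by finite differences throughout. *)

Require Import Defs.
From mathcomp Require Import all_boot all_order all_algebra.
From mathcomp Require Import all_classical all_reals all_analysis.
From mathcomp Require Import measurable_realfun ring lra.
From mathcomp Require finmap.

Set Implicit Arguments.
Unset Strict Implicit.
Unset Printing Implicit Defensive.

Import Order.TTheory GRing.Theory Num.Theory.
Import numFieldNormedType.Exports.

Local Open Scope classical_set_scope.
Local Open Scope ring_scope.

(** * Lebesgue measure and affine maps *)

(** Only a lower bound for the regular part is wanted, so one Perron subfunction suffices, whatever
    the boundary of Omega. Differences replace derivatives because the potential is merely
    continuous: summation by parts then rests on translation invariance of the integral alone, and
    errors of order h^3 vanish after division by h^2. Densities bounded by [lam] on finitely many
    cells make the minimisation a problem on a compact box and the potentials uniform limits of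
    Lipschitz functions. The price is the saturated set, which is small because the total charge is
    bounded independently of [lam]. The parameters are therefore fixed in a definite order: the
    radii first, then [lam] and eta, and last the smoothing scale tau, on which the cells depend.
    The square of the asymmetry alpha arises as a product: a mass of order alpha |Omega| lies beyond
    a shell of relative thickness of order alpha, and there the energy density has dropped in
    proportion to the thickness. The resulting gain scales like Gamma_N, so inverting Gamma_N turns
    it into a factor 1 + c alpha^2 on the square of the harmonic radius. *)

Definition push_measure d d' (T1 : measurableType d) (T2 : measurableType d')
    (R : realFieldType) (m : {measure set T1 -> \bar R}) (f : T1 -> T2)
    (mf : measurable_fun setT f) : {measure set T2 -> \bar R} :=
  measure_function_pushforward__canonical__measure_function_Measure m mf.

Section affine_image.
Context (R : realType).
Local Notation Rm := (measurableTypeR R).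

Definition affine1 (r v : R) : Rm -> Rm := fun x => r * x + v.

Lemma measurable_affine1 r v : measurable_fun setT (affine1 r v).
Proof.
rewrite /affine1; apply: measurable_funD; last exact: measurable_cst.
by apply: measurable_funM; [exact: measurable_cst|exact: measurable_id].
Qed.

Lemma preimage_affine1_itv r v a b : 0 < r ->
  affine1 r v @^-1` `]a, b] = `](a - v) / r, (b - v) / r]%classic.
Proof.
move=> r0; apply/seteqP; split => x /=; rewrite /affine1 !in_itv /=.
  by move=> /andP[h1 h2]; rewrite ltr_pdivrMr// ler_pdivlMr//; apply/andP; split; nra.
by rewrite ltr_pdivrMr// ler_pdivlMr// => /andP[h1 h2]; apply/andP; split; nra.
Qed.

(** Uniqueness of Lebesgue measure: [r] times its push-forward gives every half-open interval its
    length. *)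
Lemma lebesgue_measure_affine1 (r v : R) (A : set Rm) : 0 < r -> measurable A ->
  lebesgue_measure (affine1 r v @^-1` A) = ((r^-1)%:E * lebesgue_measure A)%E.
Proof.
move=> r0 mA.
have mf := @measurable_affine1 r v.
have -> : lebesgue_measure A =
    mscale (NngNum (ltW r0)) (push_measure lebesgue_measure mf) A.
  apply: (@lebesgue_measure_unique _ (mscale _ _)) => //.
  move=> _ [[a b]] _ <- /=; rewrite /mscale /= /pushforward preimage_affine1_itv//=.
  rewrite !lebesgue_measure_itv /= !lte_fin ltr_pM2r ?invr_gt0// ltrD2r.
  case: ifPn => ab; last by rewrite mule0.
  rewrite -!EFinB -EFinM; congr EFin; field.
  by rewrite gt_eqF.
by rewrite /mscale /= /pushforward muleA -EFinM mulVf ?gt_eqF// mul1e.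
Qed.

Definition affine_tuple n (r : R) (v : nat -> R) (t : n.-tuple Rm) : n.-tuple Rm :=
  [tuple affine1 r (v i) (tnth t i) | i < n].

Lemma measurable_affine_tuple n r v : measurable_fun setT (@affine_tuple n r v).
Proof.
apply/measurable_fun_tnthP => i.
rewrite (_ : _ \o _ = affine1 r (v i) \o (@tnth n Rm ^~ i)); last first.
  by apply/funext => t /=; rewrite tnth_mktuple.
apply: measurableT_comp; [exact: measurable_affine1|exact: measurable_tnth].
Qed.

(** Induction on [n]: [r ^+ n.+1] times the push-forward of the product measure agrees with that
    measure on rectangles, hence everywhere. *)
Lemma lebesgue_tuple_affine n (r : R) (v : nat -> R) (A : set (n.-tuple Rm)) :
  0 < r -> measurable A ->
  lebesgue_tuple R n (affine_tuple r v @^-1` A) =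
  ((r^-1 ^+ n)%:E * lebesgue_tuple R n A)%E.
Proof.
move=> r0; elim: n v A => [|n IHn] v A mA.
  rewrite expr0 mul1e (_ : _ @^-1` _ = A)//; apply/seteqP.
  by split => t /=; rewrite (tuple0 t) (tuple0 (affine_tuple _ _ _)).
pose phi (q : Rm * n.-tuple Rm) : Rm * n.-tuple Rm :=
  (affine1 r (v 0%N) q.1, affine_tuple r (v \o S) q.2).
have mphi : measurable_fun setT phi.
  apply: measurable_fun_pair.
    by apply: measurableT_comp; [exact: measurable_affine1|exact: measurable_fst].
  by apply: measurableT_comp; [exact: measurable_affine_tuple|exact: measurable_snd].
have mc : measurable_fun setT (@tuple_cons R n) by exact: measurable_tuple_cons.
have mA' : measurable (@tuple_cons R n @^-1` A).
  by rewrite -[X in measurable X]setTI; exact: mc.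
have rn0 : 0 <= r ^+ n.+1 by rewrite exprn_ge0// ltW.
have E X : measurable X ->
  (lebesgue_measure \x lebesgue_tuple R n)%E X =
  mscale (NngNum rn0)
   (push_measure (lebesgue_measure \x lebesgue_tuple R n)%E mphi) X.
  apply: (@product_measure_unique _ _ _ _ _ _ _ (mscale _ _)) => // B C mB mC.
  transitivity ((r ^+ n.+1)%:E * (lebesgue_measure \x lebesgue_tuple R n)
      ((affine1 r (v 0%N) @^-1` B) `*` (affine_tuple r (v \o S) @^-1` C)))%E.
    by [].
  rewrite product_measure1E; last 2 first.
  - by rewrite -[X in measurable X]setTI; exact: measurable_affine1.
  - by rewrite -[X in measurable X]setTI; exact: measurable_affine_tuple.
  have /= H1 := lebesgue_measure_affine1 (v 0%N) r0 mB; have /= H2 := IHn (v \o S) C mC.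
  rewrite [X in (_ * (X * _))%E]H1 [X in (_ * (_ * X))%E]H2.
  have K (k a b : R) (x y : \bar R) : k * (a * b) = 1 ->
      (k%:E * ((a%:E * x) * (b%:E * y)) = x * y)%E.
    by move=> kab; rewrite (muleACA a%:E) -EFinM (muleA k%:E) -EFinM kab mul1e.
  apply: K.
  by rewrite -exprS -exprMn divff ?gt_eqF// expr1n.
have -> : lebesgue_tuple R n.+1 A =
    (lebesgue_measure \x lebesgue_tuple R n)%E (@tuple_cons R n @^-1` A) by [].
rewrite E// /mscale /= /pushforward muleA -EFinM.
rewrite -exprMn mulVf ?gt_eqF// expr1n mul1e /product_cons /pushforward.
congr (_ _); apply/seteqP.
have H q : affine_tuple r v (tuple_cons q) = tuple_cons (phi q).
  apply: eq_from_tnth => i; rewrite tnth_mktuple.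
  have [j ->|->] := unliftP ord0 i; last by rewrite !tnth0.
  by rewrite !tnthS tnth_mktuple.
by split => q /=; rewrite H.
Qed.

End affine_image.

(** * Integration over R^N *)

Section row_integral.
Context (R : realType) (N : nat).
Local Notation V := 'rV[R]_N.
Local Notation T := (N.-tuple (measurableTypeR R)).
Local Notation mu := (lebesgue_tuple R N).
Implicit Types (A B U : set V) (f g : V -> R) (c v x y : V) (r : R).

Definition row_of (t : T) : V := \row_(i < N) tnth t i.
(** The measure lives on tuples, so measurability on row vectors is defined by pulling back along
    [row_of]. *)
Definition mesV A := measurable (row_of @^-1` A).
Definition mrow f := measurable_fun [set: T] (f \o row_of).
Definition sq x : R := \sum_(i < N) x ord0 i ^+ 2.

Lemma sq_ge0 x : 0 <= sq x.
Proof. by apply: sumr_ge0 => i _; exact: sqr_ge0. Qed.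

Lemma sqr_coord_le x i : x ord0 i ^+ 2 <= sq x.
Proof.
rewrite /sq (bigD1 i)//= lerDl; apply: sumr_ge0 => j _; exact: sqr_ge0.
Qed.

Lemma mrow_coord i : mrow (fun x => x ord0 i).
Proof.
rewrite /mrow (_ : _ \o _ = (@tnth N _ ^~ i)); first exact: measurable_tnth.
by apply/funext => t /=; rewrite mxE.
Qed.

Lemma mrow_cst k : mrow (fun=> k).
Proof. exact: measurable_cst. Qed.

Lemma mrowD f g : mrow f -> mrow g -> mrow (fun x => f x + g x).
Proof. by move=> mf mg; exact: measurable_funD. Qed.

Lemma mrowB f g : mrow f -> mrow g -> mrow (fun x => f x - g x).
Proof. by move=> mf mg; exact: measurable_funB. Qed.

Lemma mrowM f g : mrow f -> mrow g -> mrow (fun x => f x * g x).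
Proof. by move=> mf mg; exact: measurable_funM. Qed.

Lemma mrowZ k f : mrow f -> mrow (fun x => k * f x).
Proof. by move=> mf; apply: mrowM => //; exact: mrow_cst. Qed.

Lemma mrow_sum (I : Type) (s : seq I) (F : I -> V -> R) :
  (forall i, mrow (F i)) -> mrow (fun x => \sum_(i <- s) F i x).
Proof. by move=> mF; apply: measurable_sum => i; exact: mF. Qed.

Lemma mrow_comp (k : R -> R) f : measurable_fun setT k -> mrow f ->
  mrow (fun x => k (f x)).
Proof. by move=> mk mf; apply: (measurableT_comp mk). Qed.

Lemma mrowX f n : mrow f -> mrow (fun x => f x ^+ n).
Proof. by move=> mf; exact: (measurable_funX n mf). Qed.

Lemma mrow_max f g : mrow f -> mrow g -> mrow (fun x => Num.max (f x) (g x)).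
Proof. by move=> mf mg; exact: measurable_maxr. Qed.

Lemma mesV_lt f g : mrow f -> mrow g -> mesV [set x | f x < g x].
Proof.
move=> mf mg; have := measurable_fun_ltr mf mg.
move=> /(_ measurableT [set true]) /(_ Logic.I); rewrite setTI /mesV.
by congr (measurable _); apply/seteqP; split.
Qed.

Lemma mesV_le f g : mrow f -> mrow g -> mesV [set x | f x <= g x].
Proof.
move=> mf mg; have := measurable_fun_ler mf mg.
move=> /(_ measurableT [set true]) /(_ Logic.I); rewrite setTI /mesV.
by congr (measurable _); apply/seteqP; split.
Qed.

Lemma mesVI A B : mesV A -> mesV B -> mesV (A `&` B).
Proof. by move=> *; exact: measurableI. Qed.

Lemma mesVU A B : mesV A -> mesV B -> mesV (A `|` B).
Proof. by move=> *; exact: measurableU. Qed.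

Lemma mesVD A B : mesV A -> mesV B -> mesV (A `\` B).
Proof. by move=> *; exact: measurableD. Qed.

Lemma mrow_indic A : mesV A -> mrow (\1_A : V -> R).
Proof.
move=> mA; rewrite /mrow (_ : _ \o _ = \1_(row_of @^-1` A)); last first.
  by apply/funext => t; rewrite /= !indicE; congr ((_ : bool)%:R); apply/idP/idP; rewrite !inE.
exact: measurable_indic.
Qed.

Lemma mesV_box c r : mesV [set y | forall i, `|y ord0 i - c ord0 i| < r].
Proof.
rewrite (_ : [set _ | _] = \bigcap_(i in [set: 'I_N])
    [set y | `|y ord0 i - c ord0 i| < r]); last first.
  by apply/seteqP; split => y /= H i; [move=> _|]; exact: H.
rewrite /mesV preimage_bigcap; apply: fin_bigcap_measurable => // i _.
apply: mesV_lt; last exact: mrow_cst.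
apply: (mrow_comp (k := fun s => `|s|)); first exact: normr_measurable.
by apply: mrowB; [exact: mrow_coord|exact: mrow_cst].
Qed.

(** An open set is the union of the rational boxes that it contains, and these are countably
    many. *)
Lemma mesV_open U : open U -> mesV U.
Proof.
move=> oU.
pose B (q : 'rV[rat]_N * rat) : set V :=
  [set y | forall i, `|y ord0 i - ratr (q.1 ord0 i)| < ratr q.2].
pose F q := if `[< B q `<=` U >] then B q else set0.
have -> : U = \bigcup_q F q.
  apply/seteqP; split => [x Ux|x [q _]]; last first.
    by rewrite /F; case: asboolP => [BU|]//; exact: BU.
  have /nbhs_ballP[e /= e0 xe] : nbhs x U by apply: open_nbhs_nbhs; split.
  have e20 : 0 < e / 2 by rewrite divr_gt0.
  have [s] := rat_in_itvoo e20; rewrite in_itv /= => /andP[s0 se].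
  have H i : {q : rat | `|x ord0 i - ratr q| < ratr s}.
    apply: cid.
    have : x ord0 i - ratr s < x ord0 i + ratr s by lra.
    move=> /rat_in_itvoo[q]; rewrite in_itv /= => /andP[h1 h2].
    by exists q; rewrite distrC ltr_distl h1 h2.
  exists (\row_i sval (H i), s) => //.
  rewrite /F; case: asboolP => [_ i|nBU]; first by rewrite /= mxE; case: (H i).
  exfalso; apply: nBU => y By; apply: xe => /=; split=> // i j; rewrite !(ord1 i).
  have /= := By j; rewrite mxE; case: (H j) => q /= hq hy.
  rewrite /ball /=; move: hq hy; rewrite !ltr_norml.
  by move=> /andP[? ?] /andP[? ?]; apply/andP; split; lra.
rewrite /mesV preimage_bigcup; apply: countable_bigcupT_measurable => [|q].
  exact: countableP.
rewrite /F; case: asboolP => BU; last by rewrite preimage_set0.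
rewrite (_ : B q = [set y | forall i, `|y ord0 i - (map_mx ratr q.1 : V) ord0 i| < ratr q.2]).
  exact: mesV_box.
by apply/seteqP; split => y H i; have := H i; rewrite mxE.
Qed.

End row_integral.
Arguments row_of {R N} t.

Section int_row.
Context (R : realType) (N : nat).
Local Notation V := 'rV[R]_N.
Local Notation T := (N.-tuple (measurableTypeR R)).
Local Notation mu := (lebesgue_tuple R N).
Implicit Types (A B U : set V) (f g : V -> R) (c v x y : V) (r : R).

Lemma vol_row_of A : vol A = fine (mu (@row_of R N @^-1` A)).
Proof. by []. Qed.

(** Bounded, measurable, of bounded support: a class stable under sums, products and shifts on which
    every integral is finite. A single [M] bounds both the values and [sq] on the support. *)
Definition tame f := mrow f /\
  exists M : R, forall x, `|f x| <= M /\ (M < sq x -> f x = 0).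

Lemma intV_spec : {I : (V -> R) -> R | forall f, I f = \int[mu]_t f (row_of t)}.
Proof. by exists (fun f => \int[mu]_t f (row_of t)). Qed.

(* Sealed: unification would otherwise compare integrals by unfolding them. *)
Definition intV : (V -> R) -> R := sval intV_spec.

Lemma intVE f : intV f = \int[mu]_t f (row_of t).
Proof. exact: (svalP intV_spec). Qed.

Let box M : set T := [set t | forall i : 'I_N, `]- (M + 1), M + 1]%classic (tnth t i)].

Let mbox M : measurable (box M).
Proof.
rewrite (_ : box M = \bigcap_(i in [set: 'I_N]) ((@tnth N (measurableTypeR R) ^~ i) @^-1`
  `]- (M + 1), M + 1]%classic)); last first.
  by apply/seteqP; split => t /= H i; [move=> _|]; exact: H.
apply: fin_bigcap_measurable => // i _.
by rewrite -[X in measurable X]setTI; apply: measurable_tnth.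
Qed.

Let box_lty M : (mu (box M) < +oo)%E.
Proof.
rewrite (@lebesgue_tuple_box R N (fun=> `]- (M + 1), M + 1]%classic)) //.
set p := (X in (X < _)%E); suff /andP[] : ((0 <= p) && (p < +oo))%E by [].
rewrite {}/p; elim/big_ind : _ => [||i _]; first by rewrite lee_fin ler01 ltry.
- move=> x y /andP[x0 xoo] /andP[y0 yoo].
  by rewrite mule_ge0//= lte_mul_pinfty// ge0_fin_numE.
- by rewrite measure_ge0/= lebesgue_measure_itv; case: ifP => _; rewrite ?ltry.
Qed.

Let notbox M t : 0 <= M -> ~ box M t -> M < sq (row_of t : V).
Proof.
move=> M0 /existsNP[i] /= /negP; rewrite in_itv /= => h.
apply: (lt_le_trans _ (sqr_coord_le (row_of t : V) i)); rewrite mxE.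
rewrite ltNge; apply: contra h => h; set s := tnth t i in h *.
by apply/andP; split; nra.
Qed.

Lemma tame_integrable f : tame f -> mu.-integrable setT (EFin \o (f \o @row_of R N)).
Proof.
move=> [mf [M HM]].
have M0 : 0 <= M by have [h _] := HM 0; exact: (le_trans (normr_ge0 _) h).
rewrite (_ : EFin \o _ = (EFin \o (f \o @row_of R N)) \_ (box M)).
  apply/(integrable_mkcond _ (mbox M)).
  apply: (measurable_bounded_integrable (mbox M) (box_lty M)).
    exact: measurable_funTS.
  exists M; split; first exact: num_real.
  by move=> y My t _ /=; rewrite (le_trans (proj1 (HM _)))// ltW.
apply/funext => t /=; rewrite patchE; case: ifPn => // /negP.
by rewrite inE => /(notbox M0)/(proj2 (HM _)) ->.
Qed.

Lemma intVD f g : tame f -> tame g -> intV (fun x => f x + g x) = intV f + intV g.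
Proof. by move=> tf tg; rewrite !intVE; apply: RintegralD => //; exact: tame_integrable. Qed.

Lemma intVB f g : tame f -> tame g -> intV (fun x => f x - g x) = intV f - intV g.
Proof. by move=> tf tg; rewrite !intVE; apply: RintegralB => //; exact: tame_integrable. Qed.

Lemma intVZ k f : tame f -> intV (fun x => k * f x) = k * intV f.
Proof. by move=> tf; rewrite !intVE; apply: RintegralZl => //; exact: tame_integrable. Qed.

Lemma le_intV f g : tame f -> tame g -> (forall x, f x <= g x) -> intV f <= intV g.
Proof. by move=> tf tg fg; rewrite !intVE; apply: le_Rintegral => //; exact: tame_integrable. Qed.

Lemma eq_intV f g : f =1 g -> intV f = intV g.
Proof. by move=> fg; congr intV; apply/funext. Qed.

Lemma intV_ge0 f : (forall x, 0 <= f x) -> 0 <= intV f.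
Proof. by move=> f0; rewrite intVE; apply: Rintegral_ge0. Qed.

Lemma tame0 : tame (fun=> 0).
Proof.
by split; [exact: mrow_cst|exists 0 => x; rewrite normr0].
Qed.

Lemma tameD f g : tame f -> tame g -> tame (fun x => f x + g x).
Proof.
move=> [mf [M HM]] [mg [K HK]]; split; first exact: mrowD.
have M0 : 0 <= M by have [h _] := HM 0; exact: (le_trans (normr_ge0 _) h).
have K0 : 0 <= K by have [h _] := HK 0; exact: (le_trans (normr_ge0 _) h).
exists (M + K) => x; split.
  by rewrite (le_trans (ler_normD _ _))// lerD//; [case: (HM x)|case: (HK x)].
by move=> h; rewrite (proj2 (HM x)) ?(proj2 (HK x)) ?addr0//; lra.
Qed.

(** The bound on [g] is asked only where [f] does not vanish, so that [g] may be a kernel or a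
    distance function, unbounded on the whole space. *)
Lemma tameM f g : tame f -> mrow g ->
  (exists K, forall x, f x != 0 -> `|g x| <= K) -> tame (fun x => f x * g x).
Proof.
move=> [mf [M HM]] mg [K HK]; split; first exact: mrowM.
have M0 : 0 <= M by have [h _] := HM 0; exact: (le_trans (normr_ge0 _) h).
exists (M * `|K| + M) => x; split; last first.
  move=> h; rewrite (proj2 (HM x)) ?mul0r//.
  by apply: le_lt_trans h; rewrite lerDr mulr_ge0.
rewrite normrM; have [->|fx0] := eqVneq (f x) 0.
  by rewrite normr0 mul0r addr_ge0// mulr_ge0.
apply: (@le_trans _ _ (M * `|K|)); last by rewrite lerDl.
by rewrite ler_pM//; [case: (HM x)|apply: le_trans (HK x fx0) (ler_norm _)].
Qed.

Lemma tameMt f g : tame f -> tame g -> tame (fun x => f x * g x).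
Proof.
by move=> tf [mg [K HK]]; apply: tameM => //; exists K => x _; case: (HK x).
Qed.

Lemma tameZ k f : tame f -> tame (fun x => k * f x).
Proof.
move=> tf; rewrite (_ : (fun _ => _) = (fun x => f x * (fun=> k) x)).
  by apply: tameM => //; [exact: mrow_cst|exists `|k|].
by apply/funext => x; rewrite mulrC.
Qed.

Lemma tameB f g : tame f -> tame g -> tame (fun x => f x - g x).
Proof.
move=> tf tg; rewrite (_ : (fun _ => _) = (fun x => f x + (-1) * g x)).
  by apply: tameD => //; exact: tameZ.
by apply/funext => x; rewrite mulN1r.
Qed.

Lemma tame_sum (I : Type) (s : seq I) (F : I -> V -> R) :
  (forall i, tame (F i)) -> tame (fun x => \sum_(i <- s) F i x).
Proof.
move=> tF; elim: s => [|i s IH].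
  rewrite (_ : (fun _ => _) = fun=> 0); first exact: tame0.
  by apply/funext => x; rewrite big_nil.
rewrite (_ : (fun _ => _) = fun x => F i x + \sum_(j <- s) F j x).
  exact: tameD.
by apply/funext => x; rewrite big_cons.
Qed.

Lemma intV0 : intV (fun=> 0) = 0.
Proof. by rewrite intVE Rintegral_cst// mul0r. Qed.

Lemma intV_sum (I : Type) (s : seq I) (F : I -> V -> R) :
  (forall i, tame (F i)) ->
  intV (fun x => \sum_(i <- s) F i x) = \sum_(i <- s) intV (F i).
Proof.
move=> tF; elim: s => [|i s IH].
  by rewrite big_nil -[RHS]intV0; apply: eq_intV => x; rewrite big_nil.
rewrite big_cons -IH -intVD//; last exact: tame_sum.
by apply: eq_intV => x; rewrite big_cons.
Qed.

Definition bounded_sq A := exists M, forall x, A x -> sq x <= M.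

Lemma tame_indic A : mesV A -> bounded_sq A -> tame (\1_A : V -> R).
Proof.
move=> mA [M HM]; split; first exact: mrow_indic.
exists (Num.max M 1) => x; rewrite indicE; split.
  by rewrite le_max; apply/orP; right; case: (_ \in _); rewrite ?normr0 ?normr1.
rewrite gt_max => /andP[h _]; case: (boolP (x \in A)) => // /set_mem/HM.
by rewrite leNgt h.
Qed.

Lemma intV_indic A : mesV A -> intV (\1_A : V -> R) = vol A.
Proof.
move=> mA; rewrite intVE vol_row_of /Rintegral; congr fine.
rewrite -[in RHS](setIT (row_of @^-1` A)) -integral_indic//.
Qed.

(** The coordinates of [v] as a function on the natural numbers, the form that [affine_tuple] takes;
    0 is the default value from index [N] on. *)
Definition cvec v (k : nat) : R := oapp (v ord0) 0 (insub k : option 'I_N).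

Lemma row_of_affine r v t : row_of (affine_tuple r (cvec v) t) = r *: (row_of t : V) + v.
Proof.
apply/rowP => i; rewrite !mxE tnth_mktuple /affine1 /cvec.
by rewrite insubT//= => ?; congr (_ + v _ _); apply: val_inj.
Qed.

Lemma tame_shift f v : tame f -> tame (fun x => f (x + v)).
Proof.
move=> [mf [M HM]]; split.
  rewrite /mrow (_ : _ \o _ = (f \o @row_of R N) \o affine_tuple 1 (cvec v)); last first.
    by apply/funext => t /=; rewrite row_of_affine scale1r.
  apply: measurableT_comp => //; exact: measurable_affine_tuple.
have M0 : 0 <= M by have [h _] := HM 0; exact: (le_trans (normr_ge0 _) h).
exists (2 * M + 2 * sq v) => x; split.
  rewrite (le_trans (proj1 (HM _)))// -[leLHS]addr0 lerD//; last first.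
    by rewrite mulr_ge0// sq_ge0.
  by rewrite ler_peMl// ler1n.
move=> h; apply: (proj2 (HM _)).
have : sq x <= 2 * sq (x + v) + 2 * sq v.
  rewrite /sq !mulr_sumr -big_split /=; apply: ler_sum => i _; rewrite !mxE.
  rewrite -subr_ge0 [leRHS](_ : _ = (x ord0 i + 2 * v ord0 i) ^+ 2) ?sqr_ge0//; ring.
lra.
Qed.

Lemma intV_shift f v : tame f -> intV (fun x => f (x + v)) = intV f.
Proof.
move=> tf; rewrite !intVE /Rintegral; congr fine.
have mF : measurable_fun setT (EFin \o (f \o @row_of R N)).
  by apply/measurable_EFinP; case: tf.
have maff := @measurable_affine_tuple R N 1 (cvec v).
transitivity (\int[mu]_(t in affine_tuple 1 (cvec v) @^-1` setT)
    ((EFin \o (f \o @row_of R N)) \o affine_tuple 1 (cvec v)) t)%E.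
  rewrite preimage_setT; apply: eq_integral => t _ /=.
  by rewrite row_of_affine scale1r.
rewrite -(integral_pushforward maff)//; last first.
  rewrite preimage_setT.
  have := tame_integrable (tame_shift v tf).
  rewrite (_ : EFin \o _ = (EFin \o (f \o @row_of R N)) \o affine_tuple 1 (cvec v))//.
  by apply/funext => t /=; rewrite row_of_affine scale1r.
apply: (@eq_measure_integral _ _ _ setT mu (push_measure mu maff)) => A mA _.
have := lebesgue_tuple_affine (cvec v) (@ltr01 R) mA.
by rewrite invr1 expr1n mul1e => h; rewrite -[RHS]h.
Qed.

Lemma bounded_fin_num A : mesV A -> bounded_sq A -> mu (row_of @^-1` A) \is a fin_num.
Proof.
move=> mA [M HM]; rewrite ge0_fin_numE//.
apply: (le_lt_trans _ (box_lty `|M|)); apply: le_measure; rewrite ?inE//.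
move=> t /= /HM h; apply: contrapT => /(notbox (normr_ge0 _)).
by rewrite ltNge (le_trans h)// ler_norm.
Qed.

Lemma vol_ge0 A : 0 <= vol A.
Proof. by rewrite /vol fine_ge0. Qed.

Lemma le_vol A B : mesV A -> mesV B -> bounded_sq B -> A `<=` B -> vol A <= vol B.
Proof.
move=> mA mB [M HM] AB; rewrite -!intV_indic//; apply: le_intV.
- by apply: tame_indic => //; exists M => x /AB; exact: HM.
- by apply: tame_indic => //; exists M.
by move=> x; rewrite !indicE; case: (boolP (x \in A)) => [/set_mem/AB/mem_set ->//|_].
Qed.

Lemma mesV_sqlt c r : mesV [set x | sq (x - c) < r].
Proof.
apply: mesV_lt; last exact: mrow_cst.
apply: mrow_sum => i; apply: mrowX.
rewrite (_ : (fun _ => _) = (fun x => x ord0 i - c ord0 i)).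
  by apply: mrowB; [exact: mrow_coord|exact: mrow_cst].
by apply/funext => x; rewrite !mxE.
Qed.

Lemma eballE c r : 0 < r -> eball c r = [set x | sq (x - c) < r ^+ 2].
Proof.
move=> r0; apply/seteqP; split => x; rewrite /eball /enorm /= -/(sq _) => h.
  rewrite -(sqr_sqrtr (sq_ge0 _)) ltrXn2r// ?nnegrE ?sqrtr_ge0//; exact: ltW.
rewrite -(ger0_norm (ltW r0)) -sqrtr_sqr ltr_sqrt// exprn_gt0//.
Qed.

Lemma mesV_eball c r : mesV (eball c r).
Proof.
have [r0|r0] := ltP 0 r; first by rewrite eballE//; exact: mesV_sqlt.
rewrite (_ : eball c r = set0); first exact: measurable0.
apply/seteqP; split => // x; rewrite /eball /= => /lt_le_trans/(_ r0).
by rewrite ltNge /enorm sqrtr_ge0.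
Qed.

Lemma vol_eball c r : 0 < r -> vol (eball c r) = r ^+ N * omegaN R N.
Proof.
move=> r0; rewrite /omegaN !vol_row_of.
have mB : measurable (@row_of R N @^-1` eball c r) by exact: mesV_eball.
have := lebesgue_tuple_affine (cvec c) r0 mB.
rewrite (_ : _ @^-1` _ = @row_of R N @^-1` eball 0 1); last first.
  rewrite !eballE//; apply/seteqP; split => t /=; rewrite row_of_affine addrK subr0 expr1n;
    rewrite (_ : sq (r *: _) = r ^+ 2 * sq (row_of t : V)) ?gtr_pMr ?exprn_gt0//;
    by rewrite /sq mulr_sumr; apply: eq_bigr => i _; rewrite mxE exprMn.
move=> ->; rewrite fineM//; last first.
  apply: bounded_fin_num => //; exists (2 * r ^+ 2 + 2 * sq c) => x.
  rewrite eballE//= => /ltW h; have : sq x <= 2 * sq (x - c) + 2 * sq c; last by lra.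
  rewrite /sq !mulr_sumr -big_split /=; apply: ler_sum => i _; rewrite !mxE.
  by rewrite -subr_ge0 [leRHS](_ : _ = (x ord0 i - 2 * c ord0 i) ^+ 2) ?sqr_ge0//; ring.
by rewrite /= mulrA -exprMn divff ?gt_eqF// expr1n mul1r.
Qed.

Lemma bounded_sq_eball c r : bounded_sq (eball c r).
Proof.
exists (2 * r ^+ 2 + 2 * sq c) => x; have [r0|r0] := ltP 0 r; last first.
  by rewrite /eball /= => /lt_le_trans/(_ r0); rewrite ltNge /enorm sqrtr_ge0.
rewrite eballE//= => /ltW h; have : sq x <= 2 * sq (x - c) + 2 * sq c; last by lra.
rewrite /sq !mulr_sumr -big_split /=; apply: ler_sum => i _; rewrite !mxE.
by rewrite -subr_ge0 [leRHS](_ : _ = (x ord0 i - 2 * c ord0 i) ^+ 2) ?sqr_ge0//; ring.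
Qed.

(** The unit ball contains the cube of half-side s = 1 / (N + 1), because N s^2 <= N s < 1. *)
Lemma omegaN_gt0 : 0 < omegaN R N.
Proof.
pose s : R := (N.+1%:R)^-1.
have s0 : 0 < s by rewrite invr_gt0 ltr0n.
have s1 : N%:R * s < 1 by rewrite /s ltr_pdivrMr ?ltr0n// mul1r ltr_nat.
pose A : set V := [set x | forall i : 'I_N, `]- s, s]%classic (x ord0 i)].
have mA : measurable (row_of @^-1` A : set T).
  rewrite (_ : _ @^-1` _ = \bigcap_(i in [set: 'I_N]) ((@tnth N (measurableTypeR R) ^~ i) @^-1`
    `]- s, s]%classic)); last first.
    by apply/seteqP; split => t /= H i; [move=> _|]; have := H i; rewrite ?mxE//; exact.
  apply: fin_bigcap_measurable => // i _.
  by rewrite -[X in measurable X]setTI; apply: measurable_tnth.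
have AB : A `<=` eball 0 1.
  move=> x Ax; rewrite eballE//= subr0 expr1n; apply: le_lt_trans s1.
  rewrite (_ : N%:R * s = \sum_(i < N) s); last by rewrite sumr_const card_ord mulr_natl.
  apply: ler_sum => i _; have := Ax i; rewrite /= in_itv /= => /andP[h1 h2].
  have : s <= 1 by rewrite /s invf_le1 ?ltr0n// ler1n.
  by nra.
have -> : 0 = 0 :> R by [].
have vA : vol A = (2 * s) ^+ N.
  rewrite vol_row_of (_ : _ @^-1` _ = [set t | forall i : 'I_N, `]- s, s]%classic (tnth t i)]); last first.
    by apply/seteqP; split => t /= H i; have := H i; rewrite ?mxE.
  rewrite (@lebesgue_tuple_box R N (fun=> `]- s, s]%classic))//.
  rewrite (eq_bigr (fun=> (2 * s)%:E)); last first.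
    move=> i _; rewrite /= lebesgue_measure_itv /= lte_fin ifT; last by lra.
    by rewrite -EFinD opprK mulr_natl mulr2n.
  elim: (N) => [|n IHn]; first by rewrite big_ord0.
  rewrite big_ord_recr /= fineM//; first by rewrite IHn exprSr.
  by elim/big_ind : _ => // *; exact: fin_numM.
have : 0 < vol A by rewrite vA exprn_gt0// mulr_gt0.
move=> /lt_le_trans; apply; apply: le_vol => //; first exact: mesV_eball.
exact: bounded_sq_eball.
Qed.

End int_row.

(** * The fundamental solution *)

Section power.
Context (R : realType).
Implicit Types (s m x y u : R).

(** The real power m^s for m > 0, written so that derivative, monotonicity and measurability come
    from [expR] and [ln]. *)
Definition pw s m : R := expR (s * ln m).

Lemma pw_gt0 s m : 0 < pw s m. Proof. exact: expR_gt0. Qed.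

Lemma is_derive_pw s m : 0 < m -> is_derive m 1 (pw s) (s * pw s m / m).
Proof.
move=> m0; rewrite (_ : pw s = expR \o (s \*: (@ln R))); last by apply/funext.
have d1 := is_derive1_ln m0.
have d2 : is_derive m 1 (s \*: (@ln R)) (s *: m^-1) by exact: is_deriveZ.
have := @is_derive1_comp _ expR (s \*: (@ln R)) m _ _ (is_derive_expR _) d2.
rewrite (_ : _ * (s *: m^-1) = s * pw s m / m)//.
by rewrite /pw /GRing.scale /=; ring.
Qed.

Lemma pw_le s x y : s <= 0 -> 0 < x -> x <= y -> pw s y <= pw s x.
Proof.
move=> s0 x0 xy; rewrite /pw ler_expR ler_wnM2l// ler_ln// posrE.
exact: lt_le_trans xy.
Qed.

Lemma pwS s m : 0 < m -> pw (s - 1) m = pw s m / m.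
Proof.
by move=> m0; rewrite /pw mulrBl mul1r expRD expRN lnK// posrE.
Qed.

Lemma pwMr s x y : 0 < x -> 0 < y -> pw s (x * y) = pw s x * pw s y.
Proof. by move=> x0 y0; rewrite /pw lnM// mulrDr expRD. Qed.

Lemma pw_sqr s x : 0 < x -> pw s (x ^+ 2) = pw (2 * s) x.
Proof.
by move=> x0; rewrite expr2 pwMr// /pw -expRD -mulrDl mulr_natl mulr2n.
Qed.

Lemma pwNn (n : nat) x : 0 < x -> pw (- n%:R) x = (x ^+ n)^-1.
Proof.
by move=> x0; rewrite /pw mulNr expRN expRM_natl lnK.
Qed.

(** The two points may come in either order or coincide, as they do when increments of both signs
    are expanded. *)
Lemma mvt_ge (f df : R -> R) (m1 x y : R) :
  (forall z, m1 <= z -> is_derive z 1 f (df z)) -> m1 <= x -> m1 <= y ->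
  exists2 c, [/\ m1 <= c & `|c - x| <= `|y - x|] & f y - f x = df c * (y - x).
Proof.
move=> fdf m1x m1y.
have cf a b : m1 <= a -> {within `[a, b], continuous f}.
  move=> m1a; apply: derivable_within_continuous => z.
  rewrite in_itv /= => /andP[az _]; apply: ex_derive.
  by apply: fdf; exact: le_trans az.
have H a b z : m1 <= a -> z \in `]a, b[ -> is_derive z 1 f (df z).
  by move=> m1a; rewrite in_itv /= => /andP[az _]; apply: fdf; lra.
have [xy|yx|->] := ltgtP x y.
- have [c] := MVT xy (fun z => H x y z m1x) (cf x y m1x).
  rewrite in_itv /= => /andP[? ?] e; exists c => //; split; first by lra.
  by rewrite !gtr0_norm; lra.
- have [c] := MVT yx (fun z => H y x z m1y) (cf y x m1y).
  rewrite in_itv /= => /andP[? ?] e; exists c; last by lra.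
  split; first by lra.
  by rewrite !ltr0_norm; lra.
- by exists y; [rewrite !subrr|rewrite !subrr mulr0].
Qed.

End power.

Section fundamental.
Context (R : realType) (N : nat).
Implicit Types (m u : R).

Definition kap : R := if N == 2 then 1 else (N - 2)%:R.

(* As functions of [m = |x|^2]: [gam] is the fundamental solution [Gamma_N] and
   [- kap * en m *: x] its gradient. *)
Definition gam m : R :=
  if N == 2 then - ln m / 2 else pw (- ((N - 2)%:R / 2)) m.

Definition en m : R := pw (- (N%:R / 2)) m.

Lemma en_gt0 m : 0 < en m. Proof. exact: pw_gt0. Qed.

Lemma en_sqr t : 0 < t -> en (t ^+ 2) = (t ^+ N)^-1.
Proof.
move=> t0; rewrite /en pw_sqr// (_ : 2 * _ = - N%:R); last by field.
by rewrite pwNn.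
Qed.

Lemma en_le m1 m : 0 < m1 -> m1 <= m -> en m <= en m1.
Proof. by move=> *; apply: pw_le => //; rewrite oppr_le0. Qed.

Lemma kap_gt0 : (2 <= N)%N -> 0 < kap.
Proof.
by move=> N2; rewrite /kap; case: eqVneq => // h; rewrite ltr0n subn_gt0 ltn_neqAle eq_sym h.
Qed.

Lemma kap_le : (2 <= N)%N -> kap <= N%:R - 1.
Proof.
move=> N2; rewrite /kap; case: eqVneq => [->|h]; first by rewrite lerBrDr.
by rewrite lerBrDr natr1 ler_nat -subSn// subSS leq_subr.
Qed.

Lemma is_derive_gam m : (2 <= N)%N -> 0 < m ->
  is_derive m 1 gam (- (kap / 2) * en m).
Proof.
move=> N2 m0; rewrite /gam /kap /en; case: eqVneq => [->|h].
  rewrite (_ : (fun _ => _) = (- 2^-1) \*: (@ln R)); last first.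
    by apply/funext => x; rewrite /= /GRing.scale /=; ring.
  have := is_deriveZ (- 2^-1) (is_derive1_ln m0).
  rewrite (_ : _ *: _ = - (1 / 2) * pw (- (2 / 2)) m)//.
  by rewrite divff// (pwNn 1 m0) expr1 /GRing.scale /=; field; rewrite gt_eqF.
rewrite (_ : (fun _ => _) = pw (- ((N - 2)%:R / 2))); last by apply/funext.
have := is_derive_pw (- ((N - 2)%:R / 2)) m0.
rewrite -mulrA -pwS// (_ : - ((N - 2)%:R / 2) - 1 = - (N%:R / 2))//.
by rewrite natrB//; field.
Qed.

(** Up to the factor - N / 2, the derivative of [en]. *)
Definition en1 m : R := pw (- (N%:R / 2) - 1) m.

Lemma en1_gt0 m : 0 < en1 m. Proof. exact: pw_gt0. Qed.

Lemma en1E m : 0 < m -> en1 m = en m / m. Proof. exact: pwS. Qed.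

Lemma en1_le m1 m : 0 < m1 -> m1 <= m -> en1 m <= en1 m1.
Proof.
move=> *; apply: pw_le => //; rewrite -opprD oppr_le0 addr_ge0//.
Qed.

Lemma is_derive_en m : 0 < m -> is_derive m 1 en (- (N%:R / 2) * en1 m).
Proof.
by move=> m0; have := is_derive_pw (- (N%:R / 2)) m0; rewrite -mulrA -pwS.
Qed.

Lemma en_lip m1 : 0 < m1 -> exists2 C : R, 0 < C & forall m m',
  m1 <= m -> m1 <= m' -> `|en m' - en m| <= C * `|m' - m|.
Proof.
move=> m10; exists (N%:R / 2 * en1 m1 + 1).
  by rewrite ltr_wpDl// mulr_ge0// ltW// en1_gt0.
move=> m m' h h'.
have [c [h1 _] ->] := mvt_ge (fun z hz => is_derive_en (lt_le_trans m10 hz)) h h'.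
rewrite normrM ler_wpM2r// normrM normrN [`|_ / _|]ger0_norm//.
rewrite (ger0_norm (ltW (en1_gt0 _))) ler_wpDr//.
by rewrite ler_wpM2l// en1_le.
Qed.

Lemma en1_lip m1 : 0 < m1 -> exists2 C : R, 0 < C & forall m m',
  m1 <= m -> m1 <= m' -> `|en1 m' - en1 m| <= C * `|m' - m|.
Proof.
move=> m10; exists ((N%:R / 2 + 1) * (en1 m1 / m1) + 1).
  by rewrite ltr_wpDl// mulr_ge0// ?addr_ge0// divr_ge0// ltW// en1_gt0.
move=> m m' h h'.
have [c [h1 _] e] := mvt_ge (fun z hz => is_derive_pw (- (N%:R / 2) - 1) (lt_le_trans m10 hz)) h h'.
rewrite /en1 {}e.
have c0 : 0 < c by exact: lt_le_trans h1.
rewrite -/(en1 c).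
rewrite (_ : _ * en1 c / c = - ((N%:R / 2 + 1) * (en1 c / c))); last by ring.
have p0 : 0 <= en1 c / c by rewrite divr_ge0 ?(ltW c0)// ltW// en1_gt0.
have Q : en1 c / c <= en1 m1 / m1.
  by rewrite ler_pM ?en1_le ?lef_pV2 ?posrE ?invr_ge0 ?(ltW c0) ?(ltW (en1_gt0 c)).
have P : 0 <= (N%:R / 2 + 1) * (en1 c / c) by apply: mulr_ge0 => //; exact: addr_ge0.
by rewrite normrM ler_wpM2r// normrN ger0_norm// ler_wpDr// ler_wpM2l// addr_ge0.
Qed.

Hypothesis N2 : (2 <= N)%N.

Lemma gam_mvt m1 m m' : 0 < m1 -> m1 <= m -> m1 <= m' ->
  exists2 c, [/\ m1 <= c & `|c - m| <= `|m' - m|] &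
    gam m' - gam m = - (kap / 2) * en c * (m' - m).
Proof.
move=> m10 h h'.
exact: (mvt_ge (fun z hz => is_derive_gam N2 (lt_le_trans m10 hz)) h h').
Qed.

Lemma gam_lip m1 m m' : 0 < m1 -> m1 <= m -> m1 <= m' ->
  `|gam m' - gam m| <= kap / 2 * en m1 * `|m' - m|.
Proof.
move=> m10 h h'; have [c [h1 _] ->] := gam_mvt m10 h h'.
have k0 := kap_gt0 N2.
have k2 : 0 <= kap / 2 by rewrite divr_ge0// ltW.
have p : 0 <= kap / 2 * en c by rewrite mulr_ge0// ltW// en_gt0.
by rewrite normrM ler_wpM2r// mulNr normrN ger0_norm// ler_wpM2l// en_le.
Qed.

Lemma gam_le m m' : 0 < m -> m <= m' -> gam m' <= gam m.
Proof.
move=> m0 h; have [c [h1 _]] := gam_mvt m0 (lexx _) h.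
have : 0 <= kap / 2 * en c * (m' - m).
  by rewrite !mulr_ge0 ?subr_ge0// ltW ?en_gt0 ?kap_gt0.
lra.
Qed.

(* convexity of [gam] *)
Lemma gam_ge_tangent m m' : 0 < m -> m <= m' ->
  kap / 2 * en m' * (m' - m) <= gam m - gam m'.
Proof.
move=> m0 h; have [c [h1 h2]] := gam_mvt m0 (lexx _) h.
have cm' : c <= m'.
  by move: h2; rewrite (ger0_norm (x := m' - m)) ?subr_ge0// ger0_norm ?subr_ge0// lerD2r.
have := en_le (lt_le_trans m0 h1) cm'; have k0 := kap_gt0 N2.
move=> e E; have : 0 <= (en c - en m') * (m' - m) * (kap / 2).
  by rewrite !mulr_ge0// ?subr_ge0// ltW// divr_gt0.
by lra.
Qed.

Lemma gam_taylor1 m1 : 0 < m1 -> exists2 C : R, 0 < C & forall m u,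
  m1 <= m -> m1 <= m + u ->
  `|gam (m + u) - gam m + kap / 2 * en m * u| <= C * u ^+ 2.
Proof.
move=> m10; have [C C0 HC] := en_lip m10; have k0 := kap_gt0 N2.
exists (kap / 2 * C); first by rewrite mulr_gt0// divr_gt0.
move=> m u h h'; have [c [h1 h2] e] := gam_mvt m10 h h'.
rewrite e (_ : _ + _ = - (kap / 2) * ((en c - en m) * u)); last by ring.
have k2 : 0 <= kap / 2 by rewrite divr_ge0// ltW.
rewrite normrM normrN (ger0_norm k2) -(mulrA _ C) ler_wpM2l// normrM.
rewrite (_ : C * u ^+ 2 = (C * `|u|) * `|u|); last first.
  by rewrite -(real_normK (num_real u)) expr2 mulrA.
rewrite ler_wpM2r//; apply: (le_trans (HC _ _ h h1)).
rewrite ler_wpM2l ?(ltW C0)//.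
by move: h2; rewrite (_ : m + u - m = u)//; ring.
Qed.

(** The second derivative of [gam] is (kap N / 4) [en1], whence the coefficient kap N / 8. The mean
    value theorem is applied to the difference with the Taylor polynomial, then to [en]; the
    Lipschitz bound on [en1] gives the cubic error. *)
Lemma gam_taylor2 m1 : 0 < m1 -> exists2 C : R, 0 < C & forall m u,
  m1 <= m -> m1 <= m + u ->
  `|gam (m + u) - gam m + kap / 2 * en m * u - kap * N%:R / 8 * en1 m * u ^+ 2|
    <= C * `|u| ^+ 3.
Proof.
move=> m10; have [C C0 HC] := en1_lip m10; have k0 := kap_gt0 N2.
exists (kap / 2 * (N%:R / 2 * C) + 1).
  by rewrite ltr_wpDl// ?mulr_ge0// ltW.
move=> m u h h'.
have m0 : 0 < m by exact: lt_le_trans h.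
pose F y := gam y + kap / 2 * en m * y - kap * N%:R / 8 * en1 m * (y - m) ^+ 2.
pose F' y := - (kap / 2) * en y + kap / 2 * en m - kap * N%:R / 4 * en1 m * (y - m).
have dF z : m1 <= z -> is_derive z 1 F (F' z).
  move=> hz; have z0 : 0 < z by exact: lt_le_trans hz.
  have d1 := is_derive_gam N2 z0.
  have d2 : is_derive z 1 ((kap / 2 * en m) \*: (@id R)) ((kap / 2 * en m) *: 1).
    exact: is_deriveZ.
  have d3 : is_derive z 1 ((@id R) - cst m) (1 - 0) by exact: is_deriveB.
  have d4 := is_deriveZ (kap * N%:R / 8 * en1 m) (is_deriveX 2 d3).
  have d5 := is_deriveB (is_deriveD d1 d2) d4.
  have -> : F = gam + ((kap / 2 * en m) \*: (@id R)) -
      ((kap * N%:R / 8 * en1 m) \*: ((@id R) - cst m) ^+ 2).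
    by apply/funext => y.
  rewrite (_ : F' z = - (kap / 2) * en z + (kap / 2 * en m) *: 1 -
     (kap * N%:R / 8 * en1 m) *: ((2%:R * ((@id R) - cst m) z ^+ 2.-1) *: (1 - 0)))//.
  have -> : ((@id R) - cst m) z = z - m by [].
  by rewrite /F' /GRing.scale /= expr1 subr0 !mulr1; field.
have [c [h1 h2] e] := mvt_ge dF h h'.
have [c' [h1' h2'] e'] := mvt_ge (fun z hz => is_derive_en (lt_le_trans m10 hz)) h h1.
have -> : gam (m + u) - gam m + kap / 2 * en m * u - kap * N%:R / 8 * en1 m * u ^+ 2
    = F (m + u) - F m by rewrite /F; ring.
have E1 : m + u - m = u by ring.
rewrite e /F'.
have -> : - (kap / 2) * en c + kap / 2 * en m - kap * N%:R / 4 * en1 m * (c - m)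
   = - (kap / 2) * (en c - en m) - kap * N%:R / 4 * en1 m * (c - m) by ring.
rewrite e'.
have -> : (- (kap / 2) * (- (N%:R / 2) * en1 c' * (c - m)) -
    kap * N%:R / 4 * en1 m * (c - m)) * (m + u - m) =
    (kap / 2) * (N%:R / 2) * ((en1 c' - en1 m) * ((c - m) * u)).
  by rewrite E1; field.
rewrite E1 in h2.
apply: (@le_trans _ _ (kap / 2 * (N%:R / 2 * C) * `|u| ^+ 3)); last first.
  by rewrite ler_wpM2r// ?exprn_ge0// lerDl.
rewrite normrM [X in X * _]ger0_norm ?mulr_ge0 ?divr_ge0 ?(ltW k0)//.
rewrite -!mulrA ler_wpM2l ?(ltW k0)// ler_wpM2l// ler_wpM2l// ler_wpM2l//.
rewrite !normrM; apply: (@le_trans _ _ (C * `|u| * (`|u| * `|u|))).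
  apply: ler_pM; rewrite ?mulr_ge0//.
    apply: (le_trans (HC _ _ h h1')); rewrite ler_wpM2l ?(ltW C0)//.
    exact: le_trans h2' h2.
  by rewrite ler_wpM2r.
by rewrite -mulrA -expr2 -exprS.
Qed.

Lemma gamE t : 0 < t -> gam (t ^+ 2) = gammaN N t.
Proof.
move=> t0; rewrite /gam /gammaN; case: eqVneq => // h.
  by rewrite lnXn// mulr2n; field.
rewrite pw_sqr// mulrN mulrC divfK// pwNn//.
Qed.

Lemma gam_unbounded M : exists2 m0 : R, 0 < m0 & forall m, 0 < m -> m <= m0 -> M <= gam m.
Proof.
(* With this threshold - ln m / 2 >= |M|, which settles N = 2; for larger N the inequality exp y >=
   1 + y reduces the power to the logarithm. *)
exists (expR (- (2 * `|M|))); first exact: expR_gt0.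
move=> m m0 hm; have lm : ln m <= - (2 * `|M|).
  by rewrite -(expRK (- _)) ler_ln// posrE expR_gt0.
have M1 := ler_norm M; have M2 := normr_ge0 M.
rewrite /gam; case: eqVneq => h; first by lra.
have k1 : 1 <= (N - 2)%:R :> R by rewrite ler1n subn_gt0 ltn_neqAle eq_sym h.
apply: (@le_trans _ _ (1 + (- ((N - 2)%:R / 2) * ln m))); last exact: expR_ge1Dx.
nra.
Qed.

Definition psi m : R := pw (- ((N%:R - 1) / 2)) m.

(* [psi (|x|^2) = |x|^(1 - N)], one integrable majorant for the logarithmic and the
   power case. *)
Lemma gam_sub_le_psi a b : 0 < a -> a <= b -> gam a - gam b <= pw 2^-1 b * psi a.
Proof.
move=> a0 ab; pose F := gam - (pw 2^-1 b \*: psi).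
pose F' m := - (kap / 2) * en m - pw 2^-1 b *: (- ((N%:R - 1) / 2) * psi m / m).
have dF z : a <= z -> is_derive z 1 F (F' z).
  move=> az; have z0 := lt_le_trans a0 az.
  exact: is_deriveB (is_derive_gam N2 z0) (is_deriveZ _ (is_derive_pw _ z0)).
have [c [c1 c2]] := mvt_ge dF (lexx a) ab.
have c0 := lt_le_trans a0 c1.
have cb : c <= b.
  by move: c2; rewrite (ger0_norm (x := b - a)) ?subr_ge0// ger0_norm ?subr_ge0// lerD2r.
have E : psi c / c = en c * pw (- 2^-1) c.
  rewrite /psi /en -pwS// (_ : - ((N%:R - 1) / 2) - 1 = - (N%:R / 2) + - 2^-1); last by field.
  by rewrite /pw -expRD -mulrDl.
have P : 1 <= pw 2^-1 b * pw (- 2^-1) c.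
  rewrite -[leLHS](expR0 R) /pw -expRD ler_expR mulNr -mulrBr mulr_ge0// subr_ge0.
  by rewrite ler_ln// posrE// (lt_le_trans a0).
have F'0 : 0 <= F' c.
  rewrite /F' /GRing.scale /= -mulrA E.
  have e0 := en_gt0 c; have k0 := kap_gt0 N2; have k1 := kap_le N2.
  have : 0 <= en c * ((pw 2^-1 b * pw (- 2^-1) c - 1) * (N%:R - 1) + ((N%:R - 1) - kap)).
    by rewrite mulr_ge0 ?(ltW e0)// addr_ge0 ?mulr_ge0 ?subr_ge0//; lra.
  lra.
move=> e; have : 0 <= F b - F a by rewrite e mulr_ge0// subr_ge0.
have -> : F b - F a = gam b - gam a - pw 2^-1 b * psi b + pw 2^-1 b * psi a.
  by rewrite /F /GRing.scale /=; change ((gam b - pw 2^-1 b * psi b) - (gam a - pw 2^-1 b * psi a) = gam b - gam a - pw 2^-1 b * psi b + pw 2^-1 b * psi a); ring.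
have := mulr_ge0 (ltW (pw_gt0 2^-1 b)) (ltW (pw_gt0 (- ((N%:R - 1) / 2)) b)).
rewrite -/(psi b); lra.
Qed.

End fundamental.

(** * Second differences and the Green function of a ball *)

Section euclid.
Context (R : realType) (N : nat).
Local Notation V := 'rV[R]_N.
Implicit Types (x y z v : V) (t h : R) (i : 'I_N).

Definition dot x y : R := \sum_(i < N) x ord0 i * y ord0 i.

Lemma dotC x y : dot x y = dot y x.
Proof. by apply: eq_bigr => i _; rewrite mulrC. Qed.

Lemma sqD x y : sq (x + y) = sq x + 2 * dot x y + sq y.
Proof.
rewrite /sq /dot mulr_sumr -!big_split /=; apply: eq_bigr => i _.
by rewrite !mxE; ring.
Qed.

Lemma sqN x : sq (- x) = sq x.
Proof. by apply: eq_bigr => i _; rewrite mxE sqrrN. Qed.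

Lemma sqZ t x : sq (t *: x) = t ^+ 2 * sq x.
Proof. by rewrite /sq mulr_sumr; apply: eq_bigr => i _; rewrite mxE exprMn. Qed.

Lemma sq0 : sq (0 : V) = 0.
Proof. by rewrite /sq big1// => i _; rewrite mxE expr0n. Qed.

Lemma dotNr x y : dot x (- y) = - dot x y.
Proof. by rewrite /dot -sumrN; apply: eq_bigr => i _; rewrite mxE mulrN. Qed.

Lemma dotZr t x y : dot x (t *: y) = t * dot x y.
Proof. by rewrite /dot mulr_sumr; apply: eq_bigr => i _; rewrite mxE; ring. Qed.

Lemma dotDl x y z : dot (x + y) z = dot x z + dot y z.
Proof. by rewrite /dot -big_split /=; apply: eq_bigr => i _; rewrite mxE; ring. Qed.

Lemma dot_delta x i : dot x (delta_mx ord0 i) = x ord0 i.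
Proof.
rewrite /dot (bigD1 i)//= mxE !eqxx mulr1 big1 ?addr0// => j ji.
by rewrite mxE (negbTE ji) andbF mulr0.
Qed.

Lemma sq_delta i : sq (delta_mx ord0 i : V) = 1.
Proof.
rewrite /sq (bigD1 i)//= mxE !eqxx expr1n big1 ?addr0// => j ji.
by rewrite mxE (negbTE ji) andbF expr0n.
Qed.

Lemma sqB x y : sq (x - y) = sq x - 2 * dot x y + sq y.
Proof. by rewrite sqD dotNr sqN; ring. Qed.

Lemma sqBC x y : sq (x - y) = sq (y - x).
Proof. by rewrite -sqN opprB. Qed.

Lemma sq_eq0 x : (sq x == 0) = (x == 0).
Proof.
apply/idP/eqP => [/eqP h|->]; last by rewrite sq0.
apply/rowP => i; rewrite mxE; apply/eqP; rewrite -sqrf_eq0; apply/eqP/le_anti.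
by rewrite sqr_ge0 andbT -h sqr_coord_le.
Qed.

Lemma sqr_dot x y : dot x y ^+ 2 <= sq x * sq y.
Proof.
have [/eqP|y0] := eqVneq (sq y) 0.
  by rewrite sq_eq0 => /eqP ->; rewrite sq0 mulr0 /dot big1 ?expr0n// => i _; rewrite mxE mulr0.
have yp : 0 < sq y by rewrite lt0r y0 sq_ge0.
have := sq_ge0 (sq y *: x - dot x y *: y).
rewrite sqB !sqZ dotZr (dotC (_ *: x)) dotZr (dotC y) => h.
rewrite -subr_ge0 -(pmulr_rge0 _ yp); lra.
Qed.

Lemma enormE x : enorm x ^+ 2 = sq x.
Proof. by rewrite sqr_sqrtr// sq_ge0. Qed.

Lemma enorm_ge0 x : 0 <= enorm x. Proof. exact: sqrtr_ge0. Qed.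

Lemma enorm_le x t : 0 <= t -> (enorm x <= t) = (sq x <= t ^+ 2).
Proof. by move=> t0; rewrite -enormE ler_sqr// nnegrE// enorm_ge0. Qed.

Lemma enorm_lt x t : 0 <= t -> (enorm x < t) = (sq x < t ^+ 2).
Proof. by move=> t0; rewrite -enormE ltr_sqr// nnegrE// enorm_ge0. Qed.

Lemma enorm_ge x t : 0 <= t -> (t <= enorm x) = (t ^+ 2 <= sq x).
Proof. by move=> t0; rewrite -enormE ler_sqr// nnegrE// enorm_ge0. Qed.

Lemma normr_dot x y : `|dot x y| <= enorm x * enorm y.
Proof.
rewrite -ler_sqr ?nnegrE ?mulr_ge0 ?enorm_ge0// exprMn !enormE.
by rewrite real_normK ?num_real// sqr_dot.
Qed.

Lemma enormD x y : enorm (x + y) <= enorm x + enorm y.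
Proof.
rewrite enorm_le ?addr_ge0 ?enorm_ge0// sqD -!enormE.
have := ler_norm (dot x y); have := normr_dot x y; lra.
Qed.

Lemma enormN x : enorm (- x) = enorm x.
Proof. by rewrite /enorm -/(sq _) sqN. Qed.

Lemma enorm0 : enorm (0 : V) = 0.
Proof. by rewrite /enorm -/(sq _) sq0 sqrtr0. Qed.

Lemma enormB x y : enorm (x - y) <= enorm x + enorm y.
Proof. by rewrite -(enormN y) enormD. Qed.

Lemma enormBC x y : enorm (x - y) = enorm (y - x).
Proof. by rewrite -enormN opprB. Qed.

Lemma enorm_triangle y x z : enorm (x - z) <= enorm (x - y) + enorm (y - z).
Proof. by rewrite -[x - z](subrKA y) enormD. Qed.

Lemma enorm_subl x y : enorm x - enorm y <= enorm (x - y).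
Proof. by have := enormD (x - y) y; rewrite subrK; lra. Qed.

Lemma enormZ t x : enorm (t *: x) = `|t| * enorm x.
Proof. by rewrite /enorm -!/(sq _) sqZ sqrtrM ?sqr_ge0// sqrtr_sqr. Qed.

Lemma enorm_delta i : enorm (delta_mx ord0 i : V) = 1.
Proof. by rewrite /enorm -/(sq _) sq_delta sqrtr1. Qed.

Lemma normr_coord x i : `|x ord0 i| <= enorm x.
Proof.
by rewrite -ler_sqr ?nnegrE ?enorm_ge0// enormE real_normK ?num_real// sqr_coord_le.
Qed.

Lemma sq_lip x y B : enorm x <= B -> enorm y <= B ->
  `|sq x - sq y| <= 2 * B * enorm (x - y).
Proof.
move=> xB yB; rewrite -!enormE subr_sqr normrM mulrC.
have h1 := enorm_subl x y; have h2 := enorm_subl y x; have x0 := enorm_ge0 x.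
have y0 := enorm_ge0 y; rewrite (enormBC y) in h2.
by rewrite ler_pM// ler_norml; apply/andP; split; lra.
Qed.

(** The discrete Laplacian multiplied by h^2. Without the division, expansions carry errors C h^3
    and no quotients. *)
Definition dd h (f : V -> R) x : R := \sum_(i < N)
  (f (x + h *: delta_mx ord0 i) + f (x - h *: delta_mx ord0 i) - 2 * f x).

End euclid.

Section quadratic.
Context (R : realType) (N : nat).
Hypothesis N2 : (2 <= N)%N.
Local Notation gam := (@gam R N).
Local Notation en := (@en R N).
Local Notation en1 := (@en1 R N).
Local Notation kap := (@kap R N).

(* [v] is the gradient and [a *: 1] half the Hessian of a quadratic function
   [M] of [N] variables at a point where it equals [m], and
   [|v|^2 = 4 a (M - c)]: [gam \o M] is harmonic up to the term in [c]. *)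
Lemma dd_gam_quadratic (m1 A B : R) : 0 < m1 -> 0 <= A -> 0 <= B ->
  exists2 C : R, 0 < C & forall m a c h (v : 'I_N -> R),
    m1 <= m -> 0 <= a -> a <= A -> (forall i, `|v i| <= B) -> `|h| <= 1 ->
    \sum_i v i ^+ 2 = 4 * a * (m - c) ->
    (forall i, m1 <= m + (h * v i + a * h ^+ 2)) ->
    (forall i, m1 <= m + (- h * v i + a * h ^+ 2)) ->
    `|\sum_i (gam (m + (h * v i + a * h ^+ 2)) + gam (m + (- h * v i + a * h ^+ 2))
        - 2 * gam m) + kap * N%:R * a * c * en1 m * h ^+ 2| <= C * `|h| ^+ 3.
Proof.
move=> m10 A0 B0; have [C C0 HC] := gam_taylor2 N2 m10; have k0 := kap_gt0 R N2.
exists (N%:R * (2 * C * (A + B) ^+ 3) + kap * N%:R / 4 * N%:R * A ^+ 2 * en1 m1 + 1).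
  rewrite ltr_wpDl// addr_ge0// !mulr_ge0 ?exprn_ge0 ?addr_ge0 ?(ltW k0) ?(ltW C0)//.
  exact: ltW (en1_gt0 _ _).
move=> m a c h v hm a0 aA vB h1 sv hp hn.
have m0 : 0 < m := lt_le_trans m10 hm.
pose T u := gam (m + u) - gam m + kap / 2 * en m * u - kap * N%:R / 8 * en1 m * u ^+ 2.
pose up i := h * v i + a * h ^+ 2; pose un i := - h * v i + a * h ^+ 2.
have sN (k : R) : \sum_(i < N) k = N%:R * k.
  by rewrite sumr_const card_ord mulr_natl.
(* An exact identity. The terms of order h^2 cancel up to the one in [c], by the hypothesis on the
   sum of the v_i^2 and [en m] = m [en1 m]; what remains is the Taylor remainders and a term in
   h^4. *)
have -> : \sum_i (gam (m + (h * v i + a * h ^+ 2)) + gam (m + (- h * v i + a * h ^+ 2))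
        - 2 * gam m) + kap * N%:R * a * c * en1 m * h ^+ 2 =
    \sum_i (T (up i) + T (un i)) + kap * N%:R / 4 * N%:R * a ^+ 2 * en1 m * h ^+ 4.
  set S := (X in X + _ = _).
  have -> : \sum_i (T (up i) + T (un i)) = S + \sum_i (kap * en m * a * h ^+ 2
      - kap * N%:R / 4 * en1 m * a ^+ 2 * h ^+ 4
      - kap * N%:R / 4 * en1 m * h ^+ 2 * v i ^+ 2).
    by rewrite -big_split /=; apply: eq_bigr => i _; rewrite /T /up /un; field.
  rewrite sumrB -mulr_sumr sv sN.
  have -> : en m = en1 m * m by rewrite en1E// divfK// gt_eqF.
  by field.
rewrite (le_trans (ler_normD _ _))//.
have h0 := normr_ge0 h.
have bu i (s : R) : `|s| = `|h| -> `|s * v i + a * h ^+ 2| <= `|h| * (A + B).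
  move=> sh; rewrite (le_trans (ler_normD _ _))// normrM sh normrM (ger0_norm a0).
  rewrite normrX.
  have := vB i; have : `|h| ^+ 2 <= `|h| by rewrite expr2 ler_piMl.
  move=> q1 q2; rewrite mulrDr addrC lerD ?ler_wpM2l//.
  by rewrite mulrC ler_pM// exprn_ge0.
have bT i (s : R) : `|s| = `|h| -> m1 <= m + (s * v i + a * h ^+ 2) ->
    `|T (s * v i + a * h ^+ 2)| <= C * (A + B) ^+ 3 * `|h| ^+ 3.
  move=> sh hs; apply: (le_trans (HC _ _ hm hs)); rewrite -mulrA ler_wpM2l ?(ltW C0)//.
  by rewrite -exprMn (mulrC (A + B)) lerXn2r ?nnegrE ?mulr_ge0 ?addr_ge0// bu.
have S1 : `|\sum_i (T (up i) + T (un i))| <= N%:R * (2 * C * (A + B) ^+ 3) * `|h| ^+ 3.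
  rewrite (le_trans (ler_norm_sum _ _ _))// -mulrA -sN; apply: ler_sum => i _.
  rewrite (le_trans (ler_normD _ _))//.
  have := bT i h erefl (hp i); have := bT i (- h) (normrN _) (hn i).
  rewrite -/(up i) -/(un i); lra.
have S2 : `|kap * N%:R / 4 * N%:R * a ^+ 2 * en1 m * h ^+ 4| <=
    kap * N%:R / 4 * N%:R * A ^+ 2 * en1 m1 * `|h| ^+ 3.
  have e1 := en1_gt0 N m; have e2 := en1_le N m10 hm.
  rewrite normrM normrX ger0_norm; last first.
    by rewrite !mulr_ge0 ?exprn_ge0 ?(ltW k0) ?(ltW e1).
  apply: ler_pM; rewrite ?exprn_ge0//; last first.
    by rewrite exprS ler_piMl ?exprn_ge0.
    apply: ler_pM => //.
      by rewrite ?mulr_ge0 ?exprn_ge0 ?(ltW k0).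
    by rewrite (ltW e1).
    rewrite ler_wpM2l ?mulr_ge0 ?(ltW k0)//.
    by rewrite lerXn2r ?nnegrE.
  by rewrite !mulr_ge0 ?exprn_ge0 ?(ltW k0) ?(ltW e1).
have : 0 <= `|h| ^+ 3 by rewrite exprn_ge0.
lra.
Qed.

End quadratic.

(** * The Green function of a ball, with smoothed singularity *)

Section kernel.
Context (R : realType) (N : nat).
Hypothesis N2 : (2 <= N)%N.
Local Notation V := 'rV[R]_N.
Local Notation gam := (@gam R N).
Local Notation en := (@en R N).
Local Notation en1 := (@en1 R N).
Local Notation kap := (@kap R N).
Implicit Types (x y z : V) (tau h t m : R) (i : 'I_N).

Definition ms tau z x : R := sq (x - z) + tau ^+ 2.

Variables (L D : R).
Hypotheses (D0 : 0 < D) (DL : D < L).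

Let L0 : 0 < L. Proof. exact: lt_trans DL. Qed.
Let LD0 : 0 < L - D. Proof. by rewrite subr_gt0. Qed.

(* [L^-1 * |z| * |x - L^2 z / |z|^2|], squared: [gr 0] below is the Green
   function of the ball of radius [L], obtained by reflection. *)
Definition mr z x : R := L ^+ 2 - 2 * dot x z + sq x * sq z / L ^+ 2.

(** Only the singular term is smoothed. The reflected one stays away from its singularity as long as
    one of the two points lies in the ball of radius [D] and the other in that of radius [L]. *)
Definition gr tau x z : R := gam (ms tau z x) - gam (mr z x).

Lemma msC tau x z : ms tau z x = ms tau x z.
Proof. by rewrite /ms sqBC. Qed.

Lemma mrC x z : mr z x = mr x z.
Proof. by rewrite /mr dotC [sq x * _]mulrC. Qed.

Lemma grC tau x z : gr tau x z = gr tau z x.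
Proof. by rewrite /gr msC mrC. Qed.

(** The form that shows signs: [mr] exceeds |x - z|^2 inside the ball of radius [L] and equals it
    when a point is on the sphere. *)
Lemma mrE x z : mr z x = sq (x - z) + (L ^+ 2 - sq x) * (L ^+ 2 - sq z) / L ^+ 2.
Proof. by rewrite /mr sqB; field; rewrite gt_eqF. Qed.

(** By the Cauchy-Schwarz inequality the worst case is that of aligned vectors, where [mr] is the
    square of L - |x| |z| / L. *)
Lemma mr_ge x z : enorm x <= L -> enorm z <= D -> (L - D) ^+ 2 <= mr z x.
Proof.
move=> xL zD.
have x0 := enorm_ge0 x; have z0 := enorm_ge0 z.
apply: (@le_trans _ _ ((L - enorm x * enorm z / L) ^+ 2)).
  have q : enorm x * enorm z / L <= D by rewrite ler_pdivrMr// mulrC ler_pM.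
  have q2 : L - D <= L - enorm x * enorm z / L by rewrite lerD2l lerN2.
  by rewrite !expr2 ler_pM ?(ltW LD0).
have -> : (L - enorm x * enorm z / L) ^+ 2 =
    L ^+ 2 - 2 * (enorm x * enorm z) + sq x * sq z / L ^+ 2.
  by rewrite -!enormE; field; rewrite gt_eqF.
rewrite /mr; have := ler_norm (dot x z); have := normr_dot x z; lra.
Qed.

Lemma mr_le x z : enorm x <= L -> enorm z <= D -> mr z x <= 4 * L ^+ 2.
Proof.
move=> xL zD; rewrite /mr.
have x0 := enorm_ge0 x; have z0 := enorm_ge0 z.
have d := normr_dot x z; move: d; rewrite ler_norml => /andP[d _].
have q : enorm x * enorm z <= L * L by rewrite ler_pM// (le_trans zD)// ltW.
have : sq x * sq z / L ^+ 2 <= L ^+ 2.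
  rewrite ler_pdivrMr ?exprn_gt0// ler_pM ?sq_ge0// -enorm_le ?(ltW L0)//.
  by rewrite (le_trans zD)// ltW.
rewrite expr2; lra.
Qed.

(** On the sphere the exact Green function vanishes, and smoothing the singular term lowers it. *)
Lemma gr_le0 tau x z : enorm x = L -> enorm z <= D -> gr tau x z <= 0.
Proof.
move=> xL zD; rewrite /gr subr_le0 /ms.
have m0 : 0 < mr z x.
  have xL' : enorm x <= L by rewrite xL.
  exact: lt_le_trans (exprn_gt0 2 LD0) (mr_ge xL' zD).
apply: gam_le => //; rewrite mrE -(enormE x) xL subrr !mul0r addr0 lerDl.
exact: sqr_ge0.
Qed.

(** Convexity of [gam]: the gap between [mr] and [ms] is multiplied by the slope at the largest
    value of [mr], where the slope is flattest. *)
Lemma gr_ge tau x z : enorm x <= L -> enorm z <= D -> 0 < tau ->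
  tau ^+ 2 <= (L ^+ 2 - sq x) * (L ^+ 2 - sq z) / L ^+ 2 ->
  kap / 2 * en (4 * L ^+ 2) *
    ((L ^+ 2 - sq x) * (L ^+ 2 - sq z) / L ^+ 2 - tau ^+ 2) <= gr tau x z.
Proof.
move=> xL zD t0 ht.
have ms0 : 0 < ms tau z x by rewrite ltr_wpDl ?sq_ge0// exprn_gt0.
have msr : ms tau z x <= mr z x by rewrite mrE lerD2l.
apply: le_trans (gam_ge_tangent N2 ms0 msr).
have -> : mr z x - ms tau z x = (L ^+ 2 - sq x) * (L ^+ 2 - sq z) / L ^+ 2 - tau ^+ 2.
  by rewrite mrE /ms; ring.
rewrite ler_wpM2r ?subr_ge0// ler_wpM2l ?divr_ge0 ?(ltW (kap_gt0 _ N2))//.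
by rewrite en_le ?mr_le// (lt_le_trans ms0).
Qed.

Lemma ms_shift tau z x i t :
  ms tau z (x + t *: delta_mx ord0 i) =
  ms tau z x + (t * (2 * (x - z) ord0 i) + 1 * t ^+ 2).
Proof.
rewrite /ms (_ : x + _ - z = (x - z) + t *: delta_mx ord0 i); last first.
  by rewrite addrAC.
by rewrite sqD sqZ sq_delta dotZr dot_delta; ring.
Qed.

Lemma mr_shift z x i t :
  mr z (x + t *: delta_mx ord0 i) =
  mr z x + (t * (2 * (sq z / L ^+ 2) * x ord0 i - 2 * z ord0 i) + sq z / L ^+ 2 * t ^+ 2).
Proof.
rewrite /mr sqD sqZ sq_delta dotZr dot_delta dotDl (dotC (_ *: _)) dotZr dot_delta.
ring.
Qed.

(** The case a = 1, c = tau^2 of [dd_gam_quadratic]; the term in [en1] is the smoothed delta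
    function. The constant does not depend on [tau]. *)
Lemma dd_ms (m1 B : R) : 0 < m1 -> 0 <= B ->
  exists2 C : R, 0 < C & forall tau z x h, `|h| <= 1 -> enorm (x - z) <= B ->
    m1 <= ms tau z x ->
    (forall i, m1 <= ms tau z (x + h *: delta_mx ord0 i)) ->
    (forall i, m1 <= ms tau z (x - h *: delta_mx ord0 i)) ->
    `|dd h (fun x => gam (ms tau z x)) x + kap * N%:R * tau ^+ 2 * en1 (ms tau z x) * h ^+ 2|
      <= C * `|h| ^+ 3.
Proof.
move=> m10 B0; have B20 : 0 <= 2 * B by rewrite mulr_ge0.
have [C C0 HC] := dd_gam_quadratic N2 m10 ler01 B20.
exists C => // tau z x h h1 xz hm hp hn.
have E : dd h (fun x => gam (ms tau z x)) x =
  \sum_i (gam (ms tau z x + (h * (2 * (x - z) ord0 i) + 1 * h ^+ 2)) +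
   gam (ms tau z x + (- h * (2 * (x - z) ord0 i) + 1 * h ^+ 2)) - 2 * gam (ms tau z x)).
  by apply: eq_bigr => i _; rewrite -scaleNr !ms_shift sqrrN.
have := HC (ms tau z x) 1 (tau ^+ 2) h (fun i => 2 * (x - z) ord0 i) hm ler01 (lexx _).
rewrite -E {E}.
rewrite !mulr1; apply => //.
- move=> i; rewrite normrM ger0_norm// ler_wpM2l//; apply: le_trans xz; exact: normr_coord.
- rewrite (eq_bigr (fun i => 4 * (x - z) ord0 i ^+ 2)).
    by rewrite -mulr_sumr -/(sq _) /ms; ring.
  by move=> i _; rewrite exprMn; ring.
- by move=> i; have := hp i; rewrite ms_shift.
- by move=> i; have := hn i; rewrite -scaleNr ms_shift sqrrN.
Qed.

(** The case a = |z|^2 / L^2 <= 1, c = 0 of [dd_gam_quadratic]: the reflected part is harmonic, here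
    with an error uniform in [z]. *)
Lemma dd_mr : exists2 C : R, 0 < C & forall z x h, `|h| <= 1 -> enorm z <= D ->
    enorm x + `|h| <= L ->
    `|dd h (fun x => gam (mr z x)) x| <= C * `|h| ^+ 3.
Proof.
have m10 : 0 < (L - D) ^+ 2 by rewrite exprn_gt0.
have B0 : 0 <= 4 * L by rewrite mulr_ge0// ltW.
have [C C0 HC] := dd_gam_quadratic N2 m10 ler01 B0.
exists C => // z x h h1 zD xh.
have z0 := enorm_ge0 z; have x0 := enorm_ge0 x; have h0 := normr_ge0 h.
have xL : enorm x <= L by lra.
have zL : enorm z <= L := ltW (le_lt_trans zD DL).
have a0 : 0 <= sq z / L ^+ 2 by rewrite divr_ge0 ?sq_ge0// exprn_ge0// ltW.
have a1 : sq z / L ^+ 2 <= 1.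
  by rewrite ler_pdivrMr ?exprn_gt0// mul1r -enorm_le// ltW.
have sh i s : `|s| = `|h| -> (L - D) ^+ 2 <= mr z (x + s *: delta_mx ord0 i).
  move=> sh; apply: mr_ge => //; rewrite (le_trans (enormD _ _))// enormZ enorm_delta mulr1 sh.
  lra.
have E : dd h (fun x => gam (mr z x)) x =
  \sum_i (gam (mr z x + (h * (2 * (sq z / L ^+ 2) * x ord0 i - 2 * z ord0 i) + sq z / L ^+ 2 * h ^+ 2)) +
   gam (mr z x + (- h * (2 * (sq z / L ^+ 2) * x ord0 i - 2 * z ord0 i) + sq z / L ^+ 2 * h ^+ 2)) - 2 * gam (mr z x)).
  by apply: eq_bigr => i _; rewrite -scaleNr !mr_shift sqrrN.
have := HC (mr z x) (sq z / L ^+ 2) 0 h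
  (fun i => 2 * (sq z / L ^+ 2) * x ord0 i - 2 * z ord0 i) (mr_ge xL zD) a0 a1.
rewrite -E {E}.
rewrite mulr0 !mul0r addr0; apply => //.
- move=> i; move: (sq z / L ^+ 2) a0 a1 => a a0 a1.
  rewrite (le_trans (ler_normB _ _))// !normrM (ger0_norm a0) ger0_norm//.
  have hx := normr_coord x i; have hz := normr_coord z i.
  have : a * `|x ord0 i| <= 1 * L by rewrite ler_pM// (le_trans hx).
  lra.
- rewrite (eq_bigr (fun i => 4 * (sq z / L ^+ 2) ^+ 2 * x ord0 i ^+ 2
      - 8 * (sq z / L ^+ 2) * (x ord0 i * z ord0 i) + 4 * z ord0 i ^+ 2)); last first.
    by move=> i _; ring.
  rewrite big_split sumrB /= -!mulr_sumr -!/(sq _) -/(dot _ _) /mr subr0.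
  by field; rewrite gt_eqF.
- by move=> i; have := sh i h erefl; rewrite mr_shift.
- by move=> i; have := sh i (- h) (normrN _); rewrite mr_shift sqrrN.
Qed.

Lemma ddD h (f g : V -> R) x : dd h (fun x => f x + g x) x = dd h f x + dd h g x.
Proof. by rewrite /dd -big_split /=; apply: eq_bigr => i _; ring. Qed.

Lemma ddB h (f g : V -> R) x : dd h (fun x => f x - g x) x = dd h f x - dd h g x.
Proof. by rewrite /dd -sumrB /=; apply: eq_bigr => i _; ring. Qed.

Lemma ddZ h k (f : V -> R) x : dd h (fun x => k * f x) x = k * dd h f x.
Proof. by rewrite /dd mulr_sumr; apply: eq_bigr => i _; ring. Qed.

Lemma dd_cst h (k : R) x : dd h (fun=> k) x = 0.
Proof. by rewrite /dd big1// => i _; ring. Qed.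

Lemma dd_sum h (J : Type) (s : seq J) (F : J -> V -> R) x :
  dd h (fun x => \sum_(j <- s) F j x) x = \sum_(j <- s) dd h (F j) x.
Proof.
rewrite /dd exchange_big /=; apply: eq_bigr => i _.
by rewrite mulr_sumr -big_split -sumrB.
Qed.

Lemma dd_gr (m1 : R) : 0 < m1 ->
  exists2 C : R, 0 < C & forall tau z x h, `|h| <= 1 -> enorm z <= D ->
    enorm x + `|h| <= L -> m1 <= ms tau z x ->
    (forall i, m1 <= ms tau z (x + h *: delta_mx ord0 i)) ->
    (forall i, m1 <= ms tau z (x - h *: delta_mx ord0 i)) ->
    `|dd h (gr tau ^~ z) x + kap * N%:R * tau ^+ 2 * en1 (ms tau z x) * h ^+ 2|
      <= C * `|h| ^+ 3.
Proof.
move=> m10; have B0 : 0 <= 2 * L by rewrite mulr_ge0// ltW.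
have [C1 C10 H1] := dd_ms m10 B0; have [C2 C20 H2] := dd_mr.
exists (C1 + C2); first exact: addr_gt0.
move=> tau z x h h1 zD xh hm hp hn.
have zL : enorm z <= L := ltW (le_lt_trans zD DL).
have xz : enorm (x - z) <= 2 * L.
  by rewrite (le_trans (enormB _ _))//; have := normr_ge0 h; lra.
have := H1 tau z x h h1 xz hm hp hn; have := H2 z x h h1 zD xh.
rewrite /gr ddB mulrDl => q1 q2.
rewrite addrAC (le_trans (ler_normB _ _))//; lra.
Qed.

(** The lower bounds on [mr] are taken as hypotheses so that, [gr] being symmetric, one estimate
    yields Lipschitz bounds in either argument. *)
Let gr_lip_mr (m1 : R) : 0 < m1 ->
  exists2 C : R, 0 < C & forall tau x y z, enorm x <= L -> enorm y <= L ->
    enorm z <= L -> (L - D) ^+ 2 <= mr z x -> (L - D) ^+ 2 <= mr z y ->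
    m1 <= ms tau z x -> m1 <= ms tau z y ->
    `|gr tau x z - gr tau y z| <= C * enorm (x - y).
Proof.
move=> m10; have k0 := kap_gt0 R N2.
have m20 : 0 < (L - D) ^+ 2 by rewrite exprn_gt0.
pose K1 := kap / 2 * en m1; pose K2 := kap / 2 * en ((L - D) ^+ 2).
have K10 : 0 < K1 by rewrite mulr_gt0 ?en_gt0// divr_gt0.
have K20 : 0 < K2 by rewrite mulr_gt0 ?en_gt0// divr_gt0.
exists (K1 * (4 * L) + K2 * (4 * L)).
  have L4 : 0 < 4 * L by rewrite mulr_gt0.
  exact: addr_gt0 (mulr_gt0 K10 L4) (mulr_gt0 K20 L4).
move=> tau x y z xL yL zL mx my hx hy.
have e0 := enorm_ge0 (x - y); have z0 := enorm_ge0 z.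
have q1 := gam_lip N2 m10 hy hx; have q2 := gam_lip N2 m20 my mx.
have r1 : `|ms tau z x - ms tau z y| <= 4 * L * enorm (x - y).
  have -> : x - y = (x - z) - (y - z) by rewrite opprB addrA subrK.
  have -> : ms tau z x - ms tau z y = sq (x - z) - sq (y - z) by rewrite /ms; ring.
  have -> : 4 * L = 2 * (2 * L) by ring.
  have b1 := enormB x z; have b2 := enormB y z.
  by apply: sq_lip; clear -b1 b2 xL yL zL; lra.
have r2 : `|mr z x - mr z y| <= 4 * L * enorm (x - y).
  have -> : mr z x - mr z y = - 2 * dot (x - y) z + (sq x - sq y) * (sq z / L ^+ 2).
    by rewrite /mr dotDl (dotC (- y)) dotNr (dotC z); ring.
  have a0 : 0 <= sq z / L ^+ 2 by rewrite divr_ge0 ?sq_ge0// exprn_ge0// ltW.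
  have a1 : sq z / L ^+ 2 <= 1.
    by rewrite ler_pdivrMr ?exprn_gt0// mul1r -enorm_le// ltW.
  move: (sq z / L ^+ 2) a0 a1 => a a0 a1.
  rewrite (le_trans (ler_normD _ _))// !normrM normrN (ger0_norm a0) normr_nat.
  have d1 := normr_dot (x - y) z; have d2 := sq_lip xL yL.
  have d3 : enorm (x - y) * enorm z <= enorm (x - y) * L by rewrite ler_wpM2l.
  have : `|sq x - sq y| * a <= 2 * L * enorm (x - y) * 1 by rewrite ler_pM.
  clear -d1 d3; lra.
have -> : gr tau x z - gr tau y z = (gam (ms tau z x) - gam (ms tau z y))
   - (gam (mr z x) - gam (mr z y)).
  by rewrite /gr; move: (gam _) (gam _) (gam _) (gam _) => *; ring.
rewrite (le_trans (ler_normB _ _))// mulrDl; apply: lerD.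
  by apply: (le_trans q1); rewrite -(mulrA K1) ler_wpM2l// ltW.
by apply: (le_trans q2); rewrite -(mulrA K2) ler_wpM2l// ltW.
Qed.

Lemma gr_lip (m1 : R) : 0 < m1 ->
  exists2 C : R, 0 < C & forall tau x y z, enorm x <= L -> enorm y <= L ->
    enorm z <= D -> m1 <= ms tau z x -> m1 <= ms tau z y ->
    `|gr tau x z - gr tau y z| <= C * enorm (x - y).
Proof.
move=> m10; have [C C0 HC] := gr_lip_mr m10; exists C => // tau x y z xL yL zD hx hy.
apply: HC => //; [exact: ltW (le_lt_trans zD DL)|exact: mr_ge|exact: mr_ge].
Qed.

Lemma gr_lipr (m1 : R) : 0 < m1 ->
  exists2 C : R, 0 < C & forall tau x z w, enorm x <= L -> enorm z <= D ->
    enorm w <= D -> m1 <= ms tau z x -> m1 <= ms tau w x ->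
    `|gr tau x z - gr tau x w| <= C * enorm (z - w).
Proof.
move=> m10; have [C C0 HC] := gr_lip_mr m10; exists C => // tau x z w xL zD wD hz hw.
rewrite (grC _ _ z) (grC _ _ w); apply: HC => //; rewrite 1?msC//.
- exact: ltW (le_lt_trans zD DL).
- exact: ltW (le_lt_trans wD DL).
- by rewrite mrC; exact: mr_ge.
- by rewrite mrC; exact: mr_ge.
Qed.

Lemma measurable_pw (s : R) : measurable_fun setT (pw s : R -> R).
Proof.
have m1 : measurable_fun setT (fun m : R => s * ln m).
  by apply: measurable_funM; [exact: measurable_cst|exact: measurable_ln].
exact: (measurableT_comp (@measurable_expR R) m1).
Qed.

Lemma measurable_gam : measurable_fun setT gam.
Proof.
rewrite /gam; case: (N == 2).
  apply: measurable_funM; last exact: measurable_cst.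
  by apply: measurable_funN; exact: measurable_ln.
exact: measurable_pw.
Qed.

Lemma mrow_sq : mrow (@sq R N).
Proof. by apply: mrow_sum => i; apply: mrowX; exact: mrow_coord. Qed.

Lemma mrow_dot x : mrow (dot x).
Proof. by apply: mrow_sum => i; apply: mrowZ; exact: mrow_coord. Qed.

Lemma mrow_ms tau z : mrow (ms tau z).
Proof.
rewrite (_ : ms tau z = fun x => sq x - 2 * dot z x + sq z + tau ^+ 2).
  by apply: mrowD; [apply: mrowD; [apply: mrowB; [exact: mrow_sq|apply: mrowZ; exact: mrow_dot]|exact: mrow_cst]|exact: mrow_cst].
by apply/funext => x; rewrite /ms sqB dotC.
Qed.

Lemma mrow_gam_ms tau z : mrow (fun x => gam (ms tau z x)).
Proof. by apply: mrow_comp; [exact: measurable_gam|exact: mrow_ms]. Qed.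

Lemma mrow_gr tau z : mrow (gr tau ^~ z).
Proof.
apply: mrowB; first exact: mrow_gam_ms.
apply: mrow_comp; first exact: measurable_gam.
rewrite (_ : mr z = fun x => L ^+ 2 - 2 * dot z x + (sq z / L ^+ 2) * sq x).
  by apply: mrowD; [apply: mrowB; [exact: mrow_cst|apply: mrowZ; exact: mrow_dot]|apply: mrowZ; exact: mrow_sq].
by apply/funext => x; rewrite /mr dotC; ring.
Qed.

End kernel.

(** * Perron subfunctions *)

Section topology.
Context (R : realType) (N : nat).
Local Notation V := 'rV[R]_N.
Implicit Types (A U : set V) (x y z c v : V) (r h : R) (f u w : V -> R).

Lemma nbhs_enormP x A : nbhs x A <-> exists2 e : R, 0 < e & eball x e `<=` A.
Proof.
split=> [/nbhs_ballP[e /= e0 xe]|[e e0 xeA]].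
  exists e => // y xy; apply: xe; split => // i j; rewrite (ord1 i) /ball /= distrC.
  by rewrite (le_lt_trans _ xy)//; have := normr_coord (y - x) j; rewrite !mxE.
pose s := e / N.+1%:R; have s0 : 0 < s by rewrite divr_gt0// ltr0n.
apply/nbhs_ballP; exists s => //= y [_ xy]; apply: xeA.
rewrite /eball /= enorm_lt ?ltW// /sq.
have se : N%:R * s ^+ 2 < e ^+ 2.
  have es : e = s * N.+1%:R by rewrite divfK// pnatr_eq0.
  have -> : e ^+ 2 = s ^+ 2 * (N.+1 ^ 2)%:R by rewrite natrX -exprMn -es.
  rewrite (mulrC N%:R) ltr_pM2l ?exprn_gt0// ltr_nat.
  by rewrite (leq_trans (ltnSn N))// -{1}[N.+1]expn1 leq_pexp2l.
apply: le_lt_trans se.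
have -> : N%:R * s ^+ 2 = \sum_(i < N) s ^+ 2 by rewrite sumr_const card_ord mulr_natl.
apply: ler_sum => i _; have := xy ord0 i; rewrite /ball /= distrC !mxE => /ltW h.
by rewrite -real_normK ?num_real// lerXn2r ?nnegrE ?(ltW s0).
Qed.

Lemma continuous_enormP f x : {for x, continuous f} <->
  forall e : R, 0 < e -> exists2 d, 0 < d & forall y, enorm (y - x) < d -> `|f y - f x| < e.
Proof.
split=> [cf e e0|H].
  have /cvgrPdist_lt/(_ _ e0)/nbhs_enormP[d d0 xd] := cf.
  by exists d => // y xy; rewrite distrC; exact: xd.
rewrite /prop_for /continuous_at.
apply/(@cvgrPdist_lt _ _ _ (nbhs x)) => e e0; apply/nbhs_enormP; have [d d0 xd] := H e e0.
by exists d => // y xy /=; rewrite distrC; exact: xd.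
Qed.

Lemma continuous_enorm x : {for x, continuous (@enorm R N)}.
Proof.
apply/continuous_enormP => e e0; exists e => // y xy; apply: le_lt_trans xy.
have := enorm_subl y x; have := enorm_subl x y; rewrite (enormBC x).
by rewrite ler_norml => ? ?; apply/andP; split; lra.
Qed.

Lemma continuous_sq x : {for x, continuous (@sq R N)}.
Proof.
rewrite (_ : @sq R N = fun x => enorm x * enorm x).
  by apply: continuousM; exact: continuous_enorm.
by apply/funext => y; rewrite -expr2 enormE.
Qed.

Lemma open_eball c r : open (eball c r).
Proof.
rewrite openE => x /= xr; apply/nbhs_enormP; exists (r - enorm (x - c)).
  by rewrite subr_gt0.
move=> y /= yx; rewrite /eball /=.
by rewrite (le_lt_trans (enorm_triangle x _ _))//; rewrite -ltrBrDr.
Qed.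

Lemma closed_eclosed_ball c r : closed (eclosed_ball c r).
Proof.
rewrite -openC openE => x /= /negP; rewrite -ltNge => xr.
apply/nbhs_enormP; exists (enorm (x - c) - r); first by rewrite subr_gt0.
move=> y /= yx /=; apply/negP; rewrite -ltNge.
by have := enorm_triangle y x c; move: yx; rewrite /eball /= (enormBC y x); lra.
Qed.

Lemma bounded_enorm A r : (forall x, A x -> enorm x <= r) -> bounded_set A.
Proof.
move=> Ar; exists `|r|; split; first exact: num_real.
move=> M rM x Ax; apply: le_trans (ltW rM).
have -> : `|x| = mx_norm x by [].
have [->//|] := eqVneq (mx_norm x) 0.
move=> /mx_norm_neq0[[i j]] ->; rewrite (ord1 i) /=.
exact: le_trans (normr_coord x j) (le_trans (Ar x Ax) (ler_norm r)).
Qed.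

Lemma enorm_bounded A : bounded_set A -> exists2 r : R, 0 < r & forall x, A x -> enorm x < r.
Proof.
move=> [M [_ HM]]; pose K := `|M| + 1.
have K0 : 0 < K by rewrite ltr_wpDl.
exists (Num.sqrt N%:R * (K + 1) + 1).
  by rewrite ltr_wpDl// mulr_ge0 ?sqrtr_ge0// addr_ge0// ltW.
move=> x Ax; have xK : `|x| <= K by apply: HM => //; rewrite ltr_pwDr// ler_norm.
have xi i : `|x ord0 i| < K + 1.
  have : ball_ (fun x : V => `|x|) 0 (K + 1) x.
    by rewrite /ball_ /= sub0r normrN ltr_pwDr.
  by rewrite -mx_norm_ball => -[_ /(_ ord0 i)]; rewrite /ball /= mxE sub0r normrN.
rewrite ltr_pwDr// enorm_le; last by rewrite mulr_ge0 ?sqrtr_ge0// addr_ge0// ltW.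
rewrite exprMn sqr_sqrtr// /sq.
have -> : N%:R * (K + 1) ^+ 2 = \sum_(i < N) (K + 1) ^+ 2.
  by rewrite sumr_const card_ord mulr_natl.
apply: ler_sum => i _; have /ltW h := xi i.
by rewrite -real_normK ?num_real// lerXn2r ?nnegrE// addr_ge0// ltW.
Qed.

Lemma compact_enorm A r : closed A -> (forall x, A x -> enorm x <= r) -> compact A.
Proof. by move=> cA Ar; apply: bounded_closed_compact => //; exact: bounded_enorm Ar. Qed.

Lemma dd_sq h x : dd h (@sq R N) x = 2 * N%:R * h ^+ 2.
Proof.
rewrite /dd (eq_bigr (fun=> 2 * h ^+ 2)); last first.
  move=> i _; rewrite -scaleNr !sqD !dotZr !sqZ sq_delta; ring.
by rewrite sumr_const card_ord -mulr_natl; ring.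
Qed.

Hypothesis N0 : (0 < N)%N.

(* At a maximum of [w + e |x|^2] the sum of second differences of [w] is at most
   [- 2 N e h^2]. *)
Lemma dd_max_principle A (M : R) w : compact A -> {within A, continuous w} ->
  (forall x, A x -> M < w x -> forall e, 0 < e -> exists h, [/\ 0 < h,
    (forall i, A (x + h *: delta_mx ord0 i)), (forall i, A (x - h *: delta_mx ord0 i))
    & - (e * h ^+ 2) < dd h w x]) ->
  forall x, A x -> w x <= M.
Proof.
move=> cA cw H x1 Ax1; rewrite leNgt; apply/negP => wM.
have [B B0 AB] := enorm_bounded (compact_bounded cA).
have A0 : A !=set0 by exists x1.
(* On [A] the perturbation e |y|^2 stays below w x1 - M, so at a maximum point of [f] the value of
   [w] still exceeds [M]. *)
pose e := (w x1 - M) / (B ^+ 2 + 1).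
have B2 : 0 < B ^+ 2 + 1 by rewrite ltr_wpDl// sqr_ge0.
have e0 : 0 < e by rewrite divr_gt0// subr_gt0.
pose f y := w y + e * sq y.
have cf : {within A, continuous f}.
  move=> y; rewrite /continuous_at; apply: (@cvgD _ _ _ _ _ w (fun y => e * sq y)); first exact: cw.
  apply: (@continuous_subspaceT _ _ A (fun y => e * sq y)) => z.
  have hz : {for z, continuous (fun y : V => e * sq y)}.
    by apply: continuousM; [exact: cst_continuous|exact: continuous_sq].
  exact: hz.
have [p Ap fp] := compact_EVT_max A0 cA cf.
have wp : M < w p.
  have := fp x1 (mem_set Ax1); rewrite /f.
  have : e * sq p < e * (B ^+ 2 + 1).
    by rewrite ltr_pM2l// ltr_pwDr// -enorm_le ?(ltW B0)// ltW// AB//; exact: set_mem.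
  have := mulr_ge0 (ltW e0) (sq_ge0 x1).
  rewrite {3}/e divfK ?gt_eqF//; lra.
have [h [h0 hp hn]] := H p (set_mem Ap) wp e e0.
have : dd h f p <= 0.
  rewrite /dd; apply: sumr_le0 => i _.
  have := fp _ (mem_set (hp i)); have := fp _ (mem_set (hn i)); lra.
rewrite /f ddD ddZ dd_sq.
have N1 : 1 <= N%:R :> R by rewrite ler1n.
have h2 : 0 < h ^+ 2 by rewrite exprn_gt0.
have := mulr_ge0 (ltW e0) (ltW h2) => eh.
have : e * h ^+ 2 <= e * (2 * N%:R * h ^+ 2).
  by rewrite ler_wpM2l ?(ltW e0)// ler_peMl ?(ltW h2)//; lra.
lra.
Qed.

End topology.

(** * Subharmonicity from second differences, and the maximum principle *)

Section perron.
Context (R : realType) (N : nat).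
Hypothesis N2 : (2 <= N)%N.
Local Notation V := 'rV[R]_N.
Implicit Types (A U B : set V) (x y z c v : V) (r h : R) (f u w : V -> R).

Let N0 : (0 < N)%N. Proof. exact: ltn_trans N2. Qed.

Lemma is_derive_line f df x v (t : R) : is_derive (x + t *: v) v f df ->
  is_derive t 1 (fun s => f (x + s *: v)) df.
Proof.
move=> [dfv <-].
have E : (fun h : R => h^-1 *: (((fun s : R => f (x + s *: v)) \o shift t) (h *: 1) - f (x + t *: v)))
   = (fun h : R => h^-1 *: ((f \o shift (x + t *: v)) (h *: v) - f (x + t *: v))).
  apply/funext => h /=; congr (_ *: (f _ - _)).
  have -> : h *: (1 : R) = h by rewrite /GRing.scale /= mulr1.
  by rewrite scalerDl addrCA.
split; first by rewrite /derivable E.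
by rewrite /derive E.
Qed.

(** With k the second derivative at [x] along an axis v, the mean value theorem is applied to f(x +
    s v) + f(x - s v) - k s^2 on [0, h], then to the first derivative on [- s, s]; continuity of the
    second derivative controls the rest. *)
Lemma dd_C2 B f x : open B -> B x -> Ck_on 2 B f ->
  forall e, 0 < e -> exists2 d, 0 < d & forall h, 0 < h -> h < d ->
    `|dd h f x - laplacian f x * h ^+ 2| <= e * h ^+ 2.
Proof.
move=> oB Bx [cf Hf] e e0.
have [r0 r00 xB] : exists2 r : R, 0 < r & eball x r `<=` B.
  by apply/nbhs_enormP; apply: open_nbhs_nbhs; split.
have N1 : 0 < N%:R :> R by rewrite ltr0n.
pose e1 := e / (2 * N%:R); have e10 : 0 < e1 by rewrite divr_gt0// mulr_gt0.
have H i : {d | 0 < d & forall h, 0 < h -> h < d ->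
   `|f (x + h *: delta_mx ord0 i) + f (x - h *: delta_mx ord0 i) - 2 * f x
     - partial i (partial i f) x * h ^+ 2| <= 2 * e1 * h ^+ 2}.
  apply: cid2.
  have [df [_ Hf']] := Hf i; have [ddf [cdd _]] := Hf' i.
  have [d d0 xd] := proj1 (continuous_enormP _ x) (cdd x Bx) _ e10.
  pose v : V := delta_mx ord0 i.
  exists (Num.min r0 d); first by rewrite lt_min r00.
  move=> h h0; rewrite lt_min => /andP[hr hd].
  have near (s : R) : `|s| <= h -> B (x + s *: v) /\ `|partial i (partial i f) (x + s *: v) - partial i (partial i f) x| < e1.
    move=> sh; have E : enorm (x + s *: v - x) = `|s|.
      by rewrite addrAC subrr add0r enormZ enorm_delta mulr1.
    split; first by apply: xB; rewrite /eball /= E (le_lt_trans sh).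
    by apply: xd; rewrite E (le_lt_trans sh).
  have d1 (s : R) : `|s| <= h -> is_derive s 1 (fun s : R => f (x + s *: v)) (partial i f (x + s *: v)).
    move=> sh; apply: is_derive_line; apply: DeriveDef => //; apply: df.
    by case: (near s sh).
  have d2 (s : R) : `|s| <= h -> is_derive s 1 (fun s : R => partial i f (x + s *: v)) (partial i (partial i f) (x + s *: v)).
    move=> sh; apply: is_derive_line; apply: DeriveDef => //; apply: ddf.
    by case: (near s sh).
  set k := partial i (partial i f) x in near *.
  pose g (s : R) := f (x + s *: v); pose g1 (s : R) := partial i f (x + s *: v).
  pose Phi := g + (g \o -%R) - (k \*: (@id R ^+ 2)).
  pose Phi1 (s : R) := g1 s + g1 (- s) * (- 1) - k *: ((2%:R * s ^+ 1) *: 1).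
  have dPhi (s : R) : `|s| <= h -> is_derive s 1 Phi (Phi1 s).
    move=> sh; have z1 : is_derive s 1 (@id R) 1 by exact: is_derive_id.
    have z2 := is_deriveZ k (is_deriveX 2 z1).
    have z3 : is_derive s 1 (g \o -%R) (g1 (- s) * (- 1)).
      have zn : is_derive s 1 (-%R : R -> R) (- 1) by exact: (is_deriveN z1).
      have nsh : `|- s| <= h by rewrite normrN.
      exact: (is_derive1_comp (d1 (- s) nsh) zn).
    exact: (is_deriveB (is_deriveD (d1 s sh) z3) z2).
  have cont (F F' : R -> R) (a b : R) : (forall s : R, `|s| <= h -> is_derive s 1 F (F' s)) ->
      - h <= a -> b <= h -> {within `[a, b], continuous F}.
    move=> dF ha hb; apply: derivable_within_continuous => s.
    rewrite in_itv /= => /andP[as_ sb]; apply: (@ex_derive _ _ _ _ _ _ (F' s)); apply: dF.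
    by rewrite ler_norml; clear -as_ sb ha hb; apply/andP; split; lra.
  have [||s] := @MVT _ Phi Phi1 0 h h0 _ (cont _ _ _ _ dPhi _ (lexx _)).
  - by move=> s; rewrite in_itv /= => /andP[s1 s2]; apply: dPhi; rewrite ler_norml; clear -s1 s2 h0; apply/andP; split; lra.
  - by rewrite oppr_le0 ltW.
  rewrite in_itv /= => /andP[s0 sh] EP.
  have ss : - s < s by lra.
  have [|||q] := @MVT _ g1 (fun s => partial i (partial i f) (x + s *: v)) (- s) s ss _ (cont _ _ _ _ d2 _ _).
  - by move=> q; rewrite in_itv /= => /andP[q1 q2]; apply: d2; rewrite ler_norml; clear -q1 q2 sh; apply/andP; split; lra.
  - by lra.
  - exact: ltW.
  rewrite in_itv /= => /andP[q1 q2] EQ.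
  have [_ qk] : B (x + q *: v) /\ `|partial i (partial i f) (x + q *: v) - k| < e1.
    by apply: near; rewrite ler_norml; clear -q1 q2 sh; apply/andP; split; lra.
  have -> : f (x + h *: v) + f (x - h *: v) - 2 * f x - k * h ^+ 2 = Phi h - Phi 0.
    change (f (x + h *: v) + f (x - h *: v) - 2 * f x - k * h ^+ 2 =
      (f (x + h *: v) + f (x + (- h) *: v) - k * h ^+ 2)
      - (f (x + 0 *: v) + f (x + (- 0) *: v) - k * 0 ^+ 2)).
    by rewrite oppr0 scaleNr scale0r addr0; ring.
  rewrite EP subr0 /Phi1.
  have -> : g1 s + g1 (- s) * -1 - k *: ((2 * s ^+ 1) *: 1) = (g1 s - g1 (- s)) - k * (2 * s).
    by rewrite /GRing.scale /=; ring.
  rewrite EQ.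
  have -> : (partial i (partial i f) (x + q *: v) * (s - - s) - k * (2 * s)) * h =
     (partial i (partial i f) (x + q *: v) - k) * (2 * s * h) by ring.
  rewrite normrM (_ : 2 * s * h = 2 * (s * h)); last by ring.
  have sh0 : 0 <= s * h by rewrite mulr_ge0// ltW.
  have sh2 : 0 <= 2 * (s * h) by rewrite mulr_ge0.
  rewrite (ger0_norm sh2).
  have : `|partial i (partial i f) (x + q *: v) - k| * (s * h) <= e1 * (s * h).
    by rewrite ler_wpM2r// ltW.
  have : e1 * (s * h) <= e1 * (h * h).
    by rewrite ler_wpM2l ?(ltW e10)// ler_wpM2r ?ltW.
  rewrite (expr2 h); lra.
pose d := \big[Num.min/1]_i s2val (H i).
have d0 : 0 < d.
  rewrite /d; elim/big_ind : _ => // [a b a0 b0|i _]; first by rewrite lt_min a0.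
  by case: (H i).
have dH i : d <= s2val (H i) by rewrite /d bigmin_le_cond.
exists d => // h h0 hd.
rewrite /dd /laplacian mulr_suml -sumrB (le_trans (ler_norm_sum _ _ _))//.
have -> : e * h ^+ 2 = \sum_(i < N) 2 * e1 * h ^+ 2.
  by rewrite sumr_const card_ord -mulr_natl /e1; field; rewrite gt_eqF.
apply: ler_sum => i _; have := dH i; case: (H i) => di di0 Hi /= ddi.
by apply: Hi => //; exact: lt_le_trans ddi.
Qed.

Lemma dd_harmonic B f x : open B -> B x -> harmonic_on B f ->
  forall e, 0 < e -> exists2 d, 0 < d & forall h, 0 < h -> h < d ->
    `|dd h f x| <= e * h ^+ 2.
Proof.
move=> oB Bx [C2 Hl] e e0; have [d d0 Hd] := dd_C2 oB Bx C2 e0.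
exists d => // h h0 hd; have := Hd h h0 hd.
by rewrite Hl// mul0r subr0.
Qed.

(** A mean value inequality in the limit of small steps. Subtracting a harmonic function preserves
    it, because harmonic functions have second differences o(h^2), and [dd_max_principle] then gives
    the comparison on the closed ball. *)
Lemma subharmonic_of_dd U u : (forall x, U x -> {for x, continuous u}) ->
  (forall x, U x -> forall e, 0 < e -> exists2 d, 0 < d &
    forall h, 0 < h -> h < d -> - (e * h ^+ 2) <= dd h u x) ->
  subharmonic_on U u.
Proof.
move=> cu Hu; split=> // c r g r0 cU hg cg ug z zB.
pose A := eclosed_ball c r.
have BA y : eball c r y -> A y by move=> /ltW.
rewrite -subr_le0; apply: (@dd_max_principle _ _ N0 A 0 (fun y => u y - g y)); last exact: BA.
- apply: (@compact_enorm _ _ _ (r + enorm c)); first exact: closed_eclosed_ball.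
  by move=> y yr; have := enorm_subl y c; move: yr; rewrite /A /eclosed_ball /=; lra.
- move=> y; apply: (@cvgB _ _ _ _ _ u g); last exact: cg.
  apply: continuous_in_subspaceT => t; rewrite inE => At; apply: cu; exact: cU.
move=> y Ay; rewrite subr_gt0 => gu e e0.
have yB : eball c r y.
  rewrite /eball /= lt_neqAle Ay andbT; apply/eqP => yr.
  by move: gu; rewrite ltNge ug.
have e20 : 0 < e / 3 by rewrite divr_gt0.
have [d1 d10 H1] := Hu y (cU _ Ay) _ e20.
have [d2 d20 H2] := dd_harmonic (@open_eball R N c r) yB hg e20.
pose d3 := r - enorm (y - c); have d30 : 0 < d3 by rewrite subr_gt0.
pose h := Num.min d1 (Num.min d2 d3) / 2.
have m0 : 0 < Num.min d1 (Num.min d2 d3) by rewrite !lt_min d10 d20.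
have h0 : 0 < h by rewrite divr_gt0.
have hm : h < Num.min d1 (Num.min d2 d3) by rewrite /h ltr_pdivrMr// ltr_pMr// ltr1n.
move: hm; rewrite !lt_min => /andP[h1 /andP[h2 h3]].
have Ash i s : `|s| = h -> A (y + s *: delta_mx ord0 i).
  move=> sh; rewrite /A /eclosed_ball /= addrAC (le_trans (enormD _ _))//.
  by rewrite enormZ enorm_delta mulr1 sh; rewrite /d3 in h3; lra.
exists h; split => //.
- by move=> i; apply: Ash; rewrite gtr0_norm.
- by move=> i; rewrite -scaleNr; apply: Ash; rewrite normrN gtr0_norm.
have := H1 h h0 h1; have := H2 h h0 h2; rewrite ddB ler_norml => /andP[_ ?] ?.
have : 0 < e * h ^+ 2 by rewrite mulr_gt0// exprn_gt0.
lra.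
Qed.

Lemma is_derive_affine (a : R) (b : V) x i :
  is_derive x (delta_mx ord0 i) (fun y => a + dot y b) (b ord0 i).
Proof.
have H : (fun h : R => h^-1 *: (((fun y => a + dot y b) \o shift x) (h *: delta_mx ord0 i)
    - (a + dot x b))) @ 0^' --> b ord0 i.
  apply: cvg_near_cst; near=> h; rewrite /= dotDl (dotC (_ *: _)) dotZr dot_delta.
  have h0 : h != 0 by near: h; exact: nbhs_dnbhs_neq.
  by rewrite /GRing.scale /=; field.
split; first by apply/cvg_ex; exists (b ord0 i).
exact: cvg_lim H.
Unshelve. all: by end_near.
Qed.

Lemma partial_affine (a : R) (b : V) i : partial i (fun y => a + dot y b) = fun=> b ord0 i.
Proof. by apply/funext => x; apply: (@derive_val _ _ _ _ _ _ _ (is_derive_affine a b x i)). Qed.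

Lemma dot0 x : dot x 0 = 0.
Proof. by rewrite /dot big1// => i _; rewrite mxE mulr0. Qed.

Lemma continuous_affine (a : R) (b : V) x : {for x, continuous (fun y => a + dot y b)}.
Proof.
apply/continuous_enormP => e e0; exists (e / (enorm b + 1)).
  by rewrite divr_gt0// ltr_wpDl// enorm_ge0.
move=> y; rewrite ltr_pdivlMr ?ltr_wpDl ?enorm_ge0// => ye.
rewrite (_ : _ - _ = dot (y - x) b); last first.
  by rewrite dotDl (dotC (- x)) dotNr (dotC b); ring.
rewrite (le_lt_trans (normr_dot _ _))// (le_lt_trans _ ye)// ler_wpM2l ?enorm_ge0//.
by rewrite lerDl.
Qed.

Lemma harmonic_affine U (a : R) (b : V) : harmonic_on U (fun y => a + dot y b).
Proof.
have C (c : R) : (fun _ : V => c) = fun y => c + dot y 0.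
  by apply/funext => y; rewrite dot0 addr0.
split; last first.
  move=> x Ux; rewrite /laplacian big1// => i _.
  by rewrite partial_affine C partial_affine mxE.
split=> [x _|i]; first exact: continuous_affine.
split=> [x _|]; first by have [] := is_derive_affine a b x i.
rewrite partial_affine C; split=> [x _|j]; first exact: continuous_affine.
split=> [x _|]; first by have [] := is_derive_affine (b ord0 i) 0 x j.
by split=> // x _; rewrite partial_affine C; exact: continuous_affine.
Qed.

(* The function [|y|^2] is affine on every sphere, so the comparison principle
   with affine functions suffices. *)
Lemma subharmonic_max_principle U u (M : R) : open U -> bounded_set U ->
  {within closure U, continuous u} -> subharmonic_on U u ->
  (forall z, (closure U `\` U) z -> u z <= M) -> forall x, U x -> u x <= M.
Proof.
move=> oU bU cu [_ su] uM x Ux.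
have [B B0 UB] := enorm_bounded bU.
have cUB y : closure U y -> enorm y <= B.
  move=> cUy; suff : eclosed_ball 0 B y by rewrite /eclosed_ball /= subr0.
  apply: (@closed_eclosed_ball R N 0 B); apply: closure_subset cUy => z Uz.
  by rewrite /eclosed_ball /= subr0 ltW// UB.
have ccU : compact (closure U) by apply: compact_enorm cUB; exact: closed_closure.
have cUx : closure U x by exact: subset_closure.
rewrite -(addr0 M); apply/ler_addgt0Pr => d d0; rewrite addr0.
pose e := d / (B ^+ 2 + 1).
have B2 : 0 < B ^+ 2 + 1 by rewrite ltr_wpDl// sqr_ge0.
have e0 : 0 < e by rewrite divr_gt0.
pose f y := u y + e * sq y.
have cf : {within closure U, continuous f}.
  move=> y; rewrite /continuous_at; apply: (@cvgD _ _ _ _ _ u (fun y => e * sq y)); first exact: cu.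
  apply: (@continuous_subspaceT _ _ (closure U) (fun y => e * sq y)) => z.
  have hz : {for z, continuous (fun y : V => e * sq y)}.
    by apply: continuousM; [exact: cst_continuous|exact: continuous_sq].
  exact: hz.
have [p cUp fp] := compact_EVT_max (ex_intro _ x cUx) ccU cf.
have {}cUp := set_mem cUp.
have fx : f x <= f p by apply: fp; exact: mem_set.
have [Up|nUp] := pselect (U p); last first.
  have : u p <= M by apply: uM.
  have : e * sq p <= e * (B ^+ 2 + 1).
    rewrite ler_wpM2l ?(ltW e0)// ler_wpDr// -enorm_le ?(ltW B0)//.
    exact: cUB.
  rewrite {2}/e divfK ?gt_eqF//.
  have := mulr_ge0 (ltW e0) (sq_ge0 x).
  by move: fx; rewrite /f; lra.
have [r r0 rU] : exists2 r : R, 0 < r & eball p r `<=` U.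
  by apply/nbhs_enormP; apply: open_nbhs_nbhs; split.
pose s := r / 2; have s0 : 0 < s by rewrite divr_gt0.
have sU : eclosed_ball p s `<=` U.
  move=> y ys; apply: rU; rewrite /eball /=; apply: le_lt_trans ys _.
  by rewrite /s ltr_pdivrMr// ltr_pMr// ltr1n.
(* The affine function equal to f p - e |y|^2 on the sphere around [p]. It dominates [u] there, but
   at [p] its value is u p - e s^2, which is the contradiction. *)
pose a := f p + e * sq p - e * s ^+ 2; pose b : V := (- (2 * e)) *: p.
have hE y : a + dot y b = f p - e * (sq p + 2 * dot p (y - p) + s ^+ 2).
  rewrite /a /b dotZr (dotC p) dotDl (dotC (- p)) dotNr.
  by rewrite (_ : dot p p = sq p)//; ring.
have := su p s (fun y => a + dot y b) s0 sU (harmonic_affine _ a b).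
have ca : {within eclosed_ball p s, continuous (fun y : V => a + dot y b)}.
  apply: continuous_subspaceT => z; exact: continuous_affine.
move=> /(_ ca); have ub z : esphere p s z -> u z <= a + dot z b.
  rewrite /esphere /= => zs.
  have cz : closure U z.
    by apply: subset_closure; apply: sU; rewrite /eclosed_ball /= zs.
  have E : sq z = sq p + 2 * dot p (z - p) + s ^+ 2.
    by rewrite -zs enormE -sqD addrC subrK.
  have := fp z (mem_set cz); rewrite hE -E.
  by rewrite /f; lra.
move=> /(_ ub p); rewrite /eball /= subrr enorm0 => /(_ s0); rewrite hE subrr dot0.
have : 0 < e * s ^+ 2 by rewrite mulr_gt0// exprn_gt0.
by rewrite /f; lra.
Qed.

(** By the maximum principle all subfunctions lie below [M], so the [sup] in [perron] is a genuine
    least upper bound. *)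
Lemma perron_ge U (phi u : V -> R) (M : R) : open U -> bounded_set U ->
  (forall z, (closure U `\` U) z -> phi z <= M) -> subfunctions U phi u ->
  forall x, U x -> u x <= perron U phi x.
Proof.
move=> oU bU pM su x Ux; apply: ub_le_sup; last by exists u.
exists M => _ [v [cv sv vphi] <-].
apply: (subharmonic_max_principle oU bU cv sv) => // z bz.
exact: le_trans (vphi z bz) (pM z bz).
Qed.

End perron.

(** * Green potentials of bounded densities *)

Section singular.
Context (R : realType) (N : nat).
Hypothesis N2 : (2 <= N)%N.
Local Notation V := 'rV[R]_N.
Local Notation gam := (@gam R N).
Local Notation en := (@en R N).
Local Notation psi := (@psi R N).
Local Notation kap := (@kap R N).
Local Notation om := (omegaN R N).
Implicit Types (A : set V) (x y z v : V) (r s t : R).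

Lemma psi_sqr t : 0 < t -> psi (t ^+ 2) = (t ^+ N.-1)^-1.
Proof.
move=> t0; rewrite /psi pw_sqr// mulrN mulrC divfK// -pwNn//.
by rewrite -[in RHS]subn1 natrB// ltnW.
Qed.

Lemma psi_le m1 m : 0 < m1 -> m1 <= m -> psi m <= psi m1.
Proof.
move=> *; apply: pw_le => //; rewrite oppr_le0 divr_ge0// subr_ge0 ler1n ltnW//.
Qed.

Lemma psi_gt0 m : 0 < psi m. Proof. exact: pw_gt0. Qed.

Lemma mrow_psi_ms tau z : mrow (fun x => psi (ms tau z x)).
Proof. by apply: mrow_comp; [exact: measurable_pw|exact: mrow_ms]. Qed.

Lemma ms_ge tau z x : tau ^+ 2 <= ms tau z x.
Proof. by rewrite /ms lerDr sq_ge0. Qed.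

Lemma ms_gt0 tau z x : 0 < tau -> 0 < ms tau z x.
Proof. by move=> t0; apply: lt_le_trans (ms_ge _ _ _); rewrite exprn_gt0. Qed.

Lemma tame_eball c r : tame (\1_(eball c r) : V -> R).
Proof. by apply: tame_indic; [exact: mesV_eball|exact: bounded_sq_eball]. Qed.

Lemma tame_psi c r tau z : 0 < tau ->
  tame (fun x => \1_(eball c r : set V) x * psi (ms tau z x)).
Proof.
move=> t0; apply: tameM; [exact: tame_eball|exact: mrow_psi_ms|].
exists (psi (tau ^+ 2)) => x _; rewrite gtr0_norm ?psi_gt0//.
by apply: psi_le; [rewrite exprn_gt0|exact: ms_ge].
Qed.

Lemma intV_eball r : 0 < r -> intV (\1_(eball (0 : V) r) : V -> R) = om * r ^+ N.
Proof. by move=> r0; rewrite intV_indic ?vol_eball 1?mulrC//; exact: mesV_eball. Qed.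

(** The integral of |x|^(1-N) over a ball is of order [r], uniformly in the smoothing [s]. The
    radius is halved until it drops below [s], where [psi] is at most s^(1-N). *)
Lemma intV_psi_ball s r : 0 < s -> 0 < r ->
  intV (fun x => \1_(eball (0 : V) r) x * psi (ms s 0 x)) <= 2 ^+ N * om * r.
Proof.
move=> s0 r0; have om0 := omegaN_gt0 R N.
have N1 : N = N.-1.+1 by rewrite prednK// ltnW.
pose I r := intV (fun x => \1_(eball (0 : V) r) x * psi (ms s 0 x)).
have [n rn] : exists n, r <= 2 ^+ n * s.
  have [n hn] : exists n : nat, r / s < n%:R.
    by exists (Num.bound (r / s)); rewrite archi_boundP// divr_ge0 ?ltW.
  exists n; move: hn; rewrite ltr_pdivrMr// => /ltW/le_trans; apply.
  rewrite ler_wpM2r ?(ltW s0)// -natrX ler_nat ltnW// ltn_expl//.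
rewrite -/(I r); elim: n r r0 rn => [|n IHn] r r0.
  rewrite expr0 mul1r => rs.
  have h1 : I r <= intV (fun x => (s ^+ N.-1)^-1 * \1_(eball (0 : V) r) x).
    apply: le_intV; [exact: tame_psi|by apply: tameZ; exact: tame_eball|].
    move=> x; rewrite mulrC ler_wpM2r ?indicE// -psi_sqr//.
    by apply: psi_le; [rewrite exprn_gt0|exact: ms_ge].
  apply: (le_trans h1); rewrite intVZ ?intV_eball//; last exact: tame_eball.
  rewrite [X in om * _ ^+ X]N1 exprSr.
  have s1 : 0 < s ^+ N.-1 by rewrite exprn_gt0.
  have h : r ^+ N.-1 / s ^+ N.-1 <= 1.
    by rewrite ler_pdivrMr// mul1r lerXn2r ?nnegrE ?(ltW r0) ?(ltW s0).
  have : (s ^+ N.-1)^-1 * (om * (r ^+ N.-1 * r)) <= om * r.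
    rewrite [leLHS](_ : _ = (om * r) * (r ^+ N.-1 / s ^+ N.-1)); last by ring.
    by rewrite ler_piMr// mulr_ge0// ltW.
  move=> /le_trans; apply; rewrite -mulrA ler_peMl//.
    by rewrite mulr_ge0// ltW.
  by rewrite exprn_ege1// ler1n.
move=> rn; have r20 : 0 < r / 2 by rewrite divr_gt0.
(* The shell between r / 2 and [r] is charged with the largest value of [psi] on it and the volume
   of the whole ball: this gives 2^N om (r / 2), exactly the increment allowed. *)
have h1 : I r <= intV (fun x => \1_(eball (0 : V) (r / 2)) x * psi (ms s 0 x) +
     psi ((r / 2) ^+ 2) * \1_(eball (0 : V) r) x).
  apply: le_intV; [exact: tame_psi| |].
    by apply: tameD; [exact: tame_psi|apply: tameZ; exact: tame_eball].
  move=> x; rewrite !indicE; have p1 := psi_gt0 (ms s 0 x); have p2 := psi_gt0 ((r / 2) ^+ 2).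
  have [xr|_] := boolP (x \in eball 0 r); last first.
    by rewrite mul0r mulr0 addr0 mulr_ge0 ?(ltW p1).
  rewrite mul1r mulr1; have [_|] := boolP (x \in eball 0 (r / 2)).
    by rewrite mul1r lerDl ltW.
  move=> /negP; rewrite inE /eball /= subr0 => /negP; rewrite -leNgt => xr2.
  rewrite mul0r add0r; apply: psi_le; first by rewrite exprn_gt0.
  rewrite /ms subr0 -[leLHS]addr0 lerD ?sqr_ge0// -enorm_ge ?(ltW r20)//.
apply: (le_trans h1); rewrite intVD; last 2 first.
- exact: tame_psi.
- by apply: tameZ; exact: tame_eball.
rewrite intVZ ?intV_eball//; last exact: tame_eball.
have := IHn (r / 2) r20; rewrite -/(I (r / 2)) => /(_ _)/le_trans => H.
have {}H : I (r / 2) <= 2 ^+ N * om * (r / 2).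
  by apply: IHn => //; rewrite ler_pdivrMr// mulrAC -exprSr.
rewrite psi_sqr//.
have -> : (((r / 2) ^+ N.-1)^-1 * (om * r ^+ N)) = 2 ^+ N * om * (r / 2).
  have E (t : R) : t ^+ N = t ^+ N.-1 * t by rewrite -exprSr -N1.
  rewrite !E expr_div_n; field.
  by rewrite !expf_neq0// gt_eqF.
by rewrite -/(I (r / 2)); lra.
Qed.

Lemma gam_ms_ge0 s t x z : 0 < s -> s <= t -> 0 <= gam (ms s x z) - gam (ms t x z).
Proof.
move=> s0 st; rewrite subr_ge0; apply: gam_le => //; first exact: ms_gt0.
by rewrite /ms lerD2l lerXn2r// nnegrE ltW// (lt_le_trans s0).
Qed.

Lemma tame_gam A tau z : tame (\1_A : V -> R) -> 0 < tau ->
  tame (fun x => \1_A x * gam (ms tau z x)).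
Proof.
move=> tA t0; apply: tameM; [exact: tA|exact: mrow_gam_ms|].
have [_ [M HM]] := tA.
exists (Num.max `|gam (tau ^+ 2)| `|gam (2 * M + 2 * sq z + tau ^+ 2)|) => x xA.
have xM : sq x <= M.
  by rewrite leNgt; apply/negP => /(proj2 (HM x)) h; rewrite h eqxx in xA.
have b : ms tau z x <= 2 * M + 2 * sq z + tau ^+ 2.
  rewrite /ms lerD2r sqB.
  have := sqr_ge0 (enorm x - enorm z); have := normr_dot x z; rewrite ler_norml => /andP[].
  rewrite sqrrB !enormE; lra.
have m0 := ms_gt0 z x t0; have t20 : 0 < tau ^+ 2 by rewrite exprn_gt0.
have g1 := gam_le N2 t20 (ms_ge tau z x); have g2 := gam_le N2 m0 b.
rewrite le_max; have [g|g] := leP 0 (gam (ms tau z x)).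
  by rewrite ger0_norm// (le_trans g1 (ler_norm _)).
apply/orP; right; rewrite (ltr0_norm g) -[leRHS]normrN.
by apply: le_trans (ler_norm _); rewrite lerN2.
Qed.

(** Split at distance [r] from [x]. Near [x] the difference is at most 2^(1/2) [psi], because r and
    t are at most 1, and has integral O(r); farther away [gam] is Lipschitz and the difference is
    O(t^2). Nothing depends on [s], [x] or [A]. *)
Lemma gam_smoothing (B e : R) : 0 < B -> 0 < e -> exists2 t0 : R, 0 < t0 <= 1 &
  forall s t x A, 0 < s -> s <= t -> t <= t0 -> mesV A -> A `<=` eball x B ->
    intV (fun z => \1_A z * (gam (ms s x z) - gam (ms t x z))) <= e.
Proof.
move=> B0 e0; have om0 := omegaN_gt0 R N.
pose c0 := pw 2^-1 2 * (2 ^+ N * om) + 1.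
have c00 : 0 < c0 by rewrite ltr_wpDl// !mulr_ge0 ?exprn_ge0// ltW// pw_gt0.
pose r := Num.min 1 (e / (2 * c0)).
have r0 : 0 < r by rewrite lt_min ltr01 divr_gt0// mulr_gt0.
have r1 : r <= 1 by rewrite ge_min lexx.
have rc : c0 * r <= e / 2.
  apply: (@le_trans _ _ (c0 * (e / (2 * c0)))).
    by rewrite ler_wpM2l ?(ltW c00)// ge_min lexx orbT.
  by rewrite le_eqVlt; apply/orP; left; apply/eqP; field; rewrite gt_eqF.
have r20 : 0 < r ^+ 2 by rewrite exprn_gt0.
pose K := kap / 2 * en (r ^+ 2).
have K0 : 0 < K by rewrite mulr_gt0 ?en_gt0// divr_gt0// kap_gt0.
have BN : 0 < om * B ^+ N by rewrite mulr_gt0// exprn_gt0.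
pose c1 := K * (om * B ^+ N); have c10 : 0 < c1 by rewrite mulr_gt0.
pose t0 := Num.min 1 (e / (2 * c1)).
have t00 : 0 < t0 by rewrite lt_min ltr01 divr_gt0// mulr_gt0.
have t01 : t0 <= 1 by rewrite ge_min lexx.
exists t0; first by rewrite t00 t01.
move=> s t x A s0 st tt0 mA AB.
have t_gt0 : 0 < t := lt_le_trans s0 st.
have t1 : t <= 1 := le_trans tt0 t01.
have tc : c1 * t ^+ 2 <= e / 2.
  have : t ^+ 2 <= t0 by apply: le_trans tt0; rewrite expr2 ler_piMr// ltW.
  have : c1 * t0 <= c1 * (e / (2 * c1)).
    by rewrite ler_wpM2l ?(ltW c10)// ge_min lexx orbT.
  have -> : c1 * (e / (2 * c1)) = e / 2 by field; rewrite gt_eqF.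
  by move=> h /(ler_wpM2l (ltW c10)) h'; lra.
have tA : tame (\1_A : V -> R).
  apply: tame_indic => //; have [M HM] := bounded_sq_eball x B.
  by exists M => z /AB; exact: HM.
pose G z := pw 2^-1 2 * (\1_(eball (0 : V) r) z * psi (ms s 0 z)) +
   (K * t ^+ 2) * \1_(eball (0 : V) B) z.
have tG : tame G.
  by apply: tameD; apply: tameZ; [exact: tame_psi|exact: tame_eball].
have IG : intV G <= e.
  rewrite /G intVD; last 2 first.
  - by apply: tameZ; exact: tame_psi.
  - by apply: tameZ; exact: tame_eball.
  rewrite !intVZ; [|exact: tame_eball|exact: tame_psi].
  rewrite intV_eball//.
  have h1 := intV_psi_ball s0 r0.
  have h2 : pw 2^-1 2 * intV (fun x => \1_(eball (0 : V) r) x * psi (ms s 0 x)) <=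
     pw 2^-1 2 * (2 ^+ N * om * r) by rewrite ler_wpM2l// ltW// pw_gt0.
  have h3 : pw 2^-1 2 * (2 ^+ N * om * r) <= c0 * r.
    by rewrite /c0 mulrDl mul1r mulrA lerDl ltW.
  have h4 : K * t ^+ 2 * (om * B ^+ N) = c1 * t ^+ 2 by rewrite /c1; ring.
  by rewrite h4; lra.
apply: le_trans IG; rewrite -(intV_shift (- x) tG); apply: le_intV.
- rewrite (_ : (fun _ => _) = fun z => \1_A z * gam (ms s x z) - \1_A z * gam (ms t x z)).
    by apply: tameB; apply: tame_gam.
  by apply/funext => z; ring.
- exact: tame_shift.
move=> z; rewrite /G.
have msx u : ms u x z = ms u 0 (z - x) by rewrite /ms subr0.
rewrite !msx; set y := z - x; rewrite !indicE.
have Kt : 0 <= K * t ^+ 2 by rewrite mulr_ge0 ?sqr_ge0// ltW.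
have P1 : 0 <= pw 2^-1 (2 : R) := ltW (pw_gt0 _ _).
have P2 : 0 <= psi (ms s 0 y) := ltW (psi_gt0 _).
have G0 : 0 <= pw 2^-1 2 * ((y \in eball (0:V) r)%:R * psi (ms s 0 y)) +
    K * t ^+ 2 * (y \in eball (0:V) B)%:R.
  by rewrite addr_ge0// mulr_ge0// mulr_ge0.
have [zA|_] := boolP (z \in A); last by rewrite mul0r.
have yB : y \in eball (0 : V) B.
  by apply/mem_set; move: zA => /set_mem/AB; rewrite /eball /= subr0.
rewrite mul1r yB mulr1.
have [yr|yr] := boolP (y \in eball (0 : V) r).
  rewrite mul1r; apply: ler_wpDr => //.
  have yr2 : sq y < r ^+ 2.
    by move: yr => /set_mem; rewrite /eball /= subr0 enorm_lt// ltW.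
  have ab : ms s 0 y <= ms t 0 y by rewrite /ms lerD2l lerXn2r// nnegrE ltW.
  apply: (le_trans (gam_sub_le_psi N2 (ms_gt0 0 y s0) ab)).
  apply: ler_wpM2r; first exact: ltW (psi_gt0 _).
  rewrite /pw ler_expR ler_wpM2l//.
  rewrite ler_ln ?posrE ?ms_gt0// /ms subr0.
  have : r ^+ 2 <= 1 by rewrite exprn_ile1// ltW.
  have : t ^+ 2 <= 1 by rewrite exprn_ile1// ltW.
  lra.
rewrite mul0r mulr0 add0r.
have yr2 : r ^+ 2 <= sq y.
  rewrite -enorm_ge ?(ltW r0)// leNgt; apply/negP => h.
  by move/negP: yr; apply; apply/mem_set; rewrite /eball /= subr0.
have q1 : r ^+ 2 <= ms s 0 y by rewrite /ms subr0 ler_wpDr// sqr_ge0.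
have q2 : r ^+ 2 <= ms t 0 y by rewrite /ms subr0 ler_wpDr// sqr_ge0.
apply: (le_trans (ler_norm _)); apply: (le_trans (gam_lip N2 r20 q2 q1)).
rewrite ler_wpM2l ?(ltW K0)// /ms (_ : _ - _ = s ^+ 2 - t ^+ 2); last by ring.
have s2t : s ^+ 2 <= t ^+ 2 by rewrite lerXn2r// nnegrE ltW.
have := sqr_ge0 s; have := sqr_ge0 t.
by rewrite ler_norml; clear -s2t => ? ?; apply/andP; split; lra.
Qed.

End singular.

Lemma ler_norm_sub (R : realDomainType) (p q r : R) :
  p - q <= r -> q - p <= r -> `|p - q| <= r.
Proof. by move=> h1 h2; rewrite ler_norml h1 andbT lerNl opprB. Qed.

(** * Approximation, continuity and second differences of potentials *)

Section potential.
Context (R : realType) (N : nat).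
Hypothesis N2 : (2 <= N)%N.
Local Notation V := 'rV[R]_N.
Local Notation gam := (@gam R N).
Local Notation en := (@en R N).
Local Notation en1 := (@en1 R N).
Local Notation kap := (@kap R N).
Implicit Types (A : set V) (x y z v : V) (r s t tau h : R) (rho f : V -> R).

Variables (L D : R).
Hypotheses (D0 : 0 < D) (DL : D < L).
Variable K : set V.
Hypotheses (mK : mesV K) (KD : forall x, K x -> enorm x <= D).
Local Notation gr := (@gr R N L).
Local Notation mr := (@mr R N L).

Let L0 : 0 < L. Proof. exact: lt_trans DL. Qed.

Definition density (lam : R) rho := mrow rho /\ forall z, 0 <= rho z <= lam * \1_K z.

Lemma bounded_sqK : bounded_sq K.
Proof. by exists (D ^+ 2) => x /KD h; rewrite -enorm_le// ltW. Qed.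

Lemma tameK : tame (\1_K : V -> R).
Proof. exact: tame_indic mK bounded_sqK. Qed.

Lemma densityK lam rho z : density lam rho -> rho z != 0 -> K z.
Proof.
move=> [_ H]; apply: contra_neqP => nK; apply/le_anti; have := H z.
rewrite indicE; have [/set_mem//|_] := boolP (z \in K).
by rewrite mulr0 andbC.
Qed.

Lemma tame_density lam rho : density lam rho -> tame rho.
Proof.
move=> [mrho H]; split=> //; exists (Num.max `|lam| (D ^+ 2)) => x; split.
  rewrite le_max; apply/orP; left; have /andP[h1 h2] := H x.
  rewrite ger0_norm// (le_trans h2)// indicE.
  by case: (_ \in _); rewrite ?mulr1 ?mulr0// ler_norm.
rewrite gt_max => /andP[_ h]; apply/eqP; apply: contraTT h => rx.
by rewrite -leNgt -enorm_le ?(ltW D0)// KD//; apply: densityK rx; split.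
Qed.

Lemma tame_density_gr lam rho tau x : density lam rho -> 0 < tau -> enorm x <= L ->
  tame (fun z => rho z * gr tau x z).
Proof.
move=> dr t0 xL; apply: tameM; first exact: tame_density dr.
  rewrite (_ : gr tau x = gr tau ^~ x); first exact: mrow_gr.
  by apply/funext => z; rewrite grC.
have t20 : 0 < tau ^+ 2 by rewrite exprn_gt0.
have [C C0 HC] := gr_lipr N2 D0 DL t20.
exists (`|gr tau x 0| + C * D) => z rz.
have zD : enorm z <= D by apply: KD; exact: densityK dr rz.
have z0 : enorm (0 : V) <= D by rewrite enorm0 ltW.
have := HC tau x z 0 xL zD z0 (ms_ge _ _ _) (ms_ge _ _ _).
rewrite subr0 => h.
have : `|gr tau x z| <= `|gr tau x 0| + `|gr tau x z - gr tau x 0|.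
  by rewrite -{1}(subrK (gr tau x 0) (gr tau x z)) addrC ler_normD.
have : C * enorm z <= C * D by rewrite ler_wpM2l// ltW.
lra.
Qed.

Lemma intV_density_le lam rho f c : density lam rho -> tame (fun z => rho z * f z) ->
  0 <= c -> (forall z, rho z != 0 -> f z <= c) -> intV (fun z => rho z * f z) <= lam * vol K * c.
Proof.
move=> dr tf c0 fc.
rewrite -(intV_indic mK) mulrAC -intVZ; last exact: tameK.
apply: le_intV => //; first by apply: tameZ; exact: tameK.
move=> z; have /andP[h1 h2] := dr.2 z.
have [->|rz] := eqVneq (rho z) 0; first by rewrite mul0r mulrAC mulr_ge0// (le_trans h1).
rewrite mulrAC; apply: (@le_trans _ _ (rho z * c)); first by rewrite ler_wpM2l// fc.
by rewrite ler_wpM2r.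
Qed.

Definition Pt rho tau x : R := intV (fun z => rho z * gr tau x z).

(** [Pt] grows as [tau] decreases to 0, so this supremum is the limit, the Green potential of [rho];
    it is obtained from bounded kernels only. *)
Definition pot rho x : R := sup [set Pt rho tau x | tau in [set tau | 0 < tau <= 1]].

Lemma Pt_mono lam rho s t x : density lam rho -> enorm x <= L -> 0 < s -> s <= t ->
  Pt rho t x <= Pt rho s x.
Proof.
move=> dr xL s0 st; apply: le_intV.
- by apply: tame_density_gr dr _ xL; exact: lt_le_trans st.
- exact: tame_density_gr dr _ xL.
move=> z; have /andP[h1 _] := dr.2 z.
rewrite ler_wpM2l// lerD2r msC (msC s) -subr_ge0.
exact: gam_ms_ge0.
Qed.

Lemma Pt_smoothing lam e : 0 < lam -> 0 < e -> exists2 t0 : R, 0 < t0 <= 1 &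
  forall rho s t x, density lam rho -> 0 < s -> s <= t -> t <= t0 -> enorm x <= L ->
    Pt rho s x <= Pt rho t x + e.
Proof.
move=> lam0 e0; have B0 : 0 < 2 * L by rewrite mulr_gt0.
have [t0 t01 H] := gam_smoothing N2 B0 (divr_gt0 e0 lam0).
exists t0 => // rho s t x dr s0 st tt0 xL.
have t_gt0 : 0 < t := lt_le_trans s0 st.
rewrite -lerBlDl /Pt -intVB; [|exact: tame_density_gr dr _ xL|exact: tame_density_gr dr _ xL].
have KB : K `<=` eball x (2 * L).
  move=> z /KD zD; rewrite /eball /= (le_lt_trans (enormB _ _))//.
  have := le_lt_trans zD DL; lra.
have := H s t x K s0 st tt0 mK KB; rewrite ler_pdivlMr// mulrC => /(le_trans _); apply.
have tk u : 0 < u -> tame (fun z => \1_K z * gam (ms u x z)).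
  by move=> u0; apply: tame_gam => //; exact: tameK.
have tkk : tame (fun z => \1_K z * (gam (ms s x z) - gam (ms t x z))).
  rewrite (_ : (fun _ => _) = fun z => \1_K z * gam (ms s x z) - \1_K z * gam (ms t x z)).
    by apply: tameB; apply: tk.
  by apply/funext => z; ring.
rewrite -intVZ//; apply: le_intV.
- by apply: tameB; exact: tame_density_gr dr _ xL.
- exact: tameZ.
move=> z; have /andP[h1 h2] := dr.2 z.
rewrite mulrA (_ : _ - _ = rho z * (gam (ms s x z) - gam (ms t x z))); last first.
  by rewrite /gr (msC s) (msC t); ring.
by rewrite ler_wpM2r//; exact: gam_ms_ge0.
Qed.

Lemma has_sup_Pt lam rho x : 0 < lam -> density lam rho -> enorm x <= L ->
  has_sup [set Pt rho tau x | tau in [set tau | 0 < tau <= 1]].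
Proof.
move=> lam0 dr xL; split; first by exists (Pt rho 1 x); exists 1 => //=; rewrite ltr01 lexx.
have [t0 /andP[t00 t01] H] := Pt_smoothing lam0 ltr01.
exists (Pt rho t0 x + 1) => _ [t /= /andP[t_gt0 t1] <-].
have [tt0|t0t] := leP t t0; first exact: H.
apply: (le_trans (Pt_mono dr xL t00 (ltW t0t))); by rewrite lerDl.
Qed.

(** The bound [lam] on the densities makes [t0] uniform in [rho] and [x]. The scale can therefore be
    fixed before the density is found. *)
Lemma pot_approx lam e : 0 < lam -> 0 < e -> exists2 t0 : R, 0 < t0 <= 1 &
  forall rho t x, density lam rho -> 0 < t -> t <= t0 -> enorm x <= L ->
    Pt rho t x <= pot rho x <= Pt rho t x + e.
Proof.
move=> lam0 e0; have [t0 /andP[t00 t01] H] := Pt_smoothing lam0 e0.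
exists t0; first by rewrite t00.
move=> rho t x dr t_gt0 tt0 xL; have hs := has_sup_Pt lam0 dr xL.
apply/andP; split.
  by apply: ub_le_sup; [exact: hs.2|exists t => //=; rewrite t_gt0 (le_trans tt0)].
apply: ge_sup; first exact: hs.1.
move=> _ [s /= /andP[s0 s1] <-]; have [st|ts] := leP s t; first exact: H.
apply: (le_trans (Pt_mono dr xL t_gt0 (ltW ts))); by rewrite lerDl ltW.
Qed.

Lemma Pt_lip lam tau : 0 < lam -> 0 < tau -> exists2 C : R, 0 < C & forall rho x y,
  density lam rho -> enorm x <= L -> enorm y <= L ->
  `|Pt rho tau x - Pt rho tau y| <= C * enorm (x - y).
Proof.
move=> lam0 t0; have t20 : 0 < tau ^+ 2 by rewrite exprn_gt0.
have [C C0 HC] := gr_lip N2 D0 DL t20.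
exists (lam * vol K * C + 1); first by rewrite ltr_wpDl// !mulr_ge0 ?vol_ge0// ltW.
move=> rho x y dr xL yL.
have H a b : enorm a <= L -> enorm b <= L ->
    Pt rho tau a - Pt rho tau b <= (lam * vol K * C + 1) * enorm (a - b).
  move=> aL bL; have ta := tame_density_gr dr t0 aL; have tb := tame_density_gr dr t0 bL.
  rewrite /Pt -intVB//.
  rewrite (@eq_intV _ _ _ (fun z => rho z * (gr tau a z - gr tau b z))); last first.
    by move=> z; ring.
  apply: (@le_trans _ _ (lam * vol K * (C * enorm (a - b)))); last first.
    by rewrite mulrA ler_wpM2r ?enorm_ge0// lerDl.
  apply: (intV_density_le dr).
  - rewrite (_ : (fun _ => _) = fun z => rho z * gr tau a z - rho z * gr tau b z).
      exact: tameB.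
    by apply/funext => z; ring.
  - by rewrite mulr_ge0 ?enorm_ge0// ltW.
  move=> z /(densityK dr)/KD zD; apply: le_trans (ler_norm _) _.
  by apply: HC => //; exact: ms_ge.
have h1 := H x y xL yL; have h2 := H y x yL xL.
rewrite (enormBC y x) in h2.
exact: (ler_norm_sub h1 h2).
Qed.

Lemma pot_continuous lam rho x : 0 < lam -> density lam rho -> enorm x < L ->
  {for x, continuous (pot rho)}.
Proof.
move=> lam0 dr xL; apply/continuous_enormP => e e0.
have e40 : 0 < e / 4 by rewrite divr_gt0.
have [t0 /andP[t00 t01] H] := pot_approx lam0 e40.
have [C C0 HC] := Pt_lip lam0 t00.
pose d := Num.min (L - enorm x) (e / 4 / C).
have d0 : 0 < d by rewrite lt_min subr_gt0 xL !divr_gt0.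
exists d => // y; rewrite lt_min => /andP[y1 y2].
have yL : enorm y <= L.
  by have := enorm_subl y x; lra.
have := H rho t0 x dr t00 (lexx _) (ltW xL); have := H rho t0 y dr t00 (lexx _) yL.
have := HC rho y x dr yL (ltW xL).
rewrite ltr_pdivlMr// mulrC in y2; rewrite ler_norml ltr_norml.
move: (Pt rho t0 x) (Pt rho t0 y) (pot rho x) (pot rho y) => p1 p2 p3 p4.
by clear -y2; move=> /andP[? ?] /andP[? ?] /andP[? ?]; apply/andP; split; lra.
Qed.

(** The smoothed kernel may be negative near the sphere, but at a given interior point it is
    nonnegative on [K] once t^2 is below the gap between [mr] and the squared distance. *)
Lemma pot_ge0 lam rho x : 0 < lam -> density lam rho -> enorm x < L -> 0 <= pot rho x.
Proof.
move=> lam0 dr xL; have [t0 /andP[t00 t01] H] := pot_approx lam0 (@ltr01 R).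
pose g := (L ^+ 2 - sq x) * (L ^+ 2 - D ^+ 2) / L ^+ 2.
have xL2 : 0 < L ^+ 2 - sq x by rewrite subr_gt0 -enorm_lt// ltW.
have DL2 : 0 < L ^+ 2 - D ^+ 2 by rewrite subr_gt0 ltrXn2r ?nnegrE// ltW.
have g0 : 0 < g by rewrite !mulr_gt0// invr_gt0 exprn_gt0.
pose t := Num.min t0 g.
have t_gt0 : 0 < t by rewrite lt_min t00.
have tt0 : t <= t0 by rewrite ge_min lexx.
have /andP[+ _] := H rho t x dr t_gt0 tt0 (ltW xL); apply: le_trans.
apply: intV_ge0 => z; have /andP[h1 _] := dr.2 z.
have [->|rz] := eqVneq (rho z) 0; first by rewrite mul0r.
have zD := KD (densityK dr rz).
have tg : t ^+ 2 <= (L ^+ 2 - sq x) * (L ^+ 2 - sq z) / L ^+ 2.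
  apply: (@le_trans _ _ g).
    apply: (@le_trans _ _ t); last by rewrite ge_min lexx orbT.
    by rewrite expr2 ler_piMr ?(ltW t_gt0)// (le_trans tt0).
  rewrite ler_wpM2r ?invr_ge0 ?exprn_ge0 ?(ltW L0)// ler_wpM2l ?(ltW xL2)//.
  by rewrite lerD2l lerN2 -enorm_le// ltW.
rewrite mulr_ge0//; apply: le_trans (gr_ge N2 D0 DL (ltW xL) zD t_gt0 tg).
rewrite !mulr_ge0 ?subr_ge0// ?ltW ?en_gt0// kap_gt0//.
Qed.

(** Where [rho] vanishes around [x], the smoothed kernel has second differences O(h^3) up to a
    source term of order t^2 h^2. For fixed [h] the latter disappears as [t] tends to 0, and O(h^3)
    is below e h^2 for small [h]. *)
Lemma pot_dd lam rho x r : 0 < lam -> density lam rho -> 0 < r -> enorm x + r <= L ->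
  (forall z, enorm (z - x) < r -> rho z = 0) ->
  forall e, 0 < e -> exists2 d, 0 < d & forall h, 0 < h -> h < d ->
    - (e * h ^+ 2) <= dd h (pot rho) x.
Proof.
move=> lam0 dr r0 xrL rz e e0.
pose m1 := (r / 2) ^+ 2.
have m10 : 0 < m1 by rewrite exprn_gt0// divr_gt0.
have [C C0 HC] := dd_gr N2 D0 DL m10.
pose c := lam * vol K * C + 1.
have c0 : 0 < c by rewrite ltr_wpDl// !mulr_ge0 ?vol_ge0// ltW.
pose d := Num.min (Num.min 1 (r / 2)) (e / c).
have r20 : 0 < r / 2 by rewrite divr_gt0.
exists d; first by rewrite !lt_min ltr01 r20 divr_gt0.
move=> h h0; rewrite !lt_min => /andP[/andP[h1 hr] he].
rewrite ltr_pdivlMr// in he.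
have xhL : enorm x + `|h| <= L by rewrite gtr0_norm//; lra.
have shL i s : `|s| = h -> enorm (x + s *: delta_mx ord0 i) <= L.
  by move=> sh; rewrite (le_trans (enormD _ _))// enormZ enorm_delta mulr1 sh; lra.
have N1 : 1 <= N%:R :> R by rewrite ler1n ltnW.
(* [h] being fixed, the potential is replaced by its smooth approximation [Pt rho t] *)
suff H q : 0 < q -> - (c * h ^+ 3) - q <= dd h (pot rho) x.
  move: (dd h (pot rho) x) H => u H.
  have : - (c * h ^+ 3) <= u.
    by apply/ler_addgt0Pr => q q0; have := H q q0; lra.
  apply: le_trans; rewrite lerN2 (_ : c * h ^+ 3 = h ^+ 2 * (h * c)); last by ring.
  by rewrite (mulrC e) ler_wpM2l ?sqr_ge0// ltW.
move=> q0; pose q1 := q / (8 * N%:R).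
have q10 : 0 < q1 by rewrite divr_gt0// mulr_gt0// (lt_le_trans ltr01).
have [t0 /andP[t00 t01] Ht] := pot_approx lam0 q10.
pose k := lam * vol K * (kap * N%:R * en1 m1 * h ^+ 2) + 1.
have e1 := ltW (en1_gt0 N m1); have k1 := ltW (kap_gt0 R N2).
have v0 : 0 <= lam * vol K by rewrite mulr_ge0 ?vol_ge0// ltW.
have k0 : 0 < k.
  by rewrite ltr_wpDl// mulr_ge0// mulr_ge0 ?sqr_ge0// mulr_ge0// mulr_ge0.
(* One half of [q] pays for replacing [pot] by [Pt] in the second difference, the other for the
   source term, which is at most k t^2. *)
pose t := Num.min t0 (q / (2 * k)).
have t_gt0 : 0 < t by rewrite lt_min t00 divr_gt0// mulr_gt0.
have tt0 : t <= t0 by rewrite ge_min lexx.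
have t1 : t <= 1 := le_trans tt0 t01.
have tq : k * t ^+ 2 <= q / 2.
  have a1 : t ^+ 2 <= t by rewrite expr2 ler_piMr// ltW.
  have a2 : t <= q / (2 * k) by rewrite ge_min lexx orbT.
  have : k * t ^+ 2 <= k * (q / (2 * k)) by rewrite ler_wpM2l ?(ltW k0)// (le_trans a1).
  by have -> : k * (q / (2 * k)) = q / 2 by field; rewrite gt_eqF.
have hx : enorm x <= L by apply: le_trans xhL; rewrite lerDl.
have E1 : dd h (Pt rho t) x - q / 2 <= dd h (pot rho) x.
  have -> : q / 2 = \sum_(i < N) 4 * q1.
    by rewrite sumr_const card_ord -mulr_natl /q1; field; rewrite gt_eqF// (lt_le_trans ltr01).
  rewrite /dd -sumrB; apply: ler_sum => i _.
  have hp := shL i h (gtr0_norm h0).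
  have hn : enorm (x - h *: delta_mx ord0 i) <= L.
    by rewrite -scaleNr; apply: shL; rewrite normrN gtr0_norm.
  have := Ht rho t _ dr t_gt0 tt0 hp.
  have := Ht rho t _ dr t_gt0 tt0 hn.
  have := Ht rho t _ dr t_gt0 tt0 hx.
  move: (Pt rho t x) (pot rho x) => p1 p2.
  move: (Pt rho t (x + h *: _)) (pot rho (x + h *: _)) => p3 p4.
  move: (Pt rho t (x - h *: _)) (pot rho (x - h *: _)) => p5 p6.
  by clear; move=> /andP[? ?] /andP[? ?] /andP[? ?]; lra.
have tm i (s : R) : `|s| = h -> tame (fun z => rho z * gr t (x + s *: delta_mx ord0 i) z).
  by move=> sh; apply: tame_density_gr dr t_gt0 _; exact: shL.
have tmx := tame_density_gr dr t_gt0 hx.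
have tmi i : tame (fun z => rho z * gr t (x + h *: delta_mx ord0 i) z +
     rho z * gr t (x - h *: delta_mx ord0 i) z - 2 * (rho z * gr t x z)).
  apply: tameB; last exact: tameZ.
  apply: tameD; first by apply: tm; rewrite gtr0_norm.
  by rewrite -scaleNr; apply: tm; rewrite normrN gtr0_norm.
have E0 z : rho z * dd h (gr t ^~ z) x = \sum_(i < N) (rho z * gr t (x + h *: delta_mx ord0 i) z +
     rho z * gr t (x - h *: delta_mx ord0 i) z - 2 * (rho z * gr t x z)).
  rewrite /dd mulr_sumr; apply: eq_bigr => i _.
  by rewrite mulrBr mulrDr (mulrCA _ 2).
have E2 : dd h (Pt rho t) x = intV (fun z => rho z * dd h (gr t ^~ z) x).
  rewrite (eq_intV E0) /dd /Pt.
  rewrite intV_sum//; apply: eq_bigr => i _.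
  have t1i : tame (fun z => rho z * gr t (x + h *: delta_mx ord0 i) z).
    by apply: tm; rewrite gtr0_norm.
  have t2i : tame (fun z => rho z * gr t (x - h *: delta_mx ord0 i) z).
    by rewrite -scaleNr; apply: tm; rewrite normrN gtr0_norm.
  by rewrite intVB ?intVD ?intVZ//; [exact: tameD|exact: tameZ].
have E3 : - intV (fun z => rho z * dd h (gr t ^~ z) x) <=
    lam * vol K * (C * h ^+ 3 + kap * N%:R * t ^+ 2 * en1 m1 * h ^+ 2).
  have tdd : tame (fun z => rho z * dd h (gr t ^~ z) x).
    rewrite (funext E0); exact: tame_sum.
  rewrite -mulN1r -intVZ//.
  rewrite (@eq_intV _ _ _ (fun z => rho z * - dd h (gr t ^~ z) x)); last first.
    by move=> z; ring.
  apply: (intV_density_le dr).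
  - rewrite (_ : (fun _ => _) = fun z => (-1) * (rho z * dd h (gr t ^~ z) x)).
      exact: tameZ.
    by apply/funext => z; ring.
  - by rewrite addr_ge0// !mulr_ge0 ?exprn_ge0// ltW.
  move=> z rzn; have zD := KD (densityK dr rzn).
  have xz : r <= enorm (z - x).
    by rewrite leNgt; apply/negP => /rz h'; rewrite h' eqxx in rzn.
  have mge i s : `|s| = h -> m1 <= ms t z (x + s *: delta_mx ord0 i).
    move=> sh; rewrite /ms /m1 -[leLHS]addr0 lerD ?sqr_ge0//.
    rewrite -enorm_ge ?(ltW r20)// enormBC.
    have := enorm_triangle (x + s *: delta_mx ord0 i) z x.
    rewrite [X in _ + enorm X](_ : _ = s *: delta_mx ord0 i); last by rewrite addrAC subrr add0r.
    by rewrite enormZ enorm_delta mulr1 sh; clear -xz hr; lra.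
  have mge0 : m1 <= ms t z x.
    rewrite /ms /m1 -[leLHS]addr0 lerD ?sqr_ge0//.
    by rewrite -enorm_ge ?(ltW r20)// enormBC (le_trans _ xz)// ler_pdivrMr// ler_pMr// ler1n.
  have h1' : `|h| <= 1 by rewrite gtr0_norm// ltW.
  have := HC t z x h h1' zD xhL mge0.
  have P1 i : m1 <= ms t z (x + h *: delta_mx ord0 i) by apply: mge; rewrite gtr0_norm.
  have P2 i : m1 <= ms t z (x - h *: delta_mx ord0 i).
    by rewrite -scaleNr; apply: mge; rewrite normrN gtr0_norm.
  move=> /(_ P1 P2); rewrite (gtr0_norm h0) ler_norml => /andP[a1 _].
  have : kap * N%:R * t ^+ 2 * en1 (ms t z x) * h ^+ 2 <= kap * N%:R * t ^+ 2 * en1 m1 * h ^+ 2.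
    rewrite ler_wpM2r ?sqr_ge0// ler_wpM2l ?en1_le//.
    by rewrite mulr_ge0 ?sqr_ge0// mulr_ge0.
  move: (dd h _ x) a1 => u a1; clear -a1; lra.
rewrite -E2 in E3.
have E4 : lam * vol K * (kap * N%:R * t ^+ 2 * en1 m1 * h ^+ 2) <= k * t ^+ 2.
  by rewrite /k mulrDl mul1r [leLHS](_ : _ = lam * vol K * (kap * N%:R * en1 m1 * h ^+ 2) * t ^+ 2); [rewrite lerDl sqr_ge0|ring].
have E5 : lam * vol K * (C * h ^+ 3) <= c * h ^+ 3.
  by rewrite /c mulrDl mul1r mulrA lerDl exprn_ge0// ltW.
rewrite mulrDr in E3.
move: (dd h (Pt rho t) x) (dd h (pot rho) x) E1 E3 => u1 u2 E1 E3; clear -E1 E3 E4 E5 tq; lra.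
Qed.

End potential.

(** * The discrete obstacle problem *)

Section quadratic_program.
Context (R : realType).

(* First-order conditions at a minimiser of [a T a - 2 b a] on the box [[0, lam]^n]. *)
Lemma box_quadratic_program (n : nat) (T : 'I_n -> 'I_n -> R) (b : 'I_n -> R) (lam : R) :
  0 < lam -> (forall i j, T i j = T j i) ->
  exists a : 'I_n -> R, [/\ forall i, 0 <= a i <= lam,
    forall i, 0 < a i -> \sum_j T i j * a j <= b i &
    forall i, a i < lam -> b i <= \sum_j T i j * a j].
Proof.
move=> lam0 Ts.
pose A : set 'rV[R]_n := [set v | forall i, `[0, lam]%classic (v ord0 i)].
have cA : compact A by apply: (@rV_compact R n (fun=> `[0, lam]%classic)) => i; exact: segment_compact.
have A0 : A !=set0.
  by exists 0 => i; rewrite /= mxE in_itv /= lexx ltW.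
pose f (v : 'rV[R]_n) := \sum_i \sum_j v ord0 i * v ord0 j * T i j - 2 * \sum_i v ord0 i * b i.
have csum (s : seq 'I_n) (F : 'I_n -> 'rV[R]_n -> R) (x : 'rV[R]_n) :
    (forall i, {for x, continuous (F i)}) -> {for x, continuous (fun v => \sum_(i <- s) F i v)}.
  move=> cF; elim: s => [|i s IH].
    rewrite (_ : (fun _ => _) = fun=> 0); first exact: cst_continuous.
    by apply/funext => v; rewrite big_nil.
  rewrite (_ : (fun _ => _) = fun v => F i v + \sum_(j <- s) F j v).
    by apply: continuousD; [exact: cF|exact: IH].
  by apply/funext => v; rewrite big_cons.
have cc i (x : 'rV[R]_n) : {for x, continuous (fun v : 'rV[R]_n => v ord0 i)}.
  exact: coord_continuous.
have cf : {within A, continuous f}.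
  apply: continuous_subspaceT => x.
  have h : {for x, continuous f}.
    apply: continuousB.
      apply: (csum) => i; apply: (csum) => j; apply: continuousM; last exact: cst_continuous.
      by apply: continuousM; exact: cc.
    apply: continuousM; first exact: cst_continuous.
    by apply: (csum) => i; apply: continuousM; [exact: cc|exact: cst_continuous].
  exact: h.
have [c /set_mem Ac fc] := compact_EVT_min A0 cA cf.
pose a i := c ord0 i.
have Aa i : 0 <= a i <= lam by have := Ac i; rewrite /= in_itv.
pose g i := \sum_j T i j * a j - b i.
(* Expansion of the quadratic function along one coordinate; 2 [g i] is its partial derivative at
   the minimiser. *)
have E i t : f (c + t *: delta_mx ord0 i) - f c = 2 * t * g i + t ^+ 2 * T i i.
  have D1 k : (c + t *: delta_mx ord0 i) ord0 k = a k + t * (k == i)%:R.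
    by rewrite !mxE eqxx.
  have S1 (G : 'I_n -> R) : \sum_k (k == i)%:R * G k = G i.
    by rewrite (bigD1 i)//= eqxx mul1r big1 ?addr0// => j /negbTE ->; rewrite mul0r.
  have F1 : \sum_k \sum_j (c + t *: delta_mx ord0 i) ord0 k * (c + t *: delta_mx ord0 i) ord0 j * T k j
      = \sum_k \sum_j a k * a j * T k j + t * \sum_j T i j * a j
        + t * \sum_j T i j * a j + t ^+ 2 * T i i.
    transitivity (\sum_k (\sum_j a k * a j * T k j + (k == i)%:R * (t * \sum_j T k j * a j)
        + t * (T i k * a k) + (k == i)%:R * (t ^+ 2 * T k i))).
      apply: eq_bigr => k _.
      transitivity (\sum_j (a k * a j * T k j + (k == i)%:R * (t * (T k j * a j))
         + (j == i)%:R * (t * (T k j * a k)) + (j == i)%:R * ((k == i)%:R * (t ^+ 2 * T k j)))).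
        by apply: eq_bigr => j _; rewrite !D1; ring.
      by rewrite !big_split /= !S1 -!mulr_sumr (Ts k i).
    by rewrite !big_split /= !S1 -mulr_sumr.
  have F2 : \sum_k (c + t *: delta_mx ord0 i) ord0 k * b k = \sum_k a k * b k + t * b i.
    transitivity (\sum_k (a k * b k + (k == i)%:R * (t * b k))).
      by apply: eq_bigr => k _; rewrite D1; ring.
    by rewrite big_split /= S1.
  rewrite /f F1 F2 /g; set u := \sum_j T i j * a j.
  have -> : \sum_k \sum_j c ord0 k * c ord0 j * T k j = \sum_k \sum_j a k * a j * T k j by [].
  have -> : \sum_k c ord0 k * b k = \sum_k a k * b k by [].
  by ring.
have fmin i t : 0 <= a i + t <= lam -> 0 <= 2 * t * g i + t ^+ 2 * T i i.
  move=> ht; rewrite -E subr_ge0; apply: fc; apply/mem_set => k.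
  rewrite /= in_itv /= !mxE; have [->|ki] := eqVneq k i; first by rewrite eqxx mulr1.
  by rewrite andbF mulr0 addr0; exact: Aa.
(* The one-sided first-order condition: after division by [s] the quadratic term is negligible for
   small s > 0. *)
have lin (u w M : R) : 0 < M -> (forall s, 0 < s -> s <= M -> 0 <= 2 * s * u + s ^+ 2 * w) -> 0 <= u.
  move=> M0 H; rewrite leNgt; apply/negP => u0.
  pose s := Num.min M (- u / (`|w| + 1)).
  have w1 : 0 < `|w| + 1 by rewrite ltr_wpDl.
  have s0 : 0 < s by rewrite lt_min M0 divr_gt0// oppr_gt0.
  have sM : s <= M by rewrite ge_min lexx.
  have : s * (`|w| + 1) <= - u.
    by rewrite -ler_pdivlMr// ge_min lexx orbT.
  have := H s s0 sM; have := ler_norm w => h1 h2 h3.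
  have : 0 <= s * (2 * u + s * w) by rewrite (_ : s * _ = 2 * s * u + s ^+ 2 * w)//; ring.
  rewrite pmulr_rge0// => h4.
  have : s * w <= s * `|w| by rewrite ler_wpM2l// ltW.
  lra.
exists a; split => // i ai.
- rewrite -subr_ge0 (_ : _ - _ = - g i); last by rewrite /g; ring.
  apply: (lin _ (T i i) (a i)) => // s s0 sa.
  have := fmin i (- s); rewrite sqrrN (_ : 2 * - s * g i = 2 * s * - g i); last by ring.
  by apply; have /andP[? ?] := Aa i; apply/andP; split; lra.
- rewrite -subr_ge0 -/(g i).
  apply: (lin _ (T i i) (lam - a i)); first by rewrite subr_gt0.
  move=> s s0 sa; apply: fmin.
  by have /andP[? ?] := Aa i; apply/andP; split; lra.
Qed.

End quadratic_program.

Section cells.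
Context (R : realType) (N : nat).
Local Notation V := 'rV[R]_N.

(** Compactness yields finitely many balls of radius [del]; a point of [K] goes to the cell of the
    first ball that contains it. This makes the cells disjoint and measurable. *)
Lemma finite_cells (K : set V) (del : R) : compact K -> mesV K -> 0 < del ->
  exists n (z : 'I_n -> V) (C : 'I_n -> set V), [/\ forall j, K (z j),
    forall j, mesV (C j), forall j x, C j x -> K x /\ enorm (x - z j) < del &
    forall x, \sum_j \1_(C j) x = \1_K x :> R].
Proof.
move=> cK mK del0.
have : cover_compact K by rewrite -compact_cover.
move=> /(_ V K (fun y => eball y del) (fun y _ => @open_eball R N y del)).
have Kc : K `<=` cover K (fun y => eball y del).
  by move=> x Kx; exists x => //; rewrite /eball /= subrr enorm0.
move=> /(_ Kc)[D' D'K Kc'].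
pose s : seq V := finmap.enum_fset D'.
pose P (x y : V) := enorm (x - y) < del.
have sK y : y \in s -> K y.
  by move=> ys; apply/set_mem; apply: D'K.
have hasPx x : K x -> has (P x) s.
  by move=> /Kc'[y /= yD xy]; apply/hasP; exists y.
pose z (j : 'I_(size s)) := nth 0 s j.
pose C (j : 'I_(size s)) : set V := K `&` [set x | find (P x) s == j].
exists (size s), z, C; split.
- by move=> j; apply: sK; rewrite mem_nth.
- move=> j; apply: mesVI => //.
  have : forall (u : seq V) (k : nat), mesV [set x | find (P x) u == k].
    elim=> [|y u IH] k /=.
      case: eqP => _.
        rewrite (_ : [set _ | _] = setT) ?/mesV ?preimage_setT//.
        by apply/seteqP; split.
      rewrite (_ : [set _ | _] = set0) ?/mesV ?preimage_set0//.
      by apply/seteqP; split.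
    have mP : mesV [set x | P x y] := mesV_eball y del.
    case: k => [|k].
      rewrite (_ : [set _ | _] = [set x | P x y])//.
      by apply/seteqP; split => x /=; case: ifP.
    rewrite (_ : [set _ | _] = [set x | find (P x) u == k] `\` [set x | P x y]).
      exact: mesVD.
    apply/seteqP; split => x /=.
      by case: ifP => // /negP; rewrite eqSS.
    by move=> [fk /negP/negbTE ->]; rewrite eqSS.
  exact.
- move=> j x [Kx /= /eqP fj]; split => //.
  by have := nth_find 0 (hasPx x Kx); rewrite fj.
- move=> x; rewrite indicE; have [/set_mem Kx|nKx] := boolP (x \in K).
    have fs : (find (P x) s < size s)%N by rewrite -has_find hasPx.
    rewrite (bigD1 (Ordinal fs))//= indicE mem_set; last by split => //=.
    rewrite big1 ?addr0// => j jf; rewrite indicE memNset//= => -[_ /= /eqP fj].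
    by move/eqP: jf; apply; apply: val_inj.
  rewrite big1// => j _; rewrite indicE memNset// => -[Kx _].
  by move/negP: nKx; apply; exact: mem_set.
Qed.

End cells.

Lemma norm_approx (R : realFieldType) (p q r e : R) :
  p <= q <= p + e / 2 -> `|p - r| <= e / 2 -> `|q - r| <= e.
Proof.
by rewrite !ler_norml => /andP[? ?] /andP[? ?]; apply/andP; split; lra.
Qed.

Lemma sub_le_osc (R : realDomainType) (p q g k e : R) :
  `|p - q| + `|g - k| <= e -> k <= q -> g - p <= e.
Proof.
have := ler_norm (g - k); have := ler_norm (- (p - q)); rewrite normrN.
lra.
Qed.

(** * From the quadratic program to the discrete obstacle problem *)

Section obstacle.
Context (R : realType) (N : nat).
Hypothesis N2 : (2 <= N)%N.
Local Notation V := 'rV[R]_N.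
Local Notation gam := (@gam R N).
Local Notation en := (@en R N).
Local Notation en1 := (@en1 R N).
Local Notation kap := (@kap R N).
Implicit Types (x y z v : V) (r s t tau h lam eta : R) (f g : V -> R).

Lemma intV_dist f g (k : V -> R) : tame f -> tame g -> tame k ->
  (forall x, `|f x - g x| <= k x) -> `|intV f - intV g| <= intV k.
Proof.
move=> tf tg tk H; apply: ler_norm_sub; rewrite -intVB//; apply: le_intV => //;
  try exact: tameB.
- by move=> x; apply: le_trans (H x); exact: ler_norm.
- by move=> x; apply: le_trans (H x); rewrite distrC; exact: ler_norm.
Qed.

Variables (L D d : R).
Hypotheses (D0 : 0 < D) (DL : D < L).
Variable K : set V.
Hypotheses (mK : mesV K) (cK : compact K) (KD : forall x, K x -> enorm x <= D).
Hypotheses (d0 : 0 < d) (Kd : forall x, K x -> d <= enorm x).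
Local Notation gr := (@gr R N L).
Local Notation pot := (@pot R N L).
Local Notation Pt := (@Pt R N L).

Let L0 : 0 < L. Proof. exact: lt_trans DL. Qed.

Definition ptsum n (z : 'I_n -> V) (m : 'I_n -> R) tau x := \sum_j m j * gr tau x (z j).

(** The unsmoothed Green function of the ball of radius [L] with pole 0, that is, [gr 0 x 0]:
    Gamma_N(|x|) shifted so as to vanish on the outer sphere. *)
Definition Gcap x := gam (sq x) - gam (L ^+ 2).

Lemma ptsum_lip n (z : 'I_n -> V) (m : 'I_n -> R) tau (m1 C : R) x y :
  (forall tau x y z, enorm x <= L -> enorm y <= L ->
    enorm z <= D -> m1 <= ms tau z x -> m1 <= ms tau z y ->
    `|gr tau x z - gr tau y z| <= C * enorm (x - y)) ->
  enorm x <= L -> enorm y <= L -> (forall j, 0 <= m j) -> (forall j, enorm (z j) <= D) ->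
  (forall j, m1 <= ms tau (z j) x) -> (forall j, m1 <= ms tau (z j) y) ->
  `|ptsum z m tau x - ptsum z m tau y| <= (\sum_j m j) * (C * enorm (x - y)).
Proof.
move=> HC xL yL m0 zD mx my; rewrite /ptsum -sumrB mulr_suml.
apply: le_trans (ler_norm_sum _ _ _) _; apply: ler_sum => j _.
by rewrite -mulrBr normrM ger0_norm// ler_wpM2l// HC.
Qed.

Lemma Gcap_lip : exists2 C : R, 0 < C & forall x y, d <= enorm x -> d <= enorm y ->
  enorm x <= L -> enorm y <= L -> `|Gcap x - Gcap y| <= C * enorm (x - y).
Proof.
have d20 : 0 < d ^+ 2 by rewrite exprn_gt0.
exists (kap / 2 * en (d ^+ 2) * (2 * L)).
  by rewrite !mulr_gt0// ?invr_gt0 ?kap_gt0 ?en_gt0.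
move=> x y; rewrite !(enorm_ge _ (ltW d0)) => dx dy xL yL.
rewrite /Gcap (_ : _ - _ = gam (sq x) - gam (sq y)); last by ring.
apply: le_trans (gam_lip N2 d20 dy dx) _; rewrite -(mulrA _ (2 * L)) ler_wpM2l//.
  by rewrite !mulr_ge0// ?(ltW (en_gt0 _ _)) ?(ltW (kap_gt0 _ _)).
exact: sq_lip.
Qed.

Lemma dd_Gcap r : 0 < r -> exists2 C : R, 0 < C & forall x h, `|h| <= 1 -> `|h| <= r / 2 ->
  r <= enorm x <= L -> `|dd h Gcap x| <= C * `|h| ^+ 3.
Proof.
move=> r0; have r20 : 0 < (r / 2) ^+ 2 by rewrite exprn_gt0// divr_gt0.
have [C C0 HC] := dd_ms N2 r20 (ltW L0).
exists C => // x h h1 hr /andP[rx xL].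
have -> : dd h Gcap x = dd h (fun x => gam (ms 0 0 x)) x.
  have -> : Gcap = fun y => gam (ms 0 0 y) - gam (L ^+ 2).
    by apply/funext => y; rewrite /ms subr0 expr0n addr0.
  by rewrite ddB dd_cst subr0.
have S t i : `|t| <= r / 2 -> (r / 2) ^+ 2 <= ms 0 0 (x + t *: delta_mx ord0 i).
  move=> tr; rewrite /ms subr0 expr0n addr0 -enorm_ge ?divr_ge0 ?(ltW r0)//.
  have := enorm_subl x (- (t *: delta_mx ord0 i)).
  by rewrite opprK enormN enormZ enorm_delta mulr1; lra.
have S0 : (r / 2) ^+ 2 <= ms 0 0 x.
  rewrite /ms subr0 expr0n addr0 -enorm_ge ?divr_ge0 ?(ltW r0)//; lra.
have := HC 0 0 x h h1 _ S0 (fun i => S h i hr).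
rewrite subr0 => /(_ xL); rewrite expr0n /= mulr0 !mul0r addr0; apply.
by move=> i; rewrite -scaleNr; apply: S; rewrite normrN.
Qed.

(* The obstacle problem with obstacle [Gcap]: the quadratic program minimises the
   energy of charges [a j * vol (C j)] placed at the points [z j], [0 <= a j <= lam]. *)
Lemma cells_potential lam eta : 0 < lam -> 0 < eta ->
  exists2 t0 : R, 0 < t0 <= 1 & forall tau, 0 < tau -> tau <= t0 ->
  exists n (z : 'I_n -> V) (C : 'I_n -> set V) (a : 'I_n -> R),
  let rho x := \sum_j a j * \1_(C j) x in
  let m j := a j * vol (C j) in
  [/\ (forall j, K (z j)), (forall j, mesV (C j)),
      (forall x, \sum_j \1_(C j) x = \1_K x :> R),
      (forall j, 0 <= a j <= lam) & density K lam rho] /\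
  [/\ forall x, enorm x <= L -> `|pot rho x - ptsum z m tau x| <= eta,
      forall j x, C j x -> 0 < vol (C j) -> a j < lam -> Gcap x - ptsum z m tau x <= eta,
      forall j x, C j x -> 0 < a j -> ptsum z m tau x - Gcap x <= eta &
      exists2 k : R, 0 < k & forall x y, enorm x <= L -> enorm y <= L ->
        `|ptsum z m tau x - ptsum z m tau y| <= k * enorm (x - y)].
Proof.
move=> lam0 eta0; have eta20 : 0 < eta / 2 by rewrite divr_gt0.
have [t0 /andP[t00 t01] Hp] := pot_approx N2 D0 DL mK KD lam0 eta20.
exists t0; first by rewrite t00.
move=> tau tau0 taut0; have tau20 : 0 < tau ^+ 2 by rewrite exprn_gt0.
have [C1 C10 HC1] := gr_lip N2 D0 DL tau20.
have [C2 C20 HC2] := gr_lipr N2 D0 DL tau20.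
have [C3 C30 HC3] := Gcap_lip.
have vK : 0 <= lam * vol K by rewrite mulr_ge0 ?vol_ge0// ltW.
pose k := lam * vol K * (C1 + C2) + C3 + 1.
have k0 : 0 < k.
  by rewrite ltr_wpDl// addr_ge0 ?(ltW C30)// mulr_ge0// addr_ge0// ltW.
(* The mesh size at which the variations over one cell of the potential, of the kernel and of the
   obstacle add up to at most eta / 2. *)
pose del := eta / (2 * k).
have del0 : 0 < del by rewrite divr_gt0// mulr_gt0.
have kdel : (lam * vol K * C1) * del + (lam * vol K * C2) * del + C3 * del <= eta / 2.
  apply: (@le_trans _ _ (k * del)); last first.
    by rewrite /del (_ : k * _ = eta / 2)//; field; rewrite gt_eqF.
  rewrite -!mulrDl ler_wpM2r ?(ltW del0)// /k mulrDr; lra.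
have b1 : 0 <= lam * vol K * C1 * del by rewrite mulr_ge0 ?(ltW del0)// mulr_ge0// ltW.
have b2 : 0 <= lam * vol K * C2 * del by rewrite mulr_ge0 ?(ltW del0)// mulr_ge0// ltW.
have b3 : 0 <= C3 * del by rewrite mulr_ge0// ltW.
have [n [z [C [Kz mC Cz CK]]]] := finite_cells cK mK del0.
(* The energy matrix. The smoothing [tau] keeps the interaction of a cell with itself finite. *)
pose T i j := vol (C i) * vol (C j) * gr tau (z i) (z j).
have Ts i j : T i j = T j i by rewrite /T (mulrC (vol (C i))) grC.
have [a0 [a0b a0p a0l]] := box_quadratic_program (fun i => vol (C i) * Gcap (z i)) lam0 Ts.
(* On null cells the optimality conditions, which carry the factor [vol (C j)], say nothing; the
   density is set to 0 there. *)
pose a j := if vol (C j) == 0 then 0 else a0 j.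
have ab j : 0 <= a j <= lam by rewrite /a; case: ifP; rewrite ?lexx ?(ltW lam0).
exists n, z, C, a => rho m.
have ma j : m j = a0 j * vol (C j).
  by rewrite /m /a; case: eqP => [->|//]; rewrite !mulr0.
have m0 j : 0 <= m j by rewrite mulr_ge0 ?vol_ge0//; have /andP[] := ab j.
have bC j : bounded_sq (C j).
  by exists (D ^+ 2) => x /Cz[/KD h _]; rewrite -enorm_le// ltW.
have tC j : tame (\1_(C j) : V -> R) by exact: tame_indic.
have dr : density K lam rho.
  split; first by apply: mrow_sum => j; apply: mrowZ; exact: mrow_indic.
  move=> x; apply/andP; split.
    by apply: sumr_ge0 => j _; rewrite mulr_ge0 ?indicE ?ler0n//; have /andP[] := ab j.
  rewrite -CK mulr_sumr; apply: ler_sum => j _.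
  by rewrite ler_wpM2r ?indicE ?ler0n//; have /andP[] := ab j.
have tr := tame_density D0 KD dr.
have rhom : intV rho = \sum_j m j.
  rewrite /rho intV_sum; last by move=> j; exact: tameZ.
  by apply: eq_bigr => j _; rewrite intVZ// intV_indic.
have mK' : \sum_j m j <= lam * vol K.
  rewrite -rhom -(intV_indic mK) -intVZ; last exact: (tameK D0).
  apply: le_intV => //; first by apply: tameZ; exact: (tameK D0).
  by move=> x; have /andP[] := dr.2 x.
have zD j : enorm (z j) <= D := KD (Kz j).
have ms1 w x : tau ^+ 2 <= ms tau w x by exact: ms_ge.
have Plip x y : enorm x <= L -> enorm y <= L ->
    `|ptsum z m tau x - ptsum z m tau y| <= lam * vol K * C1 * enorm (x - y).
  move=> xL yL; apply: le_trans (ptsum_lip HC1 xL yL m0 zD _ _) _ => //.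
  by rewrite -mulrA ler_wpM2r// mulr_ge0 ?enorm_ge0// ltW.
have KL x : K x -> enorm x <= L by move=> /KD h; apply: le_trans h _; exact: ltW.
(* Optimality holds at the points [z j]; this oscillation bound spreads it over the cells. *)
have osc j x : C j x -> `|ptsum z m tau x - ptsum z m tau (z j)| + `|Gcap x - Gcap (z j)| <= eta.
  move=> Cx; have [Kx xz] := Cz j x Cx.
  have h1 := Plip x (z j) (KL _ Kx) (KL _ (Kz j)).
  have h2 := HC3 x (z j) (Kd Kx) (Kd (Kz j)) (KL _ Kx) (KL _ (Kz j)).
  have h3 : lam * vol K * C1 * enorm (x - z j) <= lam * vol K * C1 * del.
    by rewrite ler_wpM2l ?(ltW xz)// mulr_ge0// ltW.
  have h4 : C3 * enorm (x - z j) <= C3 * del by rewrite ler_wpM2l// ltW.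
  move: h1 h2 h3 h4 kdel b1 b2 b3 eta0.
  move: (`|_ - _|) (`|_ - _|) (_ * enorm _) (_ * enorm _) (_ * del) (_ * del) (_ * del).
  by clear; move=> *; lra.
have Tm i : \sum_j T i j * a0 j = vol (C i) * ptsum z m tau (z i).
  by rewrite mulr_sumr; apply: eq_bigr => j _; rewrite ma /T; ring.
split; first by split.
split.
- move=> x xL; have := Hp rho tau x dr tau0 taut0 xL.
  have tg := tame_density_gr N2 D0 DL KD dr tau0 xL.
  (* The point charges amount to integrating [rho] against the kernel with its second argument
     frozen at [z j] on each cell. *)
  have E : ptsum z m tau x = intV (fun w => \sum_j a j * gr tau x (z j) * \1_(C j) w).
    rewrite intV_sum; last by move=> j; exact: tameZ.
    by apply: eq_bigr => j _; rewrite intVZ// intV_indic// /m mulrAC.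
  have tE : tame (fun w => \sum_j a j * gr tau x (z j) * \1_(C j) w).
    by apply: tame_sum => j; exact: tameZ.
  have : `|Pt rho tau x - ptsum z m tau x| <= eta / 2.
    rewrite E; apply: (@le_trans _ _ (intV (fun w => (C2 * del) * rho w))).
      apply: intV_dist => //; first exact: tameZ.
      move=> w; rewrite /rho mulr_suml -sumrB mulr_sumr.
      apply: le_trans (ler_norm_sum _ _ _) _; apply: ler_sum => j _.
      rewrite (_ : _ - _ = a j * \1_(C j) w * (gr tau x w - gr tau x (z j))); last by ring.
      have /andP[aj0 _] := ab j.
      have [/set_mem Cw|nCw] := boolP (w \in C j); last first.
        by rewrite indicE (negbTE nCw) mulr0 mul0r normr0 mulr0.
      rewrite indicE mem_set// !mulr1 normrM ger0_norm// mulrC ler_wpM2r//.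
      have [Kw wz] := Cz j w Cw.
      apply: (le_trans (HC2 tau x w (z j) xL (KD Kw) (zD j) (ms1 _ _) (ms1 _ _))).
      by rewrite ler_wpM2l// ltW.
    rewrite intVZ// rhom.
    have : C2 * del * \sum_j m j <= C2 * del * (lam * vol K).
      by rewrite ler_wpM2l// mulr_ge0// ltW.
    rewrite (_ : C2 * del * (lam * vol K) = lam * vol K * C2 * del); last by ring.
    move: kdel b1 b2 b3 eta0.
    move: (_ * \sum_j m j) (_ * del) (_ * del) (_ * del).
    by move=> *; lra.
  by move=> h1 h2; exact: norm_approx h2 h1.
- move=> j x Cx vj aj; apply: sub_le_osc (osc j x Cx) _.
  rewrite -(ler_pM2l vj) -Tm a0l//.
  by move: aj; rewrite /a gt_eqF.
- move=> j x Cx; rewrite {1}/a; case: eqP => [_|/eqP vn]; first by rewrite ltxx.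
  move=> aj; have := osc j x Cx; rewrite addrC => h; apply: sub_le_osc h _.
  have vj : 0 < vol (C j) by rewrite lt_neqAle eq_sym vn vol_ge0.
  by rewrite -(ler_pM2l vj) -Tm a0p.
- exists (lam * vol K * C1 + 1); first by rewrite ltr_wpDl// mulr_ge0// ltW.
  move=> x y xL yL; apply: le_trans (Plip x y xL yL) _.
  by rewrite ler_wpM2r ?enorm_ge0// lerDl.
Qed.
End obstacle.

(** * Comparison of the potential with the obstacle *)

Section obstacle_bounds.
Context (R : realType) (N : nat).
Hypothesis N2 : (2 <= N)%N.
Local Notation V := 'rV[R]_N.
Local Notation gam := (@gam R N).
Local Notation en := (@en R N).
Local Notation kap := (@kap R N).
Implicit Types (x y z v : V) (r s t tau h lam eta : R) (f g : V -> R).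

Variables (L D : R).
Hypotheses (D0 : 0 < D) (DL : D < L).
Variable K : set V.
Hypotheses (mK : mesV K) (KD : forall x, K x -> enorm x <= D).
Local Notation gr := (@gr R N L).
Local Notation pot := (@pot R N L).
Local Notation Gcap := (@Gcap R N L).

Let L0 : 0 < L. Proof. exact: lt_trans DL. Qed.
Let N0 : (0 < N)%N. Proof. exact: leq_trans N2. Qed.
Let i0 : 'I_N := Ordinal N0.

Lemma Gcap_ge0 x : 0 < enorm x -> enorm x <= L -> 0 <= Gcap x.
Proof.
move=> x0; rewrite (enorm_le _ (ltW L0)) => xL; rewrite subr_ge0; apply: gam_le => //.
by rewrite -enormE exprn_gt0.
Qed.

Lemma continuous_Gcap x : 0 < enorm x -> enorm x < L -> {for x, continuous Gcap}.
Proof.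
move=> x0 xL; pose r := enorm x / 2; have r0 : 0 < r by rewrite divr_gt0.
have [C C0 HC] := Gcap_lip N2 D0 DL r0.
apply/continuous_enormP => e e0.
exists (Num.min (Num.min r (L - enorm x)) (e / C)).
  by rewrite !lt_min r0 subr_gt0 xL divr_gt0.
move=> y; rewrite !lt_min => /andP[/andP[yr yL] ye].
rewrite ltr_pdivlMr// mulrC in ye; apply: le_lt_trans ye; apply: HC.
- have := enorm_subl x y; rewrite (enormBC x) /r in yr *; lra.
- by rewrite /r; lra.
- have := enorm_subl y x; lra.
- exact: ltW.
Qed.

(** Maximum principle on an annulus: near 0 the obstacle is huge, near the sphere the potential is
    small. Where the bound fails in between, [pot rho] - [Gcap] exceeds 2 eta nearby, so [P] -
    [Gcap] exceeds eta there and there is no charge. Hence 3 eta: one for the condition on the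
    charges, one for replacing [pot] by [P], one for the oscillation. *)
Lemma pot_le_Gcap lam eta k rho (P : V -> R) : 0 < lam -> 0 < eta -> 0 < k ->
  density K lam rho ->
  (forall x, enorm x <= L -> `|pot rho x - P x| <= eta) ->
  (forall x y, enorm x <= L -> enorm y <= L -> `|P x - P y| <= k * enorm (x - y)) ->
  (forall x, enorm x = L -> P x <= 0) ->
  (forall x, rho x != 0 -> P x - Gcap x <= eta) ->
  forall x, 0 < enorm x -> enorm x <= L -> pot rho x <= Gcap x + 3 * eta.
Proof.
move=> lam0 eta0 k0 dr pP Plip PL act.
have pleP x : enorm x <= L -> pot rho x <= P x + eta.
  by move=> /pP; rewrite ler_norml => /andP[_]; rewrite lerBlDl addrC.
(* In a shell of width eta / k the Lipschitz bound keeps [P] below eta, since [P] <= 0 on the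
   sphere; there [pot rho] is at most 2 eta. *)
pose s := Num.min (L - D) (eta / k).
have s0 : 0 < s by rewrite lt_min subr_gt0 DL divr_gt0.
have near_sphere x : L - s <= enorm x -> enorm x <= L -> pot rho x <= 2 * eta.
  move=> xs xL; have x0 : 0 < enorm x.
    by apply: lt_le_trans xs; rewrite subr_gt0 (@le_lt_trans _ _ (L - D)) ?ge_min ?lexx// ltrBlDl ltrDr.
  pose y := (L / enorm x) *: x.
  have yL : enorm y = L by rewrite /y enormZ ger0_norm ?divr_ge0 ?(ltW L0) ?(ltW x0)// divfK// gt_eqF.
  have xy : enorm (x - y) = L - enorm x.
    rewrite /y -{1}(scale1r x) -scalerBl enormZ.
    rewrite (_ : 1 - _ = - ((L - enorm x) / enorm x)); last by field; rewrite gt_eqF.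
    by rewrite normrN ger0_norm ?divr_ge0 ?subr_ge0 ?(ltW x0)// divfK// gt_eqF.
  have : k * enorm (x - y) <= eta.
    rewrite xy mulrC -ler_pdivlMr//; apply: (@le_trans _ _ s); first by lra.
    by rewrite ge_min lexx orbT.
  have := Plip x y xL; rewrite yL lexx => /(_ isT); have := PL y yL; have := pleP x xL.
  have := ler_norm (P x - P y).
  by move: (pot rho x) (P x) (P y) (`|_|) (k * _) => *; lra.
have Pbd x : enorm x <= L -> P x <= k * (2 * L).
  move=> xL; pose y : V := L *: delta_mx ord0 i0.
  have yL : enorm y = L by rewrite enormZ enorm_delta mulr1 gtr0_norm.
  have : k * enorm (x - y) <= k * (2 * L).
    by rewrite ler_wpM2l ?(ltW k0)// (le_trans (enormB _ _))// yL; lra.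
  have := Plip x y xL; rewrite yL lexx => /(_ isT); have := PL y yL.
  have := ler_norm (P x - P y).
  by move: (P x) (P y) (`|_|) (k * _) (k * _) => *; lra.
(* Below this radius the obstacle exceeds the global upper bound k (2 L) + eta of the potential. *)
have [m0 m00 Hm] := gam_unbounded N2 (gam (L ^+ 2) + k * (2 * L) + eta).
pose r := Num.min 1 m0.
have r0 : 0 < r by rewrite lt_min ltr01.
have near0 x : 0 < enorm x -> enorm x <= r -> enorm x <= L -> pot rho x <= Gcap x.
  move=> x0 xr xL; apply: (le_trans (pleP x xL)); apply: (@le_trans _ _ (k * (2 * L) + eta)).
    by rewrite lerD2r Pbd.
  rewrite /Gcap lerBrDl addrA Hm//; first by rewrite -enormE exprn_gt0.
  have r1 : r <= 1 by rewrite ge_min lexx.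
  have rm : r <= m0 by rewrite ge_min lexx orbT.
  rewrite -enormE; apply: le_trans rm; rewrite expr2 -[leRHS]mul1r.
  by apply: ler_pM; rewrite ?enorm_ge0// (le_trans xr).
move=> x x0 xL.
have [xr|rx] := leP (enorm x) r.
  by rewrite (le_trans (near0 x x0 xr xL))// lerDl mulr_ge0// ltW.
have [xs|sx] := leP (L - s) (enorm x).
  apply: le_trans (near_sphere x xs xL) _.
  have := Gcap_ge0 x0 xL; lra.
pose A : set V := [set y | r <= enorm y <= L - s].
pose w y := pot rho y - Gcap y.
suff : w x <= 3 * eta by rewrite lerBlDl.
have AE y : A y -> 0 < enorm y /\ enorm y < L.
  move=> /andP[h1 h2]; split; first exact: lt_le_trans h1.
  by apply: le_lt_trans h2 _; rewrite ltrBlDl ltrDr.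
have cw y : A y -> {for y, continuous w}.
  move=> /AE[y0 yL]; apply: continuousB; last exact: continuous_Gcap.
  exact: (pot_continuous N2 D0 DL mK KD lam0 dr).
apply: (@dd_max_principle _ _ N0 A) => //; last first.
- by rewrite /A /= (ltW rx) ltW.
- move=> y Ay wy e e0; have [y0 yL] := AE y Ay; have /andP[ry ys] := Ay.
  have ry' : r < enorm y.
    rewrite lt_neqAle ry andbT; apply: contraTneq wy => yr.
    rewrite -leNgt (@le_trans _ _ 0) ?mulr_ge0 ?(ltW eta0)// subr_le0.
    by rewrite near0 ?(ltW yL)// yr.
  have ys' : enorm y < L - s.
    rewrite lt_neqAle ys andbT; apply: contraTneq wy => yr.
    rewrite -leNgt; have h1 := @Gcap_ge0 y y0 (ltW yL).
    have h2 : pot rho y <= 2 * eta by apply: near_sphere; rewrite ?yr// -yr ltW.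
    by rewrite /w; lra.
  have [d1 d10 Hd1] := (continuous_enormP _ _).1 (cw y Ay) eta eta0.
  pose d2 := Num.min d1 (L - enorm y).
  have d20 : 0 < d2 by rewrite lt_min d10 subr_gt0.
  have rho0 v : enorm (v - y) < d2 -> rho v = 0.
    rewrite lt_min => /andP[v1 v2]; apply: contraTeq isT => /act Pv.
    have vL : enorm v <= L.
      by rewrite ltW// -(ltrD2r (- enorm y)) (le_lt_trans (enorm_subl v y)).
    have := pleP v vL; have := Hd1 v v1; rewrite ltr_norml => /andP[+ _].
    by rewrite /w in wy *; move: (P v) (pot rho v) (Gcap v) Pv wy; clear; move=> *; lra.
  have yd2 : enorm y + d2 <= L.
    by rewrite -lerBrDl ge_min lexx orbT.
  have e20 : 0 < e / 2 by rewrite divr_gt0.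
  have [d3 d30 Hd3] := pot_dd N2 D0 DL mK KD lam0 dr d20 yd2 rho0 e20.
  have [C C0 HC] := dd_Gcap N2 D0 DL r0.
  pose h := Num.min (Num.min (Num.min 1 (r / 2)) (Num.min d3 (e / (2 * C)))) (Num.min (enorm y - r) (L - s - enorm y)) / 2.
  have h0 : 0 < h.
    by rewrite divr_gt0// !lt_min ltr01 d30 !subr_gt0 ry' ys' !divr_gt0// mulr_gt0.
  have : h < Num.min (Num.min (Num.min 1 (r / 2)) (Num.min d3 (e / (2 * C)))) (Num.min (enorm y - r) (L - s - enorm y)).
    by rewrite /h in h0 *; lra.
  rewrite !lt_min => /andP[/andP[/andP[h1 hr] /andP[hd3 he]] /andP[hy1 hy2]].
  have hn : `|h| = h by rewrite gtr0_norm.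
  have inA i t : `|t| = h -> A (y + t *: delta_mx ord0 i).
    move=> th; rewrite /A /=; have := enormD y (t *: delta_mx ord0 i).
    have := enorm_subl y (- (t *: delta_mx ord0 i)).
    rewrite opprK enormN enormZ enorm_delta mulr1 th => b1 b2; apply/andP; split.
      by apply: le_trans b1; rewrite lerBrDr -lerBrDl ltW.
    by apply: le_trans b2 _; rewrite -lerBrDl ltW.
  exists h; split => //.
  - by move=> i; apply: inA.
  - by move=> i; rewrite -scaleNr; apply: inA; rewrite normrN.
  have := Hd3 h h0 hd3; have := HC y h; rewrite hn ry (ltW yL) => /(_ (ltW h1) (ltW hr) isT).
  rewrite ler_norml => /andP[_ b1] b2.
  rewrite /w ddB; apply: (@lt_le_trans _ _ (- (e / 2 * h ^+ 2) - C * h ^+ 3)); last by rewrite lerB.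
  rewrite ltr_pdivlMr ?mulr_gt0// in he.
  rewrite -subr_gt0 (_ : _ - _ = (e - h * (2 * C)) / 2 * h ^+ 2); last by field.
  by rewrite mulr_gt0 ?exprn_gt0// divr_gt0// subr_gt0.
- apply: continuous_in_subspaceT => y /set_mem Ay; exact: cw.
- have -> : A = eclosed_ball 0 (L - s) `&` ~` eball 0 r.
    apply/seteqP; split => y; rewrite /A /eclosed_ball /eball /= subr0.
      by move=> /andP[h1 ->]; split=> //; apply/negP; rewrite -leNgt.
    by move=> [-> /negP]; rewrite -leNgt => ->.
  apply: (@compact_enorm _ _ _ (L - s)).
    apply: closedI; first exact: closed_eclosed_ball.
    by apply: open_closedC; exact: open_eball.
  by move=> y [+ _]; rewrite /eclosed_ball /= subr0.
Qed.

(* Testing the obstacle inequality at one point of the sphere of radius [d / 2]. *)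
Lemma ptsum_mass d : 0 < d -> d < D -> exists2 C : R, 0 < C & exists2 t0, 0 < t0 &
  forall n (z : 'I_n -> V) (m : 'I_n -> R) tau, 0 < tau -> tau <= t0 ->
  (forall j, enorm (z j) <= D) -> (forall j, 0 <= m j) ->
  (forall x, 0 < enorm x -> enorm x <= L -> ptsum L z m tau x <= Gcap x + 4) ->
  \sum_j m j <= C.
Proof.
move=> d0 dD; pose x : V := (d / 2) *: delta_mx ord0 i0.
have d20 : 0 < d / 2 by rewrite divr_gt0.
have xd : enorm x = d / 2 by rewrite enormZ enorm_delta mulr1 gtr0_norm.
have x0 : 0 < enorm x by rewrite xd.
have xL : enorm x < L by rewrite xd; have := D0; have := DL; lra.
pose g := (L ^+ 2 - sq x) * (L ^+ 2 - D ^+ 2) / L ^+ 2.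
have xL2 : 0 < L ^+ 2 - sq x by rewrite subr_gt0 -enorm_lt// ltW.
have DL2 : 0 < L ^+ 2 - D ^+ 2 by rewrite subr_gt0 ltrXn2r ?nnegrE// ltW.
have g0 : 0 < g by rewrite !mulr_gt0// invr_gt0 exprn_gt0.
(* A lower bound for the smoothed kernel between [x] and any point of the ball of radius [D]; half
   of [g] is sacrificed to tau^2. *)
pose q := kap / 2 * en (4 * L ^+ 2) * (g / 2).
have q0 : 0 < q.
  apply: mulr_gt0; last by rewrite divr_gt0.
  by apply: mulr_gt0; [rewrite divr_gt0 ?kap_gt0|exact: en_gt0].
have W0 := Gcap_ge0 x0 (ltW xL).
exists ((Gcap x + 4) / q); first by rewrite divr_gt0// ltr_wpDl.
exists (Num.min 1 (g / 2)); first by rewrite lt_min ltr01 divr_gt0.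
move=> n z m tau tau0; rewrite le_min => /andP[t1 tg] zD m0 /(_ x x0 (ltW xL)) hx.
rewrite ler_pdivlMr//; apply: le_trans hx; rewrite /ptsum mulr_suml.
have t2 : tau ^+ 2 <= g / 2 by rewrite (le_trans _ tg)// expr2 ler_piMr// ltW.
apply: ler_sum => j _; apply: ler_wpM2l => //.
have gz : g <= (L ^+ 2 - sq x) * (L ^+ 2 - sq (z j)) / L ^+ 2.
  rewrite ler_wpM2r ?invr_ge0 ?exprn_ge0 ?(ltW L0)// ler_wpM2l ?(ltW xL2)//.
  by rewrite lerD2l lerN2 -enorm_le// ltW.
apply: le_trans (gr_ge N2 D0 DL (ltW xL) (zD j) tau0 _); last by move: t2 gz g0; lra.
rewrite /q ler_wpM2l//; last by move: t2 gz g0; lra.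
by rewrite !mulr_ge0// ?invr_ge0 ?(ltW (en_gt0 _ _)) ?(ltW (kap_gt0 _ _)).
Qed.

End obstacle_bounds.

(** * Energy inequalities *)

Section energy.
Context (R : realType) (N : nat).
Hypothesis N2 : (2 <= N)%N.
Local Notation V := 'rV[R]_N.
Local Notation gam := (@gam R N).
Local Notation en := (@en R N).
Local Notation en1 := (@en1 R N).
Local Notation kap := (@kap R N).
Implicit Types (x y z v : V) (r s t h : R) (f g phi : V -> R).

(** Summation by parts: in the term with the backward difference the variable is translated by one
    step. *)
Lemma dd_parts h phi f : tame phi -> tame f ->
  intV (fun x => phi x * dd h f x) = - \sum_(i < N) intV (fun x =>
    (phi (x + h *: delta_mx ord0 i) - phi x) * (f (x + h *: delta_mx ord0 i) - f x)).
Proof.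
move=> tp tf.
have tfs v : tame (fun x => f (x + v) - f x) by apply: tameB => //; exact: tame_shift.
have t1 v : tame (fun x => phi x * (f (x + v) - f x)) by exact: tameMt.
have t2 v : tame (fun x => phi (x + v) * (f x - f (x + v))).
  apply: tameMt; first exact: tame_shift.
  by apply: tameB => //; exact: tame_shift.
rewrite (@eq_intV _ _ _ (fun x => \sum_i (phi x * (f (x + h *: delta_mx ord0 i) - f x) +
    phi x * (f (x - h *: delta_mx ord0 i) - f x)))); last first.
  by move=> x; rewrite /dd mulr_sumr; apply: eq_bigr => i _; ring.
rewrite intV_sum; last by move=> i; apply: tameD; exact: t1.
rewrite -sumrN; apply: eq_bigr => i _.
set v := h *: delta_mx ord0 i.
rewrite intVD// -(intV_shift v (t1 (- v))).
rewrite [X in _ + X](@eq_intV _ _ _ (fun x => phi (x + v) * (f x - f (x + v)))); last first.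
  by move=> x; rewrite addrK.
rewrite -intVD// -mulN1r -intVZ; last first.
  by apply: tameMt => //; apply: tameB => //; exact: tame_shift.
by apply: eq_intV => x; ring.
Qed.

(** A chain rule for the positive part at the level of differences; [t] takes the place of the
    indicator of the set where the function is positive. *)
Lemma max0_diff (a b : R) : exists2 t, 0 <= t <= 1 & Num.max b 0 - Num.max a 0 = t * (b - a).
Proof.
wlog ab : a b / a <= b => [H|].
  have [/H//|/ltW/H[t t01 E]] := leP a b.
  by exists t => //; rewrite -opprB E -mulrN opprB.
have [b0|b0] := leP b 0.
  by exists 0; rewrite ?lexx ?ler01// (max_idPr (le_trans ab b0)) subrr mul0r.
have [a0|a0] := leP 0 a; first by exists 1; rewrite ?lexx ?ler01// mul1r.
have ba : 0 < b - a by rewrite subr_gt0 (lt_trans a0).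
exists (b / (b - a)); last by rewrite divfK ?gt_eqF// subr0.
rewrite divr_ge0 ?(ltW b0) ?(ltW ba)//= ler_pdivrMr// mul1r; lra.
Qed.

(** Division by h^2 and passage to the limit: this removes the finite differences from both energy
    inequalities. *)
Lemma le_of_small (X Y C h0 : R) : 0 < h0 ->
  (forall h, 0 < h -> h < h0 -> X * h ^+ 2 <= Y * h ^+ 2 + C * h ^+ 3) -> X <= Y.
Proof.
move=> h00 H; apply/ler_addgt0Pr => e e0.
have C1 : 0 < `|C| + 1 by rewrite ltr_wpDl.
pose h := Num.min h0 (e / (`|C| + 1)) / 2.
have m0 : 0 < Num.min h0 (e / (`|C| + 1)) by rewrite lt_min h00 divr_gt0.
have hh : 0 < h by rewrite divr_gt0.
have : h < Num.min h0 (e / (`|C| + 1)) by rewrite /h; move: (Num.min _ _) m0 => *; lra.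
rewrite lt_min ltr_pdivlMr// => /andP[hh0 he].
have h20 : 0 < h ^+ 2 by rewrite exprn_gt0.
rewrite -(ler_pM2r h20); apply: le_trans (H h hh hh0) _.
rewrite mulrDl lerD2l exprS mulrA ler_wpM2r ?(ltW h20)//.
have := ler_norm C => hC.
have : C * h <= `|C| * h by rewrite ler_wpM2r// ltW.
by move: (C * h) (`|C|) he => *; lra.
Qed.

Lemma tame_ball (r M : R) f : mrow f -> (forall x, enorm x < r -> `|f x| <= M) ->
  tame (fun x => \1_(eball 0 r) x * f x).
Proof.
move=> mf fM; apply: tameM => //; first exact: tame_eball.
exists M => x; rewrite indicE; have [/set_mem xr _|] := boolP (x \in _).
  by apply: fM; move: xr; rewrite /eball /= subr0.
by rewrite eqxx.
Qed.

Lemma in_ball r x : (x \in eball (0 : V) r) = (enorm x < r).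
Proof.
apply/idP/idP => [/set_mem|xr]; first by rewrite /eball /= subr0.
by apply/mem_set; rewrite /eball /= subr0.
Qed.

Lemma dd_ball r h f x : enorm x + `|h| < r ->
  dd h (fun x => \1_(eball 0 r) x * f x) x = dd h f x.
Proof.
move=> xh; have S t i : `|t| = `|h| -> \1_(eball 0 r) (x + t *: delta_mx ord0 i) = 1 :> R.
  move=> th; rewrite indicE in_ball (le_lt_trans (enormD _ _))//.
  by rewrite enormZ enorm_delta mulr1 th.
have x1 : \1_(eball 0 r) x = 1 :> R.
  by rewrite indicE in_ball (le_lt_trans _ xh)// lerDl.
rewrite /dd; apply: eq_bigr => i _; rewrite -scaleNr !S ?normrN// x1.
by rewrite !mul1r.
Qed.

Lemma ball_bound (r : R) f (C : R) : 0 <= C -> 0 <= r ->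
  (forall x y, enorm x <= r -> enorm y <= r -> `|f x - f y| <= C * enorm (x - y)) ->
  forall x, enorm x < r -> `|f x| <= `|f 0| + C * r.
Proof.
move=> C0 r0 H x xr; have := H x 0 (ltW xr); rewrite enorm0 subr0 => /(_ r0) h.
have := ler_normD (f x - f 0) (f 0); rewrite subrK => h'.
have : C * enorm x <= C * r by rewrite ler_wpM2l// ltW.
by move: (`|f x|) (`|f 0|) (`|_|) (C * _) (C * _) h h' => *; lra.
Qed.

Variable tau : R.
Hypothesis tau0 : 0 < tau.

(* [src = - Laplacian Fnd] and [edens = |grad Fnd|^2]. *)
Definition Fnd x := gam (ms tau 0 x).
Definition src x := kap * N%:R * tau ^+ 2 * en1 (ms tau 0 x).
Definition edens x := kap ^+ 2 * sq x * en (ms tau 0 x) ^+ 2.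

Let tau20 : 0 < tau ^+ 2. Proof. by rewrite exprn_gt0. Qed.
Let msg x : tau ^+ 2 <= ms tau 0 x. Proof. exact: ms_ge. Qed.

Lemma mrow_en1_ms : mrow (fun x => en1 (ms tau 0 x)).
Proof. by apply: mrow_comp; [exact: measurable_pw|exact: mrow_ms]. Qed.

Lemma mrow_en_ms : mrow (fun x => en (ms tau 0 x)).
Proof. by apply: mrow_comp; [exact: measurable_pw|exact: mrow_ms]. Qed.

Lemma mrow_src : mrow src.
Proof. by apply: mrowZ; exact: mrow_en1_ms. Qed.

Lemma mrow_edens : mrow edens.
Proof.
apply: mrowM; last by apply: mrowX; exact: mrow_en_ms.
by apply: mrowZ; exact: mrow_sq.
Qed.

Lemma src_bound x : 0 <= src x <= kap * N%:R * tau ^+ 2 * en1 (tau ^+ 2).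
Proof.
have k0 : 0 <= kap * N%:R * tau ^+ 2 by rewrite !mulr_ge0// ?(ltW tau20)// ltW// kap_gt0.
by rewrite /src mulr_ge0 ?(ltW (en1_gt0 _ _))//= ler_wpM2l// en1_le.
Qed.

Lemma edens_bound r x : 0 <= r -> enorm x <= r ->
  0 <= edens x <= kap ^+ 2 * r ^+ 2 * en (tau ^+ 2) ^+ 2.
Proof.
move=> r0; rewrite enorm_le// => xr.
have e0 := ltW (en_gt0 N (ms tau 0 x)).
have k0 : 0 <= kap ^+ 2 * sq x by rewrite mulr_ge0 ?sqr_ge0 ?sq_ge0.
apply/andP; split; first by rewrite /edens mulr_ge0// sqr_ge0.
apply: ler_pM => //; first exact: sqr_ge0.
  by rewrite ler_wpM2l// sqr_ge0.
by rewrite lerXn2r ?nnegrE ?(ltW (en_gt0 _ _))// en_le.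
Qed.

Lemma dd_Fnd (B : R) : 0 <= B -> exists2 C : R, 0 < C & forall x h, 0 < h -> h <= 1 ->
  enorm x <= B -> `|dd h Fnd x + src x * h ^+ 2| <= C * h ^+ 3.
Proof.
move=> B0; have [C C0 HC] := dd_ms N2 tau20 B0.
exists C => // x h h0 h1 xB; have := HC tau 0 x h.
by rewrite subr0 gtr0_norm//; apply => // i.
Qed.

Lemma Fnd_lip (B : R) : 0 <= B -> exists2 C : R, 0 < C & forall x y,
  enorm x <= B -> enorm y <= B -> `|Fnd x - Fnd y| <= C * enorm (x - y).
Proof.
move=> B0; have c0 : 0 < kap / 2 * en (tau ^+ 2).
  by apply: mulr_gt0; [rewrite divr_gt0 ?kap_gt0|exact: en_gt0].
exists (kap / 2 * en (tau ^+ 2) * (2 * B + 1)).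
  by rewrite mulr_gt0// ltr_wpDl// mulr_ge0.
move=> x y xB yB; apply: le_trans (gam_lip N2 tau20 (msg y) (msg x)) _.
rewrite -(mulrA _ (2 * B + 1)) ler_wpM2l ?(ltW c0)//.
rewrite /ms !subr0 (_ : _ - _ = sq x - sq y); last by ring.
by apply: le_trans (sq_lip xB yB) _; rewrite ler_wpM2r ?enorm_ge0// lerDl.
Qed.

Lemma sqr_diff_Fnd (B : R) : 0 <= B -> exists2 C : R, 0 < C & forall x h, 0 < h -> h <= 1 ->
  enorm x <= B ->
  `|\sum_i (Fnd (x + h *: delta_mx ord0 i) - Fnd x) ^+ 2 - edens x * h ^+ 2| <= C * h ^+ 3.
Proof.
move=> B0; have [C C0 HC] := gam_taylor1 N2 tau20.
pose E := kap * en (tau ^+ 2).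
have E0 : 0 < E by rewrite mulr_gt0 ?kap_gt0 ?en_gt0.
pose C1 := E + C * (2 * B + 1) ^+ 2.
have C10 : 0 < C1 by rewrite ltr_pwDl// mulr_ge0 ?sqr_ge0// ltW.
exists (N%:R * (C1 * (2 * E * B + C1))).
  rewrite mulr_gt0 ?ltr0n ?(leq_trans _ N2)// mulr_gt0// ltr_wpDl//.
  by rewrite mulr_ge0// mulr_ge0// ltW.
move=> x h h0 h1 xB.
(* - [a] is the gradient of [Fnd] at [x]. Below, dF + a i h is O(h^2), and the second factor in the
   difference of squares is O(h). *)
pose m := ms tau 0 x; pose a i := kap * en m * x ord0 i.
have -> : edens x * h ^+ 2 = \sum_i (a i * h) ^+ 2.
  rewrite /edens /sq mulr_sumr !mulr_suml; apply: eq_bigr => i _; rewrite /a -/m; ring.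
have -> : N%:R * (C1 * (2 * E * B + C1)) * h ^+ 3 = \sum_(i < N) C1 * (2 * E * B + C1) * h ^+ 3.
  by rewrite sumr_const card_ord -mulrA mulr_natl.
rewrite -sumrB.
apply: le_trans (ler_norm_sum _ _ _) _; apply: ler_sum => i _.
have en0 := ltW (en_gt0 N m).
have enE : kap * en m <= E by apply: ler_wpM2l; [exact: ltW (kap_gt0 R N2)|exact: en_le (msg x)].
have ken0 : 0 <= kap * en m by rewrite mulr_ge0// ltW// (kap_gt0 R N2).
have xi : `|x ord0 i| <= B by apply: le_trans (normr_coord x i) xB.
pose u := h * (2 * x ord0 i) + h ^+ 2.
have msE : ms tau 0 (x + h *: delta_mx ord0 i) = m + u.
  by rewrite ms_shift subr0 mul1r.
have := HC m u (msg x); rewrite -msE => /(_ (msg _)); rewrite -/(Fnd _) -/(Fnd x).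
set dF := Fnd _ - Fnd x => Hd.
have ai : `|a i| <= E * B.
  by rewrite /a normrM ger0_norm// ler_pM.
have ub : `|u| <= (2 * B + 1) * h.
  rewrite /u; apply: le_trans (ler_normD _ _) _; rewrite (ger0_norm (sqr_ge0 h)) !normrM (gtr0_norm h0) (ger0_norm (ler0n _ 2)).
  have : h * (2 * `|x ord0 i|) <= h * (2 * B) by rewrite ler_wpM2l ?(ltW h0)// ler_wpM2l.
  have : h ^+ 2 <= h by rewrite expr2 ler_piMr// ltW.
  by move: (h ^+ 2) (h * (2 * `|_|)) => *; lra.
have u2 : C * u ^+ 2 <= C * (2 * B + 1) ^+ 2 * h ^+ 2.
  rewrite -mulrA -exprMn ler_wpM2l ?(ltW C0)// -real_normK ?num_real//.
  by rewrite lerXn2r ?nnegrE// mulr_ge0 ?(ltW h0)// addr_ge0// mulr_ge0.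
have Hr : `|dF + a i * h| <= C1 * h ^+ 2.
  rewrite (_ : dF + _ = (dF + kap / 2 * en m * u) - kap / 2 * en m * h ^+ 2); last first.
    by rewrite /u /a; field.
  apply: le_trans (ler_normB _ _) _.
  have -> : `|kap / 2 * en m * h ^+ 2| = kap * en m / 2 * h ^+ 2.
    by rewrite ger0_norm; [field|rewrite mulrAC !mulr_ge0 ?exprn_ge0 ?(ltW h0) ?(ltW (kap_gt0 R N2))].
  have : kap * en m / 2 * h ^+ 2 <= E * h ^+ 2.
    rewrite ler_wpM2r ?sqr_ge0//; lra.
  rewrite /C1 mulrDl; move: Hd u2.
  move: (`|_ + _|) (_ * h ^+ 2) (_ * h ^+ 2) (_ * h ^+ 2) (C * _).
  by clear; move=> *; lra.
rewrite (_ : _ - _ = (dF + a i * h) * ((dF + a i * h) - 2 * (a i * h))); last by ring.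
rewrite normrM (_ : C1 * _ * h ^+ 3 = C1 * h ^+ 2 * ((2 * E * B + C1) * h)); last by ring.
apply: ler_pM => //; apply: le_trans (ler_normB _ _) _.
rewrite (mulrDl (2 * E * B)) [leLHS]addrC; apply: lerD.
  have -> : `|2 * (a i * h)| = 2 * (`|a i| * h).
    by rewrite normrM normrM (gtr0_norm h0) (ger0_norm (ler0n _ 2)).
  rewrite -mulrA -mulrA ler_wpM2l// mulrA; apply: ler_wpM2r => //; exact: ltW.
apply: le_trans Hr _; rewrite ler_wpM2l ?(ltW C10)// expr2 ler_piMr//; exact: ltW.
Qed.

(* Where [phi = (Fnd - P - T)^+] is positive,
   [grad phi . grad (Fnd + P) = |grad Fnd|^2 - |grad P|^2 <= |grad Fnd|^2]. *)
Lemma energy_upper (L D T eta k Cd : R) (P : V -> R) (A : set V) :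
  0 < D -> D < L -> 0 < eta -> 0 < k -> 0 <= Cd -> mrow P -> mesV A ->
  (forall x, A x -> enorm x <= D) ->
  (forall x y, enorm x <= L -> enorm y <= L -> `|P x - P y| <= k * enorm (x - y)) ->
  (forall x h, 0 < h -> h <= 1 -> enorm x <= D -> enorm x + h <= L -> dd h P x <= Cd * h ^+ 3) ->
  (forall x, enorm x < L -> T - eta < Fnd x - P x -> A x) ->
  intV (fun x => \1_(eball 0 L) x * Num.max (Fnd x - P x - T) 0 * src x) <=
  intV (fun x => \1_A x * edens x).
Proof.
move=> D0 DL eta0 k0 Cd0 mP mA AD Plip ddP HA.
have L0 : 0 < L := lt_trans D0 DL.
have [kF kF0 Flip] := Fnd_lip (ltW L0).
have [C1 C10 HC1] := dd_Fnd (ltW D0).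
have [C2 C20 HC2] := sqr_diff_Fnd (ltW D0).
have Pb := ball_bound (ltW k0) (ltW L0) Plip.
have Fb := ball_bound (ltW kF0) (ltW L0) Flip.
have mF : mrow Fnd by exact: mrow_gam_ms.
pose phi x := \1_(eball 0 L) x * Num.max (Fnd x - P x - T) 0.
have tphi : tame phi.
  apply: (@tame_ball L (`|Fnd 0| + kF * L + (`|P 0| + k * L) + `|T|)).
    by apply: mrow_max; [apply: mrowB; [exact: mrowB|exact: mrow_cst]|exact: mrow_cst].
  move=> x xL; rewrite ger0_norm ?le_max ?lexx ?orbT// ge_max.
  rewrite !addr_ge0// ?mulr_ge0 ?(ltW kF0) ?(ltW k0) ?(ltW L0)// andbT.
  rewrite (le_trans (ler_norm _))// (le_trans (ler_normB _ _))// lerD//.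
  by rewrite (le_trans (ler_normB _ _))// lerD// ?Fb ?Pb.
have phi0 x : 0 <= phi x.
  by rewrite mulr_ge0 ?indicE ?ler0n// le_max lexx orbT.
have phiA x : phi x != 0 -> A x.
  rewrite /phi indicE in_ball; have [xL|] := ltP (enorm x) L; last by rewrite mul0r eqxx.
  rewrite mul1r => H; apply: HA => //; rewrite ltNge; apply: contra H => H.
  by apply/eqP/max_idPr; rewrite subr_le0 (le_trans H)// lerBlDr lerDl ltW.
(* The cut at radius [L] makes the function tame. Since [phi] lives in the ball of radius [D] and h
   < L - D, its second differences on the support of [phi] do not see the cut. *)
pose f x := \1_(eball 0 L) x * (Fnd x + P x).
have tf : tame f.
  apply: (@tame_ball L (`|Fnd 0| + kF * L + (`|P 0| + k * L))); first exact: mrowD.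
  by move=> x xL; rewrite (le_trans (ler_normD _ _))// lerD ?Fb ?Pb.
have tsrc : tame (fun x => phi x * src x).
  apply: tameM => //; first exact: mrow_src.
  exists (kap * N%:R * tau ^+ 2 * en1 (tau ^+ 2)) => x _.
  by have /andP[s0 s1] := src_bound x; rewrite ger0_norm.
have bA : bounded_sq A by exists (D ^+ 2) => x /AD; rewrite enorm_le// ltW.
have tA : tame (\1_A : V -> R) by exact: tame_indic.
have inA x : (x \in A) = false -> phi x = 0.
  by move=> xA; apply: contraFeq xA => /phiA /mem_set.
have tAe : tame (fun x => \1_A x * edens x).
  apply: tameM => //; first exact: mrow_edens.
  exists (kap ^+ 2 * D ^+ 2 * en (tau ^+ 2) ^+ 2) => x.
  rewrite indicE; case: (boolP (x \in A)) => [/set_mem/AD xD _|]; last by rewrite eqxx.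
  by have /andP[s0 s1] := edens_bound (ltW D0) xD; rewrite ger0_norm.
pose dl := L - D.
have dl0 : 0 < dl by rewrite subr_gt0.
pose h0 := Num.min 1 (Num.min dl (eta / (kF + k))).
have kk : 0 < kF + k by rewrite addr_gt0.
have h00 : 0 < h0 by rewrite !lt_min ltr01 dl0 divr_gt0.
apply: (@le_of_small _ _ ((C1 + Cd) * intV phi + C2 * vol A) h0 h00) => h hh.
rewrite !lt_min => /andP[h1 /andP[hl]]; rewrite ltr_pdivlMr// => heta.
have h2 : 0 <= h ^+ 2 by exact: sqr_ge0.
have nh : `|h| = h by rewrite gtr0_norm.
have tdd : tame (fun x => phi x * dd h f x).
  apply: tameMt => //; apply: tame_sum => i.
  by apply: tameB; [apply: tameD; exact: tame_shift|exact: tameZ].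
have step i x : enorm (x + h *: delta_mx ord0 i) <= enorm x + h.
  by apply: le_trans (enormD _ _) _; rewrite enormZ enorm_delta mulr1 nh.
have step' i x : enorm x <= enorm (x + h *: delta_mx ord0 i) + h.
  have := enorm_triangle (x + h *: delta_mx ord0 i) x 0.
  rewrite !subr0 opprD addrA subrr add0r enormN enormZ enorm_delta mulr1 nh; lra.
have lower : intV (fun x => phi x * src x) * h ^+ 2 - (C1 + Cd) * intV phi * h ^+ 3 <=
    - intV (fun x => phi x * dd h f x).
  have -> : (C1 + Cd) * intV phi * h ^+ 3 = intV (fun x => (C1 + Cd) * h ^+ 3 * phi x).
    by rewrite intVZ//; ring.
  rewrite mulrC -intVZ// -intVB; [|exact: tameZ|exact: tameZ].
  rewrite -mulN1r -intVZ//; apply: le_intV.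
  - by apply: tameB; exact: tameZ.
  - exact: tameZ.
  move=> x; have [->|px] := eqVneq (phi x) 0; first by rewrite !mul0r !mulr0 subrr.
  have xD := AD x (phiA x px).
  have xhL : enorm x + h < L by rewrite /dl in hl; lra.
  rewrite dd_ball ?nh// ddD.
  have := HC1 x h hh (ltW h1) xD; have := ddP x h hh (ltW h1) xD (ltW xhL).
  rewrite ler_norml => b1 /andP[_ b2].
  have : phi x * (dd h Fnd x + dd h P x + src x * h ^+ 2) <= phi x * ((C1 + Cd) * h ^+ 3).
    by rewrite ler_wpM2l// mulrDl addrAC lerD.
  by move: (dd h _ x) (dd h _ x) => u v; clear; lra.
have upper : - intV (fun x => phi x * dd h f x) <=
    intV (fun x => \1_A x * edens x) * h ^+ 2 + C2 * vol A * h ^+ 3.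
  rewrite dd_parts// opprK.
  have tprod i : tame (fun x => (phi (x + h *: delta_mx ord0 i) - phi x) * (f (x + h *: delta_mx ord0 i) - f x)).
    by apply: tameMt; apply: tameB; [exact: tame_shift|exact: tphi|exact: tame_shift|exact: tf].
  rewrite -intV_sum// -(intV_indic mA).
  have -> : C2 * intV \1_A * h ^+ 3 = intV (fun x => C2 * h ^+ 3 * \1_A x).
    by rewrite intVZ//; ring.
  rewrite mulrC -intVZ// -intVD; [|exact: tameZ|exact: tameZ].
  apply: le_intV; first exact: tame_sum.
    by apply: tameD; exact: tameZ.
  move=> x; have [/set_mem xA|xA] := boolP (x \in A); last first.
    rewrite indicE (negbTE xA) mul0r !mulr0 addr0 big1// => i _.
    rewrite (inA x (negbTE xA)) subr0; set y := x + _.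
    (* A point outside [A] with a neighbour where [phi] > 0 is impossible: one step changes [Fnd] -
       [P] by at most h (kF + k) < eta, and [HA] has that margin. *)
    have [->|py] := eqVneq (phi y) 0; first by rewrite mul0r.
    case/negP: xA; apply/mem_set; apply: HA.
      have := AD y (phiA y py); have := step' i x; rewrite -/y /dl in hl *; clear -hl; lra.
    have yD := AD y (phiA y py).
    have yL : enorm y <= L := le_trans yD (ltW DL).
    have xL : enorm x <= L by have := step' i x; rewrite -/y /dl in hl *; clear -hl yD; lra.
    have yx : enorm (y - x) = h by rewrite /y addrAC subrr add0r enormZ enorm_delta mulr1.
    have := Flip y x yL xL; have := Plip y x yL xL; rewrite yx => p1 p2.
    have p3 := ler_norm (Fnd y - Fnd x).
    have p4 := ler_norm (- (P y - P x)); rewrite normrN in p4.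
    have p5 : T < Fnd y - P y.
      rewrite ltNge; apply: contra py => H; apply/eqP; rewrite /phi indicE in_ball.
      by rewrite (max_idPr _) ?mulr0// subr_le0.
    by rewrite mulrDr in heta; move: heta p1 p2 p3 p4 p5; move: (Fnd x) (Fnd y) (P x) (P y) => u u' v v'; move: (`|v' - v|) (`|u' - u|);
    clear; move=> *; lra.
  have xD := AD x xA; have xL : enorm x < L := le_lt_trans xD DL.
  rewrite indicE mem_set// mul1r mulr1.
  apply: (@le_trans _ _ (\sum_i (Fnd (x + h *: delta_mx ord0 i) - Fnd x) ^+ 2)); last first.
    have := HC2 x h hh (ltW h1) xD; rewrite ler_norml => /andP[_].
    by rewrite lerBlDl mulrC.
  apply: ler_sum => i _; set y := x + _.
  have yL : enorm y < L by have := step i x; rewrite -/y /dl in hl *; clear -hl xD; lra.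
  rewrite /phi /f !indicE !in_ball xL yL !mul1r.
  have [t /andP[t0 t1] ->] := max0_diff (Fnd x - P x - T) (Fnd y - P y - T).
  move: (Fnd x) (Fnd y) (P x) (P y) => u u' v v'.
  rewrite [leLHS](_ : _ = t * (u' - u) ^+ 2 - t * (v' - v) ^+ 2); last by ring.
  rewrite lerBlDr (@le_trans _ _ ((u' - u) ^+ 2))//; first by rewrite ler_piMl// sqr_ge0.
  by rewrite lerDl mulr_ge0// sqr_ge0.
have := le_trans lower upper; rewrite lerBlDr => /le_trans; apply.
by rewrite (mulrDl ((C1 + Cd) * intV phi)) -addrA [X in _ + X]addrC.
Qed.


(** For a concentric ball the test function is the excess of [Fnd] over its value on the sphere of
    radius [R1], and integration by parts loses nothing in the limit. The gap between [R0] and [R1]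
    leaves room for the steps; contributions from outside the smaller ball are nonnegative and
    dropped. *)
Lemma energy_lower (R0 R1 : R) : 0 < R0 -> R0 < R1 ->
  intV (fun x => \1_(eball 0 R0) x * edens x) <=
  intV (fun x => \1_(eball 0 R1) x * (Fnd x - gam (R1 ^+ 2 + tau ^+ 2)) * src x).
Proof.
move=> R00 R01; have R10 : 0 < R1 := lt_trans R00 R01.
pose L := R1 + 1.
have L0 : 0 < L by rewrite addr_gt0.
have [kF kF0 Flip] := Fnd_lip (ltW L0).
have [C1 C10 HC1] := dd_Fnd (ltW R10).
have [C2 C20 HC2] := sqr_diff_Fnd (ltW R10).
have Fb := ball_bound (ltW kF0) (ltW L0) Flip.
have mF : mrow Fnd by exact: mrow_gam_ms.
pose T := gam (R1 ^+ 2 + tau ^+ 2).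
have FT x : (R1 <= enorm x -> Fnd x <= T) /\ (enorm x <= R1 -> T <= Fnd x).
  rewrite enorm_ge ?enorm_le ?(ltW R10)// /Fnd /T /ms subr0.
  split=> h; apply: gam_le; rewrite ?lerD2r//; first by rewrite ltr_wpDl ?sqr_ge0.
  by rewrite ltr_wpDl ?sq_ge0.
pose phi x := \1_(eball 0 L) x * Num.max (Fnd x - T) 0.
have phiE x : phi x = \1_(eball 0 R1) x * (Fnd x - T).
  rewrite /phi !indicE !in_ball; have [xR|xR] := ltP (enorm x) R1.
    rewrite (_ : enorm x < L) ?mul1r; last by rewrite /L; lra.
    by apply/max_idPl; rewrite subr_ge0 (FT x).2// ltW.
  rewrite mul0r (max_idPr _) ?mulr0// subr_le0; exact: (FT x).1.
have tphi : tame phi.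
  apply: (@tame_ball L (`|Fnd 0| + kF * L + `|T|)).
    by apply: mrow_max; [apply: mrowB => //; exact: mrow_cst|exact: mrow_cst].
  move=> x xL; rewrite ger0_norm ?le_max ?lexx ?orbT// ge_max.
  rewrite !addr_ge0// ?mulr_ge0 ?(ltW kF0) ?(ltW L0)// andbT.
  by rewrite (le_trans (ler_norm _))// (le_trans (ler_normB _ _))// lerD// Fb.
have phi0 x : 0 <= phi x by rewrite mulr_ge0 ?indicE ?ler0n// le_max lexx orbT.
pose f x := \1_(eball 0 L) x * Fnd x.
have tf : tame f by exact: (@tame_ball L (`|Fnd 0| + kF * L)).
have tsrc : tame (fun x => phi x * src x).
  apply: tameM => //; first exact: mrow_src.
  exists (kap * N%:R * tau ^+ 2 * en1 (tau ^+ 2)) => x _.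
  by have /andP[s0 s1] := src_bound x; rewrite ger0_norm.
pose A := eball (0 : V) R0.
have mA : mesV A by exact: mesV_eball.
have tA : tame (\1_A : V -> R) by exact: tame_eball.
have tAe : tame (fun x => \1_A x * edens x).
  apply: tameM => //; first exact: mrow_edens.
  exists (kap ^+ 2 * R0 ^+ 2 * en (tau ^+ 2) ^+ 2) => x.
  rewrite indicE in_ball; case: ltP => [xD _|]; last by rewrite eqxx.
  by have /andP[s0 s1] := edens_bound (ltW R00) (ltW xD); rewrite ger0_norm.
rewrite [leRHS](_ : _ = intV (fun x => phi x * src x)); last first.
  by apply: eq_intV => x; rewrite phiE.
pose h0 := Num.min 1 (R1 - R0).
have h00 : 0 < h0 by rewrite !lt_min ltr01 subr_gt0.
apply: (@le_of_small _ _ (C1 * intV phi + C2 * vol A) h0 h00) => h hh.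
rewrite !lt_min => /andP[h1 hl].
have h2 : 0 <= h ^+ 2 by exact: sqr_ge0.
have nh : `|h| = h by rewrite gtr0_norm.
have tdd : tame (fun x => phi x * dd h f x).
  apply: tameMt => //; apply: tame_sum => i.
  by apply: tameB; [apply: tameD; exact: tame_shift|exact: tameZ].
have step i x : enorm (x + h *: delta_mx ord0 i) <= enorm x + h.
  by apply: le_trans (enormD _ _) _; rewrite enormZ enorm_delta mulr1 nh.
have step' i x : enorm x <= enorm (x + h *: delta_mx ord0 i) + h.
  have := enorm_triangle (x + h *: delta_mx ord0 i) x 0.
  rewrite !subr0 opprD addrA subrr add0r enormN enormZ enorm_delta mulr1 nh; lra.
have phiR x : phi x != 0 -> enorm x < R1.
  by rewrite phiE indicE in_ball; case: ltP => // _; rewrite mul0r eqxx.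
have upper : - intV (fun x => phi x * dd h f x) <=
    intV (fun x => phi x * src x) * h ^+ 2 + C1 * intV phi * h ^+ 3.
  have -> : C1 * intV phi * h ^+ 3 = intV (fun x => C1 * h ^+ 3 * phi x).
    by rewrite intVZ//; ring.
  rewrite mulrC -intVZ// -intVD; [|exact: tameZ|exact: tameZ].
  rewrite -mulN1r -intVZ//; apply: le_intV.
  - exact: tameZ.
  - by apply: tameD; exact: tameZ.
  move=> x; have [->|px] := eqVneq (phi x) 0; first by rewrite !mul0r !mulr0 addr0.
  have xD := phiR x px.
  have xhL : enorm x + h < L by rewrite /L; lra.
  rewrite dd_ball ?nh//.
  have := HC1 x h hh (ltW h1) (ltW xD); rewrite ler_norml => /andP[b1 _].
  have : phi x * (- (dd h Fnd x + src x * h ^+ 2)) <= phi x * (C1 * h ^+ 3).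
    by rewrite ler_wpM2l// lerNl.
  by move: (dd h _ x) => u; lra.
have lower : intV (fun x => \1_A x * edens x) * h ^+ 2 - C2 * vol A * h ^+ 3 <=
    - intV (fun x => phi x * dd h f x).
  rewrite dd_parts// opprK.
  have tprod i : tame (fun x => (phi (x + h *: delta_mx ord0 i) - phi x) * (f (x + h *: delta_mx ord0 i) - f x)).
    by apply: tameMt; apply: tameB; [exact: tame_shift|exact: tphi|exact: tame_shift|exact: tf].
  rewrite -intV_sum// -(intV_indic mA).
  have -> : C2 * intV \1_A * h ^+ 3 = intV (fun x => C2 * h ^+ 3 * \1_A x).
    by rewrite intVZ//; ring.
  rewrite mulrC -intVZ// -intVB; [|exact: tameZ|exact: tameZ].
  apply: le_intV; [by apply: tameB; exact: tameZ|exact: tame_sum|].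
  move=> x; rewrite [\1_A x]indicE in_ball; have [xA|xA] := ltP (enorm x) R0; last first.
    (* As long as both points lie within radius [L], [phi] is a nondecreasing function of [f], so
       the product of differences is nonnegative. Otherwise [phi] vanishes at both, a step being
       shorter than L - R1 = 1. *)
    rewrite mul0r !mulr0 subrr; apply: sumr_ge0 => i _; set y := x + _.
    rewrite /phi /f !indicE !in_ball.
    have hy := step i x; have hx := step' i x; rewrite -/y in hy hx.
    have [yL|yL] := ltP (enorm y) L; have [xL|xL] := ltP (enorm x) L.
    - move: (Fnd x) (Fnd y) => u v; rewrite !mul1r.
      have [t /andP[t0 t1] ->] := max0_diff (u - T) (v - T).
      rewrite [leRHS](_ : _ = t * (v - u) ^+ 2); last by ring.
      by rewrite mulr_ge0// sqr_ge0.
    - have -> : Num.max (Fnd y - T) 0 = 0.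
        apply/max_idPr; rewrite subr_le0; apply: (FT y).1.
        by rewrite /L in xL; move: (enorm x) (enorm y) h1 xL hx => *; lra.
      by rewrite mulr0 mul0r subrr mul0r.
    - have -> : Num.max (Fnd x - T) 0 = 0.
        apply/max_idPr; rewrite subr_le0; apply: (FT x).1.
        by rewrite /L in yL; move: (enorm x) (enorm y) h1 yL hy => *; lra.
      by rewrite mulr0 mul0r subrr mul0r.
    - by move: (Fnd x) (Fnd y) => u v; rewrite !mul0r subrr mul0r.
  rewrite mul1r mulr1.
  apply: (@le_trans _ _ (\sum_i (Fnd (x + h *: delta_mx ord0 i) - Fnd x) ^+ 2)).
    have xR1 : enorm x <= R1 by lra.
    have := HC2 x h hh (ltW h1) xR1; rewrite ler_norml => /andP[+ _].
    by rewrite lerBrDl mulrC.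
  apply: ler_sum => i _; set y := x + _.
  have yR : enorm y < R1 by have := step i x; rewrite -/y; lra.
  have xR : enorm x < R1 by lra.
  have R1L : R1 < L by rewrite /L ltrDl.
  have xL := lt_trans xR R1L; have yL := lt_trans yR R1L.
  rewrite !phiE /f !indicE !in_ball xR yR xL yL; move: (Fnd x) (Fnd y) => u v.
  by rewrite !mul1r opprB addrA subrK expr2.
have := le_trans lower upper; rewrite lerBlDr => /le_trans; apply.
by rewrite (mulrDl (C1 * intV phi)) -addrA.
Qed.

End energy.

(** * The energy inequality for the obstacle potential *)

Section obstacle_energy.
Context (R : realType) (N : nat).
Hypothesis N2 : (2 <= N)%N.
Local Notation V := 'rV[R]_N.
Local Notation gam := (@gam R N).
Local Notation en := (@en R N).
Local Notation en1 := (@en1 R N).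
Local Notation kap := (@kap R N).
Implicit Types (x y z v : V) (r s t h : R).

Variables (Om : set V) (d D L : R).
Hypotheses (oOm : open Om) (d0 : 0 < d) (dD : d < D) (DL : D < L).
Hypotheses (dOm : eball 0 d `<=` Om) (OmD : Om `<=` eball 0 D).
Local Notation gr := (@gr R N L).
Local Notation Gcap := (@Gcap R N L).
Local Notation ptsum := (@ptsum R N L).

Let D0 : 0 < D. Proof. exact: lt_trans dD. Qed.
Let L0 : 0 < L. Proof. exact: lt_trans DL. Qed.
Let K : set V := eclosed_ball 0 D `\` Om.

Let KD x : K x -> enorm x <= D.
Proof. by move=> [+ _]; rewrite /eclosed_ball /= subr0. Qed.

Let Kd x : K x -> d <= enorm x.
Proof.
move=> [_ nOm]; rewrite leNgt; apply/negP => xd; apply: nOm; apply: dOm.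
by rewrite /eball /= subr0.
Qed.

Let cK : compact K.
Proof.
apply: (compact_enorm (r := D)) => //; rewrite /K setDE.
by apply: closedI; [exact: closed_eclosed_ball|exact: open_closedC].
Qed.

Let mK : mesV K.
Proof.
apply: mesVD; last exact: mesV_open.
rewrite (_ : eclosed_ball 0 D = [set x | sq x <= D ^+ 2]).
  by apply: mesV_le; [exact: mrow_sq|exact: mrow_cst].
by apply/seteqP; split => x; rewrite /eclosed_ball /= subr0 (enorm_le _ (ltW D0)).
Qed.

Let dd_ptsum n (z : 'I_n -> V) (m : 'I_n -> R) tau : 0 < tau ->
  (forall j, enorm (z j) <= D) -> (forall j, 0 <= m j) ->
  exists2 C : R, 0 <= C & forall x h, 0 < h -> h <= 1 -> enorm x + h <= L ->
    dd h (ptsum z m tau) x <= C * h ^+ 3.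
Proof.
move=> tau0 zD m0; have t20 : 0 < tau ^+ 2 by rewrite exprn_gt0.
have [C C0 HC] := dd_gr N2 D0 DL t20.
have sm : 0 <= \sum_j m j by apply: sumr_ge0.
exists ((\sum_j m j) * C); first by rewrite mulr_ge0// ltW.
move=> x h h0 h1 xL; rewrite (_ : ptsum z m tau = fun x => \sum_j m j * gr tau x (z j))//.
rewrite dd_sum -mulrA mulr_suml; apply: ler_sum => j _.
rewrite ddZ ler_wpM2l//; have := HC tau (z j) x h.
rewrite gtr0_norm// => /(_ h1 (zD j) xL (ms_ge _ _ _) (fun=> ms_ge _ _ _) (fun=> ms_ge _ _ _)).
rewrite ler_norml => /andP[_]; apply: le_trans.
rewrite lerDl mulr_ge0 ?sqr_ge0// mulr_ge0 ?(ltW (en1_gt0 _ _))// mulr_ge0 ?sqr_ge0// mulr_ge0//.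
exact: ltW (kap_gt0 R N2).
Qed.

(** [Cm] is chosen before [lam], so the saturated cells have volume at most Cm / lam. The last
    clause adds [energy_lower] and [energy_upper], whose test functions differ on the ball of radius
    [R1] by at most the potential plus a constant. *)
Lemma obstacle_energy : exists2 Cm : R, 0 < Cm & forall lam eta, 0 < lam -> 0 < eta ->
  eta <= 1 -> exists2 t0 : R, 0 < t0 <= 1 & forall tau, 0 < tau -> tau <= t0 ->
  exists n (z : 'I_n -> V) (m : 'I_n -> R) (p : V -> R),
  [/\ forall j, d <= enorm (z j) <= D, forall j, 0 <= m j, \sum_j m j <= Cm &
      forall x, enorm x <= L -> `|p x - ptsum z m tau x| <= eta] /\
  [/\ forall x, enorm x < L -> {for x, continuous p},
      forall x, Om x -> forall e, 0 < e -> exists2 del, 0 < del & forall h, 0 < h -> h < del ->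
        - (e * h ^+ 2) <= dd h p x,
      forall x, 0 < enorm x -> enorm x <= L -> p x <= Gcap x + 3 * eta &
      forall R0 R1 : R, 0 < R0 -> R0 < R1 -> R1 < L ->
        intV (fun x => \1_(eball 0 R0) x * edens tau x) <=
        intV (fun x => \1_Om x * edens tau x) + kap ^+ 2 * D ^+ 2 * en (d ^+ 2) ^+ 2 * (Cm / lam) +
        intV (fun x => \1_(eball 0 R1) x * (ptsum z m tau x +
          (gam (D ^+ 2) + 2 * eta - gam (R1 ^+ 2 + tau ^+ 2))) * src tau x)].
Proof.
have [Cm Cm0 [tm tm0 HCm]] := ptsum_mass N2 D0 DL d0 dD.
exists Cm => // lam eta lam0 eta0 eta1.
have [t1 /andP[t10 t11] H] := cells_potential N2 D0 DL mK cK KD d0 Kd lam0 eta0.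
exists (Num.min t1 tm); first by rewrite lt_min t10 tm0 /= ge_min t11.
move=> tau tau0; rewrite le_min => /andP[tt1 ttm].
have [n [z [C [a [[Kz mC CK ab dr] [pP free act [k k0 Plip]]]]]]] := H tau tau0 tt1.
move: dr pP free act Plip; set rho := (fun x => _); set m := (fun j => a j * vol (C j)).
set P := ptsum z m tau => dr pP free act Plip.
have m0 j : 0 <= m j by rewrite mulr_ge0 ?vol_ge0//; have /andP[] := ab j.
have zD j : enorm (z j) <= D := KD (Kz j).
pose p := pot L rho.
have pG x : 0 < enorm x -> enorm x <= L -> p x <= Gcap x + 3 * eta.
  apply: (pot_le_Gcap N2 D0 DL mK KD lam0 eta0 k0 dr pP Plip).
    move=> y yL; apply: sumr_le0 => j _; rewrite mulr_ge0_le0//.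
    exact: (gr_le0 N2 D0 DL).
  move=> y ry; have [[j [Cy aj]]|nj] := pselect (exists j, C j y /\ 0 < a j).
    exact: act Cy aj.
  case/eqP: ry; rewrite /rho big1// => j _; rewrite indicE.
  have [/set_mem Cy|_] := boolP (y \in C j); last by rewrite mulr0.
  have /andP[aj _] := ab j; rewrite le_eqVlt in aj.
  case/orP: aj => [/eqP <-|aj]; first by rewrite mul0r.
  by case: nj; exists j.
have PG x : 0 < enorm x -> enorm x <= L -> P x <= Gcap x + 4.
  move=> x0 xL; have := pG x x0 xL; have := pP x xL.
  rewrite ler_norml -/p => /andP[+ _].
  by move: (p x) (P x) (Gcap x) eta1 => *; lra.
have mCm : \sum_j m j <= Cm := HCm n z m tau tau0 ttm zD m0 PG.
exists n, z, m, p; split; first by split=> // j; rewrite zD Kd.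
split.
- by move=> x xL; exact: (pot_continuous N2 D0 DL mK KD lam0 dr).
- move=> x Ox; have [r r0 rOm] := (nbhs_enormP x Om).1 (open_nbhs_nbhs (conj oOm Ox)).
  have xL : enorm x < L by have := OmD Ox; rewrite /eball /= subr0 => /lt_trans; apply.
  pose r1 := Num.min r (L - enorm x).
  apply: (pot_dd N2 D0 DL mK KD lam0 dr (r := r1)).
  + by rewrite lt_min r0 subr_gt0.
  + by rewrite -lerBrDl ge_min lexx orbT.
  move=> y; rewrite lt_min => /andP[yr _]; apply: contraTeq isT => ry.
  by have [_ []] := densityK dr ry; exact: rOm.
- exact: pG.
move=> R0 R1 R00 R01 R1L.
have [Cd Cd0 HCd] := dd_ptsum tau0 zD m0.
(* The saturated cells together with the null ones, on which optimality gives no information. The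
   null cells add nothing to the integral of [s]. *)
pose bad j := (a j == lam) || (vol (C j) == 0).
pose s x := \sum_j (bad j)%:R * \1_(C j) x : R.
pose B := [set x | 1 <= s x].
pose A := Om `|` B.
have bC j : bounded_sq (C j).
  exists (D ^+ 2) => x Cx; rewrite -(enorm_le _ (ltW D0)); apply: KD.
  have := CK x; rewrite [in RHS]indicE; case: (boolP (x \in K)) => [/set_mem//|_] /eqP.
  rewrite psumr_eq0 => [/allP/(_ j)|i _]; last by rewrite indicE ler0n.
  by rewrite mem_index_enum indicE mem_set// oner_eq0 => /(_ isT).
have tC j : tame (\1_(C j) : V -> R) by exact: tame_indic.
have ts : tame s by apply: tame_sum => j; exact: tameZ.
have mA : mesV A.
  by apply: mesVU; [exact: mesV_open|apply: mesV_le; [exact: mrow_cst|exact: ts.1]].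
have s0 x : 0 <= s x by apply: sumr_ge0 => j _; rewrite mulr_ge0// indicE ler0n.
have sK x : s x <= \1_K x.
  rewrite -CK; apply: ler_sum => j _; rewrite ler_piMl ?indicE ?ler0n//.
  by case: (bad j).
have BK x : B x -> K x.
  rewrite /B /= => /le_trans/(_ (sK x)); rewrite indicE.
  by case: (boolP (x \in K)) => [/set_mem//|_]; rewrite ler10.
have sCm : intV s <= Cm / lam.
  rewrite intV_sum; last by move=> j; exact: tameZ.
  rewrite ler_pdivlMr// (le_trans _ mCm)// mulr_suml; apply: ler_sum => j _.
  rewrite intVZ// intV_indic// /m /bad.
  have [->|_] := eqVneq (a j) lam; first by rewrite mul1r mulrC.
  have [->|_] /= := eqVneq (vol (C j)) 0; first by rewrite !mulr0 mul0r.
  by rewrite !mul0r; exact: m0.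
have AD x : A x -> enorm x <= D.
  by case=> [/OmD|/BK/KD//]; rewrite /eball /= subr0 => /ltW.
have mP : mrow P by apply: mrow_sum => j; apply: mrowZ; exact: mrow_gr.
(* Outside [Om] and the bad cells [Fnd] - [P] is at most gam (D^2) + eta = T - eta: on the other
   cells by optimality and L > D, beyond radius [D] because the potential is nonnegative up to eta.
   The second eta is the margin required by [energy_upper]. *)
pose T := gam (D ^+ 2) + 2 * eta.
have HA x : enorm x < L -> T - eta < Fnd tau x - P x -> A x.
  move=> xL HT; have [|nOm] := pselect (Om x); first by left.
  have xd : d <= enorm x.
    rewrite leNgt; apply/negP => xd; apply: nOm; apply: dOm.
    by rewrite /eball /= subr0.
  have x0 : 0 < enorm x := lt_le_trans d0 xd.
  have sx0 : 0 < sq x by rewrite -enormE exprn_gt0.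
  have Fx : Fnd tau x <= gam (sq x).
    by apply: gam_le => //; rewrite /ms subr0 lerDl sqr_ge0.
  have D2L : gam (L ^+ 2) <= gam (D ^+ 2).
    by apply: gam_le; rewrite ?exprn_gt0// lerXn2r ?nnegrE ?(ltW D0) ?(ltW L0)// ltW.
  have [xD|Dx] := leP (enorm x) D; last first.
    have gD : gam (sq x) <= gam (D ^+ 2).
      by apply: gam_le; rewrite ?exprn_gt0// -(enorm_ge _ (ltW D0)) ltW.
    have := pP x (ltW xL); rewrite -/p ler_norml => /andP[_].
    have := pot_ge0 N2 D0 DL mK KD lam0 dr xL; rewrite -/p.
    move: HT; rewrite /T; move: Fx gD.
    move: (Fnd tau x) (gam (sq x)) (gam (D ^+ 2)) (p x) (P x).
    by clear; move=> *; lra.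
  have Kx : K x by split=> //; rewrite /eclosed_ball /= subr0.
  right; rewrite /B /= leNgt; apply/negP => sx1.
  suff : Gcap x - P x <= eta.
    rewrite /Gcap; move: HT; rewrite /T; move: Fx D2L eta0.
    move: (Fnd tau x) (gam (sq x)) (gam (D ^+ 2)) (gam (L ^+ 2)) (P x).
    by move=> *; lra.
  have [[j Cx]|nC] := pselect (exists j, C j x); last first.
    have := CK x; rewrite [in RHS]indicE mem_set// big1 => [/eqP|j _]; first by rewrite eq_sym oner_eq0.
    by rewrite indicE memNset// => Cx; apply: nC; exists j.
  have nbad : ~~ bad j.
    apply: contraTN sx1 => bj; rewrite -leNgt /s (bigD1 j)//= bj indicE mem_set// mulr1.
    by rewrite lerDl; apply: sumr_ge0 => i _; rewrite mulr_ge0// indicE ler0n.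
  rewrite /bad negb_or in nbad; case/andP: nbad => nl nv.
  apply: (free j) => //; first by rewrite lt_neqAle eq_sym nv vol_ge0.
  by rewrite lt_neqAle nl; have /andP[] := ab j.
have HCd' : forall x h, 0 < h -> h <= 1 -> enorm x <= D -> enorm x + h <= L ->
    dd h P x <= Cd * h ^+ 3 by move=> x h h0 h1 _; exact: HCd.
have EU := energy_upper N2 tau0 D0 DL eta0 k0 Cd0 mP mA AD Plip HCd' HA.
have EL := energy_lower N2 tau0 R00 R01.
pose c1 := gam (R1 ^+ 2 + tau ^+ 2).
have bA : bounded_sq A by exists (D ^+ 2) => x /AD; rewrite enorm_le// ltW.
have tq U : tame (\1_U : V -> R) -> (forall x, U x -> enorm x <= D) ->
    tame (fun x => \1_U x * edens tau x).
  move=> tU UD; apply: tameM => //; first exact: mrow_edens.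
  exists (kap ^+ 2 * D ^+ 2 * en (tau ^+ 2) ^+ 2) => x.
  rewrite indicE; case: (boolP (x \in U)) => [/set_mem/UD xD _|]; last by rewrite eqxx.
  by have /andP[? ?] := edens_bound tau0 (ltW D0) xD; rewrite ger0_norm.
have tOm : tame (\1_Om : V -> R).
  apply: tame_indic; first exact: mesV_open.
  by exists (D ^+ 2) => x Ox; rewrite -(enorm_le _ (ltW D0)) AD//; left.
have OmD' x : Om x -> enorm x <= D by move=> Ox; apply: AD; left.
have QA : intV (fun x => \1_A x * edens tau x) <=
    intV (fun x => \1_Om x * edens tau x) + kap ^+ 2 * D ^+ 2 * en (d ^+ 2) ^+ 2 * (Cm / lam).
  (* A bound for the energy density on [K], where d <= |x| <= D; it does not depend on [tau]. *)
  set qm := kap ^+ 2 * D ^+ 2 * en (d ^+ 2) ^+ 2.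
  have qm0 : 0 <= qm by rewrite mulr_ge0 ?sqr_ge0// mulr_ge0 ?sqr_ge0.
  apply: (@le_trans _ _ (intV (fun x => \1_Om x * edens tau x) + qm * intV s)); last first.
    by rewrite lerD2l ler_wpM2l.
  rewrite -intVZ// -intVD; [|exact: tq|exact: tameZ].
  have tA : tame (\1_A : V -> R) by exact: tame_indic.
  apply: le_intV; [exact: tq|by apply: tameD; [exact: tq|exact: tameZ]|].
  move=> x; have [e0 _] : 0 <= edens tau x /\ True.
    by have /andP[] := edens_bound tau0 (enorm_ge0 x) (lexx _).
  have [Ox|nOm] := pselect (Om x).
    by rewrite !indicE !mem_set ?mul1r//; [rewrite lerDl mulr_ge0|left].
  have [Bx|nB] := pselect (B x); last first.
    rewrite indicE memNset; last by case.
    rewrite mul0r; apply: addr_ge0; last by apply: mulr_ge0.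
    by apply: mulr_ge0 => //; rewrite indicE ler0n.
  rewrite [\1_A x]indicE mem_set ?mul1r; last by right.
  rewrite [\1_Om x]indicE memNset// mul0r add0r.
  have Kx := BK x Bx; have xD := KD Kx; have xd := Kd Kx.
  apply: (@le_trans _ _ (qm * 1)); last by rewrite ler_wpM2l.
  rewrite mulr1 /edens /qm; apply: ler_pM; rewrite ?sqr_ge0//.
  - by rewrite mulr_ge0 ?sqr_ge0// sq_ge0.
  - by rewrite ler_wpM2l ?sqr_ge0// -(enorm_le _ (ltW D0)).
  rewrite lerXn2r ?nnegrE ?(ltW (en_gt0 _ _))// en_le ?exprn_gt0//.
  rewrite /ms subr0 -[leLHS]addr0 lerD ?sqr_ge0// -(enorm_ge _ (ltW d0)).
  exact: xd.
have R10 : 0 < R1 := lt_trans R00 R01.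
apply: (le_trans EL); have tB := tame_eball (0 : V) R1.
have srcb x : `|src tau x| <= kap * N%:R * tau ^+ 2 * en1 (tau ^+ 2).
  by have /andP[a0 a1] := src_bound N2 tau0 x; rewrite ger0_norm.
have tsrc f : tame f -> tame (fun x => f x * src tau x).
  move=> tf; apply: tameM => //; first exact: mrow_src.
  by exists (kap * N%:R * tau ^+ 2 * en1 (tau ^+ 2)) => x _.
have PL0 := ball_bound (ltW k0) (ltW L0) Plip.
have [kF kF0 Flip] := Fnd_lip N2 tau0 (ltW L0).
have FL0 := ball_bound (ltW kF0) (ltW L0) Flip.
have mF : mrow (Fnd tau : V -> R) by exact: mrow_gam_ms.
have tphi : tame (fun x => \1_(eball 0 L) x * Num.max (Fnd tau x - P x - T) 0).
  apply: (@tame_ball _ _ L (`|Fnd tau (0 : V)| + kF * L + (`|P 0| + k * L) + `|T|)).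
    by apply: mrow_max; [apply: mrowB; [exact: mrowB|exact: mrow_cst]|exact: mrow_cst].
  move=> x xL; rewrite ger0_norm ?le_max ?lexx ?orbT// ge_max.
  rewrite !addr_ge0// ?mulr_ge0 ?(ltW kF0) ?(ltW k0) ?(ltW L0)// andbT.
  rewrite (le_trans (ler_norm _))// (le_trans (ler_normB _ _))// lerD//.
  by rewrite (le_trans (ler_normB _ _))// lerD// ?FL0 ?PL0.
have tF : tame (fun x => \1_(eball 0 R1) x * (Fnd tau x - c1)).
  apply: (@tame_ball _ _ R1 (`|Fnd tau (0 : V)| + kF * L + `|c1|)).
    by apply: mrowB => //; exact: mrow_cst.
  move=> x xR; have xL := lt_trans xR R1L.
  by rewrite (le_trans (ler_normB _ _))// lerD// FL0.
have tP : tame (fun x => \1_(eball 0 R1) x * (P x + (T - c1))).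
  apply: (@tame_ball _ _ R1 (`|P 0| + k * L + `|T - c1|)).
    by apply: mrowD => //; exact: mrow_cst.
  move=> x xR; have xL := lt_trans xR R1L.
  by rewrite (le_trans (ler_normD _ _))// lerD// PL0.
(* On the ball of radius [R1], Fnd - c1 = (Fnd - P - T) + (P + T - c1), and the first bracket is at
   most its positive part. *)
apply: (@le_trans _ _ (intV (fun x => \1_(eball 0 L) x * Num.max (Fnd tau x - P x - T) 0 * src tau x) +
   intV (fun x => \1_(eball 0 R1) x * (P x + (T - c1)) * src tau x))); last first.
  by rewrite lerD2r; exact: le_trans EU QA.
rewrite -intVD; [|exact: tsrc|exact: tsrc].
apply: le_intV; [exact: tsrc|by apply: tameD; exact: tsrc|].
move=> x; rewrite -mulrDl; apply: ler_wpM2r; first by have /andP[] := src_bound N2 tau0 x.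
rewrite !indicE !in_ball; have [xR|xR] := ltP (enorm x) R1; last first.
  by rewrite !mul0r addr0 mulr_ge0 ?ler0n// le_max lexx orbT.
rewrite (lt_trans xR R1L) !mul1r -lerBlDr le_max; apply/orP; left.
rewrite -/c1; by rewrite [leLHS](_ : _ = Fnd tau x - P x - T)//; ring.
Qed.

End obstacle_energy.

(** * The energy deficit of a domain *)

Section radial.
Context (R : realType) (N : nat).
Hypothesis N2 : (2 <= N)%N.
Local Notation V := 'rV[R]_N.
Local Notation gam := (@gam R N).
Local Notation en := (@en R N).
Local Notation en1 := (@en1 R N).
Local Notation kap := (@kap R N).
Local Notation om := (omegaN R N).
Implicit Types (x y z v : V) (r s t h tau rho : R).

Lemma en1_sqr t : 0 < t -> en1 (t ^+ 2) = (t ^+ N * t ^+ 2)^-1.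
Proof. by move=> t0; rewrite en1E ?exprn_gt0// en_sqr// (invfM (t ^+ N)). Qed.

Lemma tame_src_ball tau r : 0 < tau -> tame (fun x => \1_(eball (0 : V) r) x * src tau x).
Proof.
move=> tau0; apply: tameM; [exact: tame_eball|exact: mrow_src|].
exists (kap * N%:R * tau ^+ 2 * en1 (tau ^+ 2)) => x _.
by have /andP[a0 a1] := src_bound N2 tau0 x; rewrite ger0_norm.
Qed.

(** [src] is an approximate delta function: it is of order tau^(-N) on the ball of radius [tau], and
    the dyadic shell at radius 2^k tau contributes O(4^(-k)). Hence bounds independent of [tau] and
    [rho]. *)
Lemma src_mass : exists c1 c2 : R, [/\ 0 < c1, 0 < c2 & forall tau rho, 0 < tau -> tau <= rho ->
  c1 <= intV (fun x => \1_(eball (0 : V) rho) x * src tau x) <= c2].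
Proof.
pose c := kap * N%:R * om.
have k0 := kap_gt0 R N2; have o0 := omegaN_gt0 R N.
have n0 : 0 < N%:R :> R by rewrite ltr0n (leq_trans _ N2).
have kn0 : 0 < kap * N%:R by rewrite mulr_gt0.
have c0 : 0 < c by rewrite mulr_gt0.
exists (c / (2 ^+ N * 2 ^+ 2)), (c * (1 + 2 ^+ N * 2)); split.
- by rewrite divr_gt0// mulr_gt0// exprn_gt0.
- by rewrite mulr_gt0// ltr_pwDl// mulr_ge0// exprn_ge0.
move=> tau rho tau0 tr.
have src0 x : 0 <= src tau x by have /andP[] := src_bound N2 tau0 x.
have rho0 : 0 < rho := lt_le_trans tau0 tr.
have mono r r' f : r <= r' -> (forall x, 0 <= f x) -> forall x, \1_(eball (0 : V) r) x * f x <= \1_(eball 0 r') x * f x.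
  move=> rr f0 x; apply: ler_wpM2r => //; rewrite !indicE !in_ball.
  by case: (ltP (enorm x) r) => // xr; rewrite (lt_le_trans xr rr).
have tn0 : tau ^+ N != 0 by rewrite gt_eqF// exprn_gt0.
have tt0 : tau ^+ 2 != 0 by rewrite gt_eqF// exprn_gt0.
have pn0 : (2 : R) ^+ N != 0 by rewrite gt_eqF// exprn_gt0.
have intc r e : 0 < r -> intV (fun x => e * \1_(eball (0 : V) r) x) = e * (om * r ^+ N).
  by move=> r0; rewrite intVZ ?intV_eball//; exact: tame_eball.
apply/andP; split.
  apply: (@le_trans _ _ (intV (fun x => kap * N%:R * tau ^+ 2 * en1 ((2 * tau) ^+ 2) * \1_(eball (0 : V) tau) x))).
    rewrite intc// en1_sqr ?mulr_gt0// !exprMn.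
    rewrite [leRHS](_ : _ = c / (2 ^+ N * 2 ^+ 2))//; rewrite /c; field.
    by rewrite gt_eqF ?tn0 ?pn0//= gt_eqF// exprn_gt0.
  apply: le_intV; [by apply: tameZ; exact: tame_eball|exact: tame_src_ball|].
  move=> x; apply: (@le_trans _ _ (\1_(eball 0 tau) x * src tau x)); last exact: mono.
  rewrite mulrC !indicE in_ball; have [xt|_] := ltP (enorm x) tau; last by rewrite !mul0r.
  rewrite !mul1r /src; apply: ler_wpM2l; first by rewrite mulr_ge0 ?sqr_ge0// ltW.
  apply: en1_le; first by rewrite /ms ltr_wpDl ?sq_ge0// exprn_gt0.
  rewrite /ms subr0; move: (ltW xt); rewrite enorm_le ?(ltW tau0)// => h.
  have := sqr_ge0 tau; rewrite exprMn; move: (sq x) (tau ^+ 2) h => *; lra.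
(* 2 - 2 / 4^k dominates the partial sum of the 4^(-j) over j < k, in a form that passes through the
   induction. *)
have step k : intV (fun x => \1_(eball (0 : V) (2 ^+ k * tau)) x * src tau x) <=
    c * (1 + 2 ^+ N * (2 - 2 / (2 ^+ k) ^+ 2)).
  elim: k => [|k IH].
    rewrite expr0 mul1r expr1n divr1 subrr mulr0 addr0 mulr1.
    apply: (@le_trans _ _ (intV (fun x => kap * N%:R * tau ^+ 2 * en1 (tau ^+ 2) * \1_(eball (0 : V) tau) x))).
      apply: le_intV; [exact: tame_src_ball|by apply: tameZ; exact: tame_eball|].
      move=> x; rewrite mulrC ler_wpM2r ?indicE ?ler0n//.
      by have /andP[] := src_bound N2 tau0 x.
    rewrite intc// en1_sqr//.
    rewrite [leLHS](_ : _ = c)//; rewrite /c; field.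
    by rewrite tn0 gt_eqF.
  set r := 2 ^+ k * tau; have r0 : 0 < r by rewrite mulr_gt0// exprn_gt0.
  have p0 : 0 < (2 : R) ^+ k by rewrite exprn_gt0.
  rewrite exprS -mulrA -/r.
  have tB s : tame (\1_(eball (0 : V) s) : V -> R) by exact: tame_eball.
  have tS s : tame (fun x => \1_(eball (0 : V) s) x * src tau x) by exact: tame_src_ball.
  apply: (@le_trans _ _ (intV (fun x => \1_(eball (0 : V) r) x * src tau x) +
     intV (fun x => kap * N%:R * tau ^+ 2 * en1 (r ^+ 2) * \1_(eball (0 : V) (2 * r)) x))).
    rewrite -intVD//; last exact: tameZ.
    apply: le_intV => //; first by apply: tameD => //; exact: tameZ.
    move=> x; have E0 : 0 <= kap * N%:R * tau ^+ 2 * en1 (r ^+ 2).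
      by rewrite mulr_ge0 ?(ltW (en1_gt0 _ _))// mulr_ge0 ?sqr_ge0// ltW.
    rewrite !indicE !in_ball; have [xr|xr] := ltP (enorm x) r.
      rewrite (_ : enorm x < 2 * r); last by lra.
      by rewrite mul1r mulr1 lerDl.
    rewrite mul0r add0r; case: (enorm x < 2 * r); last by rewrite mul0r mulr0.
    rewrite mul1r mulr1 /src; apply: ler_wpM2l; first by rewrite mulr_ge0 ?sqr_ge0// ltW.
    apply: en1_le; first by rewrite exprn_gt0.
    by rewrite /ms subr0 -[leLHS]addr0 lerD ?sqr_ge0// -(enorm_ge _ (ltW r0)).
  have E : kap * N%:R * tau ^+ 2 * en1 (r ^+ 2) * (om * (2 * r) ^+ N) = c * (2 ^+ N / (2 ^+ k) ^+ 2).
    rewrite en1_sqr// /r !(exprMn N) !(exprMn 2) /c; field.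
    by rewrite tn0 !gt_eqF// !exprn_gt0.
  rewrite intc ?mulr_gt0// E; apply: le_trans (lerD IH (lexx _)) _.
  rewrite -mulrDr ler_wpM2l ?(ltW c0)// -addrA lerD2l -mulrDr ler_wpM2l ?exprn_ge0//.
  rewrite (exprMn 2) [in leRHS]invfM.
  have : 0 < ((2 : R) ^+ k) ^- 2 by rewrite invr_gt0 !exprn_gt0.
  by move: (_ ^- 2) => u; lra.
have [k hk] : exists k, rho <= 2 ^+ k * tau.
  exists (Num.bound (rho / tau)); rewrite -ler_pdivrMr//.
  apply: (le_trans (ltW (archi_boundP _))); first by rewrite divr_ge0 ?ltW.
  by rewrite -natrX ler_nat ltnW// ltn_expl.
apply: (@le_trans _ _ (intV (fun x => \1_(eball (0 : V) (2 ^+ k * tau)) x * src tau x))).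
  by apply: le_intV; [exact: tame_src_ball|exact: tame_src_ball|exact: mono].
apply: le_trans (step k) _; rewrite ler_wpM2l ?(ltW c0)// lerD2l ler_wpM2l ?exprn_ge0//.
by rewrite gerBl divr_ge0// sqr_ge0.
Qed.

(** The right-hand side is the chord over [0, 1] of the convex function on the left. *)
Lemma exp1D_le (n : nat) (t : R) : 0 <= t <= 1 -> (1 + t) ^+ n <= 1 + (2 ^+ n - 1) * t.
Proof.
move=> /andP[t0 t1]; elim: n => [|n IH]; first by rewrite !expr0 subrr mul0r addr0.
rewrite exprS; apply: (@le_trans _ _ ((1 + t) * (1 + (2 ^+ n - 1) * t))).
  by rewrite ler_wpM2l// addr_ge0.
have : (2 ^+ n - 1) * t * t <= (2 ^+ n - 1) * t * 1.
  by rewrite ler_wpM2l// mulr_ge0// subr_ge0 exprn_ege1// ler1n.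
rewrite exprS; move: (2 ^+ n) => u; nra.
Qed.

(** The squared gradient of Gamma_N at distance [r], the limit of [edens] as [tau] tends to 0. *)
Definition radq r : R := kap ^+ 2 * (r ^+ (2 * N - 2))^-1.

Lemma radq_le r s : 0 < r -> r <= s -> radq s <= radq r.
Proof.
move=> r0 rs; rewrite ler_wpM2l ?sqr_ge0// lef_pV2 ?posrE ?exprn_gt0 ?(lt_le_trans r0)//.
by rewrite lerXn2r ?nnegrE ?(ltW r0)// ltW// (lt_le_trans r0).
Qed.

Let radqE r : 0 < r -> radq r = kap ^+ 2 * r ^+ 2 * (r ^+ N)^-1 ^+ 2.
Proof.
move=> r0; rewrite /radq -mulrA; congr (_ * _).
have rn n : r ^+ n != 0 by rewrite gt_eqF// exprn_gt0.
have e : r ^+ (2 * N) = r ^+ (2 * N - 2) * r ^+ 2.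
  by rewrite -exprD subnK// mulnC leq_pmull// (leq_trans _ N2).
have -> : (r ^+ N)^-1 ^+ 2 = (r ^+ (2 * N))^-1 by rewrite exprVn -exprM mulnC.
by rewrite e (invfM (r ^+ (2 * N - 2))) mulrCA divff ?rn// mulr1.
Qed.

Lemma edens_le_radq tau x : 0 < enorm x -> edens tau x <= radq (enorm x).
Proof.
move=> x0; rewrite radqE// -en_sqr// !enormE /edens.
have sx : 0 < sq x by rewrite -enormE exprn_gt0.
apply: ler_wpM2l; first by rewrite mulr_ge0 ?sqr_ge0 ?sq_ge0.
rewrite lerXn2r ?nnegrE ?(ltW (en_gt0 _ _))//; apply: en_le => //.
by rewrite /ms subr0 lerDl sqr_ge0.
Qed.

Lemma edens_ge_radq (d D : R) : 0 < d -> 0 < D -> exists2 C : R, 0 < C & forall tau x, d <= enorm x ->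
  enorm x <= D -> radq (enorm x) - C * tau ^+ 2 <= edens tau x.
Proof.
move=> d0 D0; have d20 : 0 < d ^+ 2 by rewrite exprn_gt0.
have [C C0 HC] := en_lip N d20.
have k20 : 0 < kap ^+ 2 by rewrite exprn_gt0// kap_gt0.
have ed := en_gt0 N (d ^+ 2).
exists (kap ^+ 2 * D ^+ 2 * (2 * en (d ^+ 2)) * C).
  by apply: mulr_gt0 => //; apply: mulr_gt0; rewrite mulr_gt0// exprn_gt0.
move=> tau x dx xD; have x0 : 0 < enorm x := lt_le_trans d0 dx.
rewrite radqE// -en_sqr// !enormE /edens.
have d2x : d ^+ 2 <= sq x by rewrite -(enorm_ge _ (ltW d0)).
have xm : sq x <= ms tau 0 x by rewrite /ms subr0 lerDl sqr_ge0.
have xD2 : sq x <= D ^+ 2 by rewrite -(enorm_le _ (ltW D0)).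
have := HC (sq x) (ms tau 0 x) d2x (le_trans d2x xm).
rewrite [X in _ <= C * `|X|](_ : _ = tau ^+ 2); last by rewrite /ms subr0; ring.
rewrite (ger0_norm (sqr_ge0 tau)) ler_norml => /andP[h _].
have ex := en_gt0 N (sq x); have em := en_gt0 N (ms tau 0 x).
have e1 : en (sq x) <= en (d ^+ 2) by exact: en_le.
have sx0 : 0 < sq x := lt_le_trans d20 d2x.
have e2 : en (ms tau 0 x) <= en (sq x) by exact: en_le.
have : en (sq x) ^+ 2 - en (ms tau 0 x) ^+ 2 <= 2 * en (d ^+ 2) * (C * tau ^+ 2).
  rewrite subr_sqr mulrC; apply: ler_pM.
  - by rewrite addr_ge0// ltW.
  - by rewrite subr_ge0.
  - by move: (en _) (en _) (en _) e1 e2 => *; lra.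
  - by rewrite -lerN2 opprB.
move=> H; rewrite lerBlDl -lerBlDr -mulrBr.
apply: (@le_trans _ _ (kap ^+ 2 * D ^+ 2 * (2 * en (d ^+ 2) * (C * tau ^+ 2)))); last first.
  by rewrite [leLHS](_ : _ = kap ^+ 2 * D ^+ 2 * (2 * en (d ^+ 2)) * C * tau ^+ 2)//; ring.
apply: ler_pM => //.
- by rewrite mulr_ge0 ?sqr_ge0 ?sq_ge0.
- by rewrite subr_ge0 lerXn2r ?nnegrE// ltW.
- by rewrite ler_wpM2l ?sqr_ge0.
Qed.

(* [|grad Gamma|^2] is radially decreasing, and at least half of [Om `\` B] lies
   outside the shell [R0 <= |x| < (1 + th) * R0]. *)
Lemma edens_bathtub (Om : set V) (d D R0 s : R) : open Om -> 0 < d -> 0 < D ->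
  eball 0 d `<=` Om -> Om `<=` eball 0 D -> 0 < R0 -> vol Om = R0 ^+ N * om -> 0 < s ->
  exists2 t0 : R, 0 < t0 & forall tau, 0 < tau -> tau <= t0 ->
  kap ^+ 2 * om / (32 * 2 ^+ N) * (R0 ^+ 2 / R0 ^+ N) * (vol (Om `+` eball 0 R0) / vol Om) ^+ 2 - s <=
  intV (fun x => \1_(eball 0 R0) x * edens tau x) - intV (fun x => \1_Om x * edens tau x).
Proof.
move=> oOm d0 D0 dOm OmD R00 vOm s0.
have o0 := omegaN_gt0 R N.
have k20 : 0 < kap ^+ 2 by rewrite exprn_gt0// kap_gt0.
pose B := eball (0 : V) R0.
pose M := R0 ^+ N * om.
have M0 : 0 < M by rewrite mulr_gt0// exprn_gt0.
have vB : vol B = M by rewrite vol_eball.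
have mOm : mesV Om by exact: mesV_open.
have mB : mesV B by exact: mesV_eball.
have bOm : bounded_sq Om.
  by exists (D ^+ 2) => x /OmD; rewrite /eball /= subr0 enorm_lt ?(ltW D0)// => /ltW.
have tOm : tame (\1_Om : V -> R) by exact: tame_indic.
have tB r : tame (\1_(eball (0 : V) r) : V -> R) by exact: tame_eball.
have tB0 : tame (\1_B : V -> R) := tB R0.
pose DR := Num.max D R0.
have DR0 : 0 < DR by rewrite lt_max D0.
have [C C0 HC] := edens_ge_radq d0 DR0.
set al := vol (Om `+` B) / vol Om.
have tOB : tame (\1_(Om `\` B) : V -> R).
  apply: tame_indic; first exact: mesVD.
  by have [b Hb] := bOm; exists b => x [/Hb].
pose mu := vol (Om `\` B).
(* [Om] and [B] have equal volume, so the two halves of the symmetric difference have equal volume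
   [mu]. *)
have volY : vol (Om `+` B) = 2 * mu.
  have mY : mesV (Om `+` B) by apply: mesVU; exact: mesVD.
  rewrite -intV_indic// (@eq_intV _ _ _ (fun x => 2 * \1_(Om `\` B) x + (\1_B x - \1_Om x))); last first.
    move=> x; rewrite /setY !indicE in_setU !in_setD.
    by case: (x \in Om); case: (x \in B) => /=; lra.
  rewrite intVD; [|exact: tameZ|exact: tameB].
  rewrite intVB// intVZ//.
  by rewrite !intV_indic//; [rewrite vB vOm subrr addr0|exact: mesVD].
have muM : mu <= M.
  rewrite /M -vOm; by apply: le_vol => //; exact: mesVD.
have alE : al = 2 * mu / M by rewrite /al volY vOm.
have al0 : 0 <= al by rewrite alE !mulr_ge0 ?invr_ge0 ?vol_ge0// ltW.
have al2 : al <= 2 by rewrite alE ler_pdivrMr//; lra.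
(* The relative thickness at which the shell between [R0] and [R1] has volume at most M al / 4 = mu
   / 2, since (1 + th)^N - 1 <= 2^N th. *)
pose th := al / (4 * 2 ^+ N).
have p1 : 1 <= (2 : R) ^+ N by rewrite exprn_ege1// ler1n.
have p0 : 0 < (2 : R) ^+ N by apply: lt_le_trans p1.
have th0 : 0 <= th by rewrite divr_ge0// mulr_ge0// ltW.
have th1 : th <= 1 by rewrite ler_pdivrMr ?mulr_gt0//; lra.
pose R1 := (1 + th) * R0.
have R10 : 0 < R1 by rewrite mulr_gt0// ltr_pwDl.
have R01 : R0 <= R1 by rewrite /R1 mulrDl mul1r lerDl mulr_ge0// ltW.
pose l0 := radq R0.
have l00 : 0 < l0 by rewrite mulr_gt0// invr_gt0 exprn_gt0.
(* The exponent 2 N - 2 is at least 1, and 1 / (1 + th) <= 1 - th / 2 for th <= 1. *)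
have l1 : radq R1 <= l0 * (1 - th / 2).
  rewrite [leLHS](_ : _ = l0 * ((1 + th) ^+ (2 * N - 2))^-1); last first.
    rewrite /l0 /radq /R1 exprMn (invfM ((1 + th) ^+ (2 * N - 2))).
    by rewrite mulrCA mulrC.
  apply: ler_wpM2l; first exact: ltW.
  have t10 : 0 < 1 + th by rewrite ltr_pwDl.
  apply: (@le_trans _ _ (1 + th)^-1).
    rewrite lef_pV2 ?posrE ?exprn_gt0// -[leLHS]expr1 ler_weXn2l ?lerDl//.
    by rewrite subn_gt0; exact: (@leq_trans 4 3 (2 * N) isT (leq_mul (leqnn 2) N2)).
  rewrite -div1r ler_pdivrMr//; have : th * th <= th * 1 by rewrite ler_wpM2l.
  by move: (th) => u; nra.
have CM0 : 0 < C * M by rewrite mulr_gt0.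
exists (Num.min 1 (s / (C * M))); first by rewrite lt_min ltr01 divr_gt0.
move=> tau tau0; rewrite le_min ler_pdivlMr// => /andP[tau1 tauC].
have tq U (r : R) : tame (\1_U : V -> R) -> 0 <= r -> (forall x, U x -> enorm x <= r) ->
    tame (fun x => \1_U x * edens tau x).
  move=> tU r0 UD; apply: tameM => //; first exact: mrow_edens.
  exists (kap ^+ 2 * r ^+ 2 * en (tau ^+ 2) ^+ 2) => x.
  rewrite indicE; case: (boolP (x \in U)) => [/set_mem/UD xD _|]; last by rewrite eqxx.
  by have /andP[? ?] := edens_bound tau0 r0 xD; rewrite ger0_norm.
have tqO : tame (fun x => \1_Om x * edens tau x).
  by apply: (tq _ D) => //; [exact: ltW|move=> x /OmD; rewrite /eball /= subr0 => /ltW].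
have tqB : tame (fun x => \1_B x * edens tau x).
  by apply: (tq _ R0) => //; [exact: ltW|move=> x; rewrite /B /eball /= subr0 => /ltW].
(* A pointwise comparison with the level [l0], the value of [radq] on the sphere of radius [R0]. The
   first term integrates to 0 by equality of volumes, the second is the gain beyond the shell, the
   third is the cost of the smoothing on [B]. *)
have bath : intV (fun x => l0 * (\1_B x - \1_Om x) + th / 2 * l0 * (\1_(Om `\` B) x - (\1_(eball 0 R1) x - \1_B x)) - C * tau ^+ 2 * \1_B x) <=
    intV (fun x => \1_B x * edens tau x - \1_Om x * edens tau x).
  apply: le_intV.
  - apply: tameB; last exact: tameZ.
    by apply: tameD; apply: tameZ; apply: tameB => //; exact: tameB.
  - exact: tameB.
  move=> x; rewrite [\1_(Om `\` B) x]indicE in_setD !indicE !in_ball.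
  have th2 : 0 <= th / 2 * l0 by rewrite mulr_ge0 ?(ltW l00)// divr_ge0.
  have Ct : 0 <= C * tau ^+ 2 by rewrite mulr_ge0 ?sqr_ge0// ltW.
  have e0 : 0 <= edens tau x by have /andP[] := edens_bound tau0 (enorm_ge0 x) (lexx _).
  have [xO|xO] := boolP (x \in Om).
    have [xB|xB] := ltP (enorm x) R0.
      rewrite (lt_le_trans xB R01) /=; move: (edens tau x) e0 th2 Ct; clear; move=> *; lra.
    have x0 : 0 < enorm x := lt_le_trans R00 xB.
    have ex := edens_le_radq tau x0.
    have [xR|xR] := ltP (enorm x) R1.
      have : radq (enorm x) <= l0 by exact: radq_le.
      by move=> h /=; move: (edens tau x) (radq _) ex h; clear; move=> *; lra.
    have : radq (enorm x) <= radq R1 by exact: radq_le.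
    by move=> h /=; move: (edens tau x) (radq _) (radq _) ex h l1; clear; move=> *; nra.
  have xd : d <= enorm x.
    rewrite leNgt; apply: contra xO => xd; apply/mem_set; apply: dOm.
    by rewrite /eball /= subr0.
  have [xB|xB] := ltP (enorm x) R0.
    have xDR : enorm x <= DR by rewrite /DR le_max (ltW xB) orbT.
    have h1 := HC tau x xd xDR.
    have h2 : l0 <= radq (enorm x) by apply: radq_le; [exact: lt_le_trans xd|exact: ltW].
    rewrite (lt_le_trans xB R01) /=; move: (edens tau x) (radq _) h1 h2 th2 Ct; clear; move=> *; lra.
  by case: (enorm x < R1) => /=; move: (edens tau x); clear -th2 Ct; move=> *; lra.
rewrite -intVB//; apply: le_trans bath.
rewrite intVB; [|by apply: tameD; apply: tameZ; apply: tameB => //; exact: tameB|exact: tameZ].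
rewrite intVD; [|by apply: tameZ; exact: tameB|by apply: tameZ; apply: tameB => //; exact: tameB].
rewrite !intVZ//; [|by apply: tameB => //; exact: tameB|exact: tameB].
rewrite !intVB//; [|exact: tameB].
rewrite !intV_indic//; [|exact: mesV_eball|exact: mesVD].
rewrite vB vOm -/M subrr mulr0 add0r vol_eball// -/mu.
have E1 : R1 ^+ N * om - M <= M * (al / 4).
  rewrite /R1 exprMn (_ : _ - _ = M * ((1 + th) ^+ N - 1)); last by rewrite /M; ring.
  rewrite ler_wpM2l ?(ltW M0)// lerBlDl.
  apply: le_trans (exp1D_le N _) _; first by rewrite th0.
  rewrite lerD2l; apply: (@le_trans _ _ (2 ^+ N * th)).
    by rewrite ler_wpM2r// gerBl.
  by rewrite /th [leLHS](_ : _ = al / 4)//; field; rewrite gt_eqF.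
have muE : mu = M * (al / 2) by rewrite alE; field; rewrite gt_eqF.
have E2 : M * (al / 4) <= mu - (R1 ^+ N * om - M) by rewrite muE; clear -E1; lra.
have E3 : C * tau ^+ 2 * M <= s.
  apply: le_trans tauC; rewrite (_ : C * _ * M = tau ^+ 2 * (C * M)); last by ring.
  by apply: ler_wpM2r; [exact: ltW|rewrite expr2 ler_piMr// ltW].
apply: lerB => //.
have th2 : 0 <= th / 2 * l0 by rewrite mulr_ge0 ?(ltW l00)// divr_ge0.
apply: le_trans (ler_wpM2l th2 E2).
(* The gain is (th / 2) l0 (M al / 4) with th = al / (4 2^N): this is where the factor 32 2^N comes
   from. *)
rewrite le_eqVlt; apply/orP; left; apply/eqP.
have -> : l0 = kap ^+ 2 * R0 ^+ 2 * (R0 ^+ N)^-1 ^+ 2 by exact: radqE.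
rewrite /th /M; field.
by rewrite !gt_eqF// exprn_gt0.
Qed.

End radial.

(** * Choice of the parameters and construction of the subfunction *)

Section core.
Context (R : realType) (N : nat).
Hypothesis N2 : (2 <= N)%N.
Local Notation V := 'rV[R]_N.
Local Notation gam := (@gam R N).
Local Notation en := (@en R N).
Local Notation en1 := (@en1 R N).
Local Notation kap := (@kap R N).
Local Notation om := (omegaN R N).
Implicit Types (x y z v : V) (r s t h tau rho : R).

(** Continuity from the right, which bounds the cost of passing from [D] to a slightly larger [L]
    and from [R0] to a slightly larger [R1]. *)
Lemma gam_right r e : 0 < r -> 0 < e -> exists2 del, 0 < del &
  forall m, r ^+ 2 <= m -> m <= r ^+ 2 + del -> gam (r ^+ 2) - e <= gam m.
Proof.
move=> r0 e0; have r20 : 0 < r ^+ 2 by rewrite exprn_gt0.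
have k0 : 0 < kap / 2 * en (r ^+ 2).
  by apply: mulr_gt0; [rewrite divr_gt0 ?kap_gt0|exact: en_gt0].
exists (e / (kap / 2 * en (r ^+ 2))); first by rewrite divr_gt0.
move=> m rm; rewrite -lerBlDl ler_pdivlMr// mulrC => me.
have := gam_lip N2 r20 (lexx _) rm.
rewrite (ger0_norm (_ : 0 <= m - r ^+ 2)) ?subr_ge0// ler_norml => /andP[h _].
by move: me h; move: (gam m) (gam (r ^+ 2)) (kap / 2 * _ * _) => *; lra.
Qed.

Lemma sqr_right r b del : 0 < r -> r < b -> 0 < del ->
  exists r', [/\ r < r', r' < b & r' ^+ 2 <= r ^+ 2 + del].
Proof.
move=> r0 rb del0; have r1 : 0 < 2 * r + 1 by rewrite ltr_wpDl// mulr_ge0// ltW.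
have [t [t0 tb t1 td]] : exists t, [/\ 0 < t, t <= (b - r) / 2, t <= 1 & t * (2 * r + 1) <= del].
  exists (Num.min ((b - r) / 2) (Num.min 1 (del / (2 * r + 1)))); split.
  - by rewrite !lt_min ltr01 !divr_gt0// subr_gt0.
  - by rewrite ge_min lexx.
  - by rewrite !ge_min lexx orbT.
  - by rewrite -ler_pdivlMr// !ge_min lexx !orbT.
exists (r + t); split; [by rewrite ltrDl|lra|].
have tt : t * t <= t * 1 by rewrite ler_wpM2l// ltW.
by rewrite [leLHS](_ : _ = r ^+ 2 + 2 * (r * t) + t * t); [lra|ring].
Qed.

Let far_bound (p P gs gr gL gD g1 gR eta : R) :
  - eta <= p - P -> p <= gs - gL + 3 * eta -> gs <= gr -> gR <= g1 -> eta <= 1 ->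
  P + (gD + 2 * eta - g1) <= gr - gL + 4 + (gD + 2 - gR).
Proof. lra. Qed.

Let budget (IB IO J Q q Z XM a b : R) :
  IB <= IO + q + J -> Q - a <= IB - IO -> J <= XM + Z -> q <= a -> Z <= a -> a <= b ->
  Q <= XM + 3 * b.
Proof. lra. Qed.

Let conclude (q P0 p0 gD gL g1 gR eta e : R) :
  q <= P0 + e / 12 + (gD + 2 * eta - g1) + 3 * (e / 12) -> - eta <= p0 - P0 ->
  gD - e / 12 <= gL -> gR - e / 12 <= g1 -> eta <= e / 12 ->
  gR + q - e <= p0 + (gL - 3 * eta).
Proof. lra. Qed.

(** The function [u] has what a Perron subfunction for the data Gamma_N(|x|) requires, and its value
    at 0 is the gain to be transferred to the regular part. The loss [e] is arbitrary and [c0] does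
    not depend on it. *)
Lemma core_inequality : exists2 c0 : R, 0 < c0 & forall (Om : set V) (d D R0 e : R),
  open Om -> 0 < d -> d < D -> eball 0 d `<=` Om -> Om `<=` eball 0 D ->
  0 < R0 -> vol Om = R0 ^+ N * om -> 0 < e ->
  exists u : V -> R, [/\ forall x, enorm x <= D -> {for x, continuous u},
    forall x, Om x -> forall e, 0 < e -> exists2 del, 0 < del &
      forall h, 0 < h -> h < del -> - (e * h ^+ 2) <= dd h u x,
    forall x, 0 < enorm x -> enorm x <= D -> u x <= gam (sq x) &
    gam (R0 ^+ 2) + c0 * (R0 ^+ 2 / R0 ^+ N) * (vol (Om `+` eball 0 R0) / vol Om) ^+ 2 - e <= u 0].
Proof.
have [c1 [c2 [c10 c20 HM]]] := src_mass R N2.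
have o0 := omegaN_gt0 R N; have k0 := kap_gt0 R N2.
have k20 : 0 < kap ^+ 2 by rewrite exprn_gt0.
have p0 : 0 < 32 * (2 : R) ^+ N by rewrite mulr_gt0// exprn_gt0.
have n0 : 0 < N%:R :> R by rewrite ltr0n (leq_trans _ N2).
have N0 : (0 < N)%N by exact: leq_trans N2.
pose cq := kap ^+ 2 * om / (32 * 2 ^+ N).
have cq0 : 0 < cq by rewrite divr_gt0// mulr_gt0.
exists (cq / c2); first by rewrite divr_gt0.
move=> Om d D R0 e oOm d0 dD dOm OmD R00 vOm e0.
have D0 : 0 < D := lt_trans d0 dD.
have R0D : R0 <= D.
  have : vol Om <= vol (eball (0 : V) D).
    by apply: le_vol => //; [exact: mesV_open|exact: mesV_eball|exact: bounded_sq_eball].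
  rewrite vol_eball// vOm ler_pM2r// ler_pXn2r ?nnegrE ?(ltW D0) ?(ltW R00)//.
set al := vol _ / vol Om.
(* The final count in [conclude] consists of twelve errors of size at most [e1]. *)
pose e1 := e / 12; have e10 : 0 < e1 by rewrite divr_gt0.
have [dL dL0 HdL] := gam_right D0 e10.
have DD1 : D < D + 1 by rewrite ltrDl.
have [L [DL _ LdL]] := sqr_right D0 DD1 dL0.
have L0 : 0 < L := lt_trans D0 DL.
have gDL : gam (D ^+ 2) - e1 <= gam (L ^+ 2).
  by apply: HdL => //; rewrite lerXn2r ?nnegrE ?(ltW D0) ?(ltW L0)// ltW.
have [dR dR0 HdR] := gam_right R00 e10.
have dR20 : 0 < dR / 2 by rewrite divr_gt0.
have [R1 [R01 R1L R1dR]] := sqr_right R00 (le_lt_trans R0D DL) dR20.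
have R10 : 0 < R1 := lt_trans R00 R01.
have [Cm Cm0 HE] := obstacle_energy N2 oOm d0 dD DL dOm OmD.
have d20 : 0 < d / 2 by rewrite divr_gt0.
have d220 : 0 < (d / 2) ^+ 2 by rewrite exprn_gt0.
have [Cd Cd0 HCd] := gr_lip N2 D0 DL d220.
have CmCd0 : 0 < Cm * Cd by rewrite mulr_gt0.
(* The charges lie at distance at least [d] from 0, so within radius d / 2 their kernels have the
   Lipschitz constant [Cd], and a total charge of at most [Cm] makes the potential vary by at most
   [e1]. *)
have [rho [rho0 rhod rhoe]] : exists rho, [/\ 0 < rho, rho <= d / 2 & rho * (Cm * Cd) <= e1].
  exists (Num.min (d / 2) (e1 / (Cm * Cd))); rewrite lt_min d20 divr_gt0// ge_min lexx.
  by split => //; rewrite -ler_pdivlMr// ge_min lexx orbT.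
have dR0' : d <= R0.
  have : vol (eball (0 : V) d) <= vol Om.
    apply: le_vol => //; [exact: mesV_eball|exact: mesV_open|].
    have [b Hb] := bounded_sq_eball (0 : V) D.
    by exists b => x /OmD; exact: Hb.
  rewrite vol_eball// vOm ler_pM2r// ler_pXn2r ?nnegrE ?(ltW d0) ?(ltW R00)//.
have rhoR1 : rho < R1.
  apply: (lt_trans _ R01); apply: (lt_le_trans _ dR0').
  by apply: le_lt_trans rhod _; rewrite ltr_pdivrMr// ltr_pMr// ltr1n.
(* Errors are measured against c1 e1 because the inequality will be divided by the mass of [src],
   which is at least [c1]. *)
have ce0 : 0 < c1 * e1 by rewrite mulr_gt0.
pose qm := kap ^+ 2 * D ^+ 2 * en (d ^+ 2) ^+ 2.
have qm0 : 0 <= qm by apply: mulr_ge0; rewrite ?sqr_ge0// mulr_ge0 ?sqr_ge0.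
(* Large enough for the energy on the saturated cells, at most qm Cm / lam, to fit this budget; [Cm]
   is already fixed. *)
pose lam := qm * Cm / (c1 * e1) + 1.
have lam0 : 0 < lam by rewrite ltr_wpDl// divr_ge0 ?(ltW ce0)// mulr_ge0// ltW.
have lamE : qm * (Cm / lam) <= c1 * e1.
  have E : c1 * e1 * (qm * Cm / (c1 * e1)) = qm * Cm by rewrite mulrC divfK ?gt_eqF.
  by rewrite mulrA ler_pdivrMr// /lam mulrDr mulr1 E lerDl ltW.
pose eta := Num.min 1 e1.
have eta0 : 0 < eta by rewrite lt_min ltr01.
have eta1 : eta <= 1 by rewrite ge_min lexx.
have etae : eta <= e1 by rewrite ge_min lexx orbT.
have [t1 /andP[t10 t11] Ht1] := HE lam eta lam0 eta0 eta1.
have [t2 t20 Ht2] := edens_bathtub N2 oOm d0 D0 dOm OmD R00 vOm ce0.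
(* An upper bound, independent of [tau], for the integrand P + Tc outside the ball of radius [rho],
   where the potential is below the obstacle up to an error. There [src] is O(tau^2), so this part
   of the integral is at most Z tau^2. *)
pose G := `|gam (rho ^+ 2) - gam (L ^+ 2) + 4 + (gam (D ^+ 2) + 2 - gam (R1 ^+ 2 + 1))|.
pose S := kap * N%:R * en1 (rho ^+ 2).
have S0 : 0 <= S by rewrite mulr_ge0 ?(ltW (en1_gt0 _ _))// mulr_ge0// ltW.
have G0 : 0 <= G by exact: normr_ge0.
pose Z := G * S * (om * R1 ^+ N).
have Z0 : 0 <= Z.
  apply: mulr_ge0; first exact: mulr_ge0.
  by apply: mulr_ge0; [exact: ltW|rewrite exprn_ge0// ltW].
have Z10 : 0 < Z + 1 by rewrite ltr_wpDl.
have [tau [tau0 [tt1 tt2] tr tdR tZ]] : exists tau, [/\ 0 < tau, tau <= t1 /\ tau <= t2, tau <= rho,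
    tau <= dR / 2 & tau * (Z + 1) <= c1 * e1].
  exists (Num.min (Num.min t1 t2) (Num.min (Num.min rho (dR / 2)) (c1 * e1 / (Z + 1)))).
  rewrite !lt_min t10 t20 rho0 dR20 divr_gt0//; split => //.
  - by rewrite !ge_min !lexx !orbT.
  - by rewrite !ge_min lexx !orbT.
  - by rewrite !ge_min lexx !orbT.
  - by rewrite -ler_pdivlMr// !ge_min lexx !orbT.
have tau1 : tau <= 1 := le_trans tt1 t11.
have t2t : tau ^+ 2 <= tau by rewrite expr2 ler_piMr// ltW.
have ZE : Z * tau ^+ 2 <= c1 * e1.
  apply: le_trans tZ; rewrite mulrC; apply: ler_pM; rewrite ?sqr_ge0//.
  by rewrite lerDl.
have [n [z [m [p [[zd m0 mCm pP] [cp ddp pG pE]]]]]] := Ht1 tau tau0 tt1.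
pose P := ptsum L z m tau.
pose g1 := gam (R1 ^+ 2 + tau ^+ 2).
have g1R : gam (R0 ^+ 2) - e1 <= g1.
  apply: HdR.
    rewrite -[leLHS]addr0 lerD ?sqr_ge0// lerXn2r ?nnegrE ?(ltW R00) ?(ltW R10)// ltW//.
  by apply: le_trans (lerD R1dR (le_trans t2t tdR)) _; rewrite -addrA -splitr.
have g1R1 : gam (R1 ^+ 2 + 1) <= g1.
  apply: gam_le => //; first by rewrite ltr_wpDl ?sqr_ge0// exprn_gt0.
  by rewrite lerD2l (le_trans t2t).
pose Tc := gam (D ^+ 2) + 2 * eta - g1.
pose X := P 0 + e1 + Tc.
pose M := intV (fun x => \1_(eball (0 : V) rho) x * src tau x).
have /andP[Mc1 Mc2] : c1 <= M <= c2 := HM tau rho tau0 tr.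
have J : intV (fun x => \1_(eball 0 R1) x * (P x + Tc) * src tau x) <= X * M + Z * tau ^+ 2.
  have tS r : tame (fun x => \1_(eball (0 : V) r) x * src tau x) by exact: tame_src_ball.
  have tB : tame (\1_(eball (0 : V) R1) : V -> R) by exact: tame_eball.
  have -> : X * M + Z * tau ^+ 2 = intV (fun x => X * (\1_(eball 0 rho) x * src tau x) +
      G * S * tau ^+ 2 * \1_(eball 0 R1) x).
    rewrite intVD; [|exact: tameZ|exact: tameZ].
    by rewrite intVZ// -/M intVZ// intV_eball// /Z; ring.
  have zD j : enorm (z j) <= D by have /andP[] := zd j.
  have lip0 m1 C x : (forall tau x y z, enorm x <= L -> enorm y <= L ->
      enorm z <= D -> m1 <= ms tau z x -> m1 <= ms tau z y ->
      `|gr L tau x z - gr L tau y z| <= C * enorm (x - y)) -> 0 < C ->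
      enorm x <= L -> (forall j, m1 <= ms tau (z j) x) -> (forall j, m1 <= ms tau (z j) 0) ->
      `|P x - P 0| <= Cm * (C * enorm x).
    move=> HC C0 xL mx my; have z0 : enorm (0 : V) <= L by rewrite enorm0 ltW.
    apply: le_trans (ptsum_lip HC xL z0 m0 zD mx my) _; rewrite subr0.
    by rewrite ler_wpM2r// mulr_ge0 ?enorm_ge0// ltW.
  apply: le_intV.
  - rewrite (_ : (fun _ => _) = fun x => \1_(eball 0 R1) x * src tau x * (P x + Tc)); last first.
      by apply/funext => x; ring.
    apply: tameM => //.
      apply: mrowD; last exact: mrow_cst.
      by apply: mrow_sum => j; apply: mrowZ; exact: mrow_gr.
    have tau20 : 0 < tau ^+ 2 by rewrite exprn_gt0.
    have [C C0 HC] := gr_lip N2 D0 DL tau20.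
    exists (`|P 0| + Cm * (C * L) + `|Tc|) => x.
    rewrite indicE in_ball; have [xR1|] := ltP (enorm x) R1; last by rewrite !mul0r eqxx.
    move=> _; have xL : enorm x <= L by rewrite ltW// (lt_trans xR1).
    apply: le_trans (ler_normD _ _) _; rewrite lerD2r.
    have := lip0 _ C x HC C0 xL (fun=> ms_ge _ _ _) (fun=> ms_ge _ _ _) => h.
    have := ler_normD (P x - P 0) (P 0); rewrite subrK => /le_trans; apply.
    rewrite addrC lerD2l; apply: le_trans h _.
    by rewrite ler_wpM2l ?(ltW Cm0)// ler_wpM2l// ltW.
  - by apply: tameD; apply: tameZ.
  move=> x; have /andP[s0 _] := src_bound N2 tau0 x.
  have GS0 : 0 <= G * S * tau ^+ 2 by rewrite mulr_ge0 ?sqr_ge0// mulr_ge0.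
  rewrite !indicE !in_ball; have [xr|xr] := ltP (enorm x) rho.
    rewrite (lt_trans xr rhoR1) !mul1r mulr1.
    have xL : enorm x <= L by rewrite ltW// (lt_trans xr)// (lt_trans rhoR1).
    have ms0 j y : enorm y <= d / 2 -> (d / 2) ^+ 2 <= ms tau (z j) y.
      move=> yd; rewrite /ms -[leLHS]addr0 lerD ?sqr_ge0// -(enorm_ge _ (ltW d20)) enormBC.
      have /andP[zd1 _] := zd j; apply: le_trans (enorm_subl (z j) y).
      by rewrite lerBrDr (le_trans _ zd1)// -lerBrDl (le_trans yd)// lerBrDr -splitr.
    have z0 : enorm (0 : V) <= d / 2 by rewrite enorm0 ltW.
    have xd : enorm x <= d / 2 by rewrite ltW// (lt_le_trans xr).
    have := lip0 _ Cd x HCd Cd0 xL (fun j => ms0 j x xd) (fun j => ms0 j 0 z0).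
    rewrite ler_norml => /andP[_ h].
    have h' : Cm * (Cd * enorm x) <= e1.
      apply: le_trans rhoe; rewrite mulrA mulrC; apply: ler_wpM2r; exact: ltW.
    rewrite -[leLHS]addr0 lerD// ler_wpM2r// lerD2r.
    by rewrite -lerBlDl (le_trans h).
  case: (ltP (enorm x) R1) => xR1; last by rewrite !mul0r !mulr0 addr0.
  rewrite mul1r mul0r mulr0 add0r mulr1 -mulrA.
  have x0 : 0 < enorm x := lt_le_trans rho0 xr.
  have xL : enorm x <= L by rewrite ltW// (lt_trans xR1).
  apply: (@le_trans _ _ (G * src tau x)).
    apply: ler_wpM2r => //.
    have h1 := pP x xL; rewrite -/P ler_norml in h1; case/andP: h1 => h1 _.
    have h2 := pG x x0 xL; rewrite /Gcap in h2.
    have h3 : gam (sq x) <= gam (rho ^+ 2).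
      by apply: gam_le; rewrite ?exprn_gt0// -(enorm_ge _ (ltW rho0)).
    apply: le_trans (ler_norm _); rewrite /Tc.
    exact: far_bound h1 h2 h3 g1R1 eta1.
  apply: ler_wpM2l => //; rewrite /S /src mulrAC; apply: ler_wpM2r; first exact: sqr_ge0.
  apply: ler_wpM2l; first by rewrite mulr_ge0// ltW.
  apply: en1_le; first by rewrite exprn_gt0.
  by rewrite /ms subr0 -[leLHS]addr0 lerD ?sqr_ge0// -(enorm_ge _ (ltW rho0)).
have E1 := pE R0 R1 R00 R01 R1L; rewrite -/P -/qm -/g1 -/Tc in E1.
have E2 := Ht2 tau tau0 tt2; rewrite -/al -/cq in E2.
pose Q0 := cq * (R0 ^+ 2 / R0 ^+ N) * al ^+ 2.
have Q00 : 0 <= Q0.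
  by rewrite mulr_ge0 ?sqr_ge0// mulr_ge0 ?(ltW cq0)// divr_ge0// exprn_ge0// ltW.
(* The gain is at most (X + 3 e1) M. As it is nonnegative, so is X + 3 e1, and [M] may be replaced
   by its upper bound [c2]. *)
have QX : Q0 / c2 <= X + 3 * e1.
  have h : Q0 <= (X + 3 * e1) * M.
    have h1 : c1 * e1 <= M * e1 by rewrite ler_wpM2r// ltW.
    rewrite mulrDl [3 * e1 * M](_ : _ = 3 * (M * e1)); last by ring.
    exact: budget E1 E2 J lamE ZE h1.
  have X0 : 0 <= X + 3 * e1.
    rewrite leNgt; apply/negP => Xn.
    have M0 : 0 < M := lt_le_trans c10 Mc1.
    have := le_trans Q00 h; rewrite leNgt => /negP; apply.
    by rewrite nmulr_rlt0.
  rewrite ler_pdivrMr//; apply: le_trans h _; exact: ler_wpM2l.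
have D2 x : enorm x <= D -> enorm x < L by move=> h; exact: le_lt_trans h DL.
(* The constant turns the bound of [p] by the obstacle plus 3 eta into a bound by [gam] itself. *)
exists (fun x => p x + (gam (L ^+ 2) - 3 * eta)); split.
- move=> x xD; apply: continuousD; last exact: cst_continuous.
  by apply: cp; exact: D2.
- move=> x Ox e' e'0; have [del del0 Hdel] := ddp x Ox e' e'0.
  by exists del => // h h0 hd; rewrite ddD dd_cst addr0; exact: Hdel.
- move=> x x0 xD; have := pG x x0 (ltW (D2 x xD)); rewrite /Gcap.
  by rewrite addrA lerBlDr -lerBrDr addrAC.
have z0 : enorm (0 : V) <= L by rewrite enorm0 ltW.
have := pP 0 z0; rewrite -/P ler_norml => /andP[h _].
rewrite -/al (_ : cq / c2 * _ * _ = Q0 / c2); last by rewrite /Q0; ring.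
exact: conclude QX h gDL g1R etae.
Qed.

End core.

(** * Bounds on the harmonic radius *)

Section harmonic_radius_bound.
Context (R : realType) (N : nat).
Hypothesis N2 : (2 <= N)%N.
Local Notation V := 'rV[R]_N.
Local Notation gam := (@gam R N).
Local Notation om := (omegaN R N).
Implicit Types (x y z v : V) (r s t h tau rho : R).

Lemma vol_shift (A : set V) v : mesV A -> bounded_sq A -> vol [set y | A (y + v)] = vol A.
Proof.
move=> mA bA; have tA := tame_indic mA bA.
have E y : \1_[set y | A (y + v)] y = \1_A (y + v) :> R.
  by rewrite !indicE; congr (_ : bool)%:R; apply/idP/idP => /set_mem h; exact/mem_set.
rewrite -(intV_indic mA) -(intV_shift v tA) -(eq_intV E) intV_indic//.
rewrite (_ : [set y | A (y + v)] = [set y | (1 : R) <= \1_A (y + v)]).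
  by apply: mesV_le; [exact: mrow_cst|exact: (tame_shift v tA).1].
apply/seteqP; split => y /=; first by move=> Ay; rewrite indicE mem_set.
by rewrite indicE; case: (boolP (_ \in A)) => [/set_mem//|_]; rewrite ler10.
Qed.

(** The gain is c0 a^2 times a quantity that scales like Gamma_N(r), so it becomes a relative
    factor. For N = 2 this is 1 + y <= exp y. For larger N, with y = c0 a^2, the factor is (1 +
    y)^(2 / (N - 2)), bounded below by means of ln (1 + y) >= y / (1 + y); a <= 2 bounds the
    denominator. *)
Lemma gammaN_inv_bound (c0 : R) : 0 < c0 -> exists2 c : R, 0 < c & forall r a H,
  0 < r -> 0 <= a <= 2 -> gammaN N r + c0 * (r ^+ 2 / r ^+ N) * a ^+ 2 <= H ->
  0 < gammaN_inv N H /\ gammaN_inv N H ^+ 2 * (1 + c * a ^+ 2) <= r ^+ 2.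
Proof.
move=> c00; rewrite /gammaN_inv /gammaN; have [->|N2'] := eqVneq N 2.
  exists (2 * c0); first by rewrite mulr_gt0.
  move=> r a H r0 /andP[a0 a2]; rewrite divff ?gt_eqF ?exprn_gt0// mulr1 => h.
  split; first exact: expR_gt0.
  have h2 : 1 + 2 * c0 * a ^+ 2 <= expR (2 * c0 * a ^+ 2) by exact: expR_ge1Dx.
  have e0 : 0 <= expR (- H) ^+ 2 by exact: sqr_ge0.
  apply: le_trans (ler_wpM2l e0 h2) _.
  rewrite -[in leRHS](lnK (_ : r \is Num.pos)) ?posrE// -!expRM_natl -expRD ler_expR.
  by move: (a ^+ 2) h => u; lra.
have N20 : (0 < N - 2)%N by rewrite subn_gt0 ltn_neqAle eq_sym N2' N2.
have n0 : 0 < (N - 2)%:R :> R by rewrite ltr0n.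
pose th := 2 / (N - 2)%:R : R.
have th0 : 0 < th by rewrite divr_gt0.
have c41 : 0 < 1 + 4 * c0 by rewrite ltr_wpDr// mulr_ge0// ltW.
exists (th * c0 / (1 + 4 * c0)); first by rewrite divr_gt0// mulr_gt0.
move=> r a H r0 /andP[a0 a2].
have rn0 : 0 < r ^+ (N - 2) by rewrite exprn_gt0.
have -> : r ^+ 2 / r ^+ N = (r ^+ (N - 2))^-1.
  rewrite -{1}(subnK N2) exprD; field.
  by rewrite !gt_eqF// exprn_gt0.
pose y := c0 * a ^+ 2.
have y0 : 0 <= y by rewrite mulr_ge0 ?sqr_ge0// ltW.
have y4 : y <= 4 * c0.
  rewrite /y mulrC ler_wpM2r ?(ltW c00)// expr2.
  have : a * a <= 2 * 2 by apply: ler_pM.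
  by lra.
rewrite [X in X <= H -> _](_ : _ = (r ^+ (N - 2))^-1 * (1 + y)); last by rewrite /y; ring.
move=> h; have y10 : 0 < 1 + y by rewrite ltr_pwDl.
have K0 : 0 < (r ^+ (N - 2))^-1 * (1 + y) by rewrite mulr_gt0 ?invr_gt0.
have H0 : 0 < H := lt_le_trans K0 h.
split; first exact: powR_gt0.
have E : (H `^ (- ((N - 2)%:R)^-1)) ^+ 2 <= r ^+ 2 * expR (- (th * ln (1 + y))).
  have -> : (H `^ (- ((N - 2)%:R)^-1)) ^+ 2 = expR (- th * ln H).
    by rewrite /powR gt_eqF// -expRM_natl /th; congr expR; field; rewrite gt_eqF.
  have -> : r ^+ 2 = expR (2 * ln r) by rewrite expRM_natl lnK.
  rewrite -expRD ler_expR.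
  have : ln ((r ^+ (N - 2))^-1 * (1 + y)) <= ln H by rewrite ler_ln ?posrE.
  rewrite lnM ?posrE ?invr_gt0// lnV ?posrE// lnXn// => h1.
  have : th * (- (ln r *+ (N - 2)) + ln (1 + y)) <= th * ln H by rewrite ler_wpM2l// ltW.
  have E2 : th * (ln r *+ (N - 2)) = 2 * ln r.
    by rewrite -(mulr_natl (ln r)) mulrA divfK ?gt_eqF.
  by rewrite mulrDr mulrN E2 mulNr; lra.
have F : 1 + th * c0 / (1 + 4 * c0) * a ^+ 2 <= expR (th * ln (1 + y)).
  apply: le_trans (expR_ge1Dx _); rewrite lerD2l.
  rewrite (_ : th * c0 / _ * _ = th * (y / (1 + 4 * c0))); last by rewrite /y; ring.
  rewrite ler_wpM2l ?(ltW th0)//; apply: (@le_trans _ _ (y / (1 + y))).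
    by rewrite ler_wpM2l// lef_pV2 ?posrE// lerD2l.
  have := @expR_ge1Dx _ (- ln (1 + y)); rewrite expRN lnK ?posrE// => h1.
  rewrite (_ : y / (1 + y) = 1 - (1 + y)^-1); last by field; rewrite gt_eqF.
  by move: ((1 + y)^-1) h1 => u; lra.
apply: (@le_trans _ _ (r ^+ 2 * expR (- (th * ln (1 + y))) * expR (th * ln (1 + y)))).
  by apply: ler_pM => //; [exact: sqr_ge0|rewrite addr_ge0// mulr_ge0 ?sqr_ge0// divr_ge0 ?(ltW c41)// mulr_ge0// ltW].
by rewrite -mulrA -expRD addNr expR0 mulr1.
Qed.

(** The function of [core_inequality], translated so that its pole is at [x], is a Perron
    subfunction. The boundary data are bounded because [Om] contains a ball around [x], and the loss
    [e] is arbitrary. *)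
Lemma regular_part_ge : exists2 c0 : R, 0 < c0 & forall (Om : set V) x (R0 : R),
  open Om -> bounded_set Om -> Om x -> 0 < R0 -> vol Om = R0 ^+ N * om ->
  gammaN N R0 + c0 * (R0 ^+ 2 / R0 ^+ N) * (vol (Om `+` eball x R0) / vol Om) ^+ 2
    <= regular_part Om x x.
Proof.
have [c0 c00 core] := core_inequality R N2.
exists c0 => // Om x R0 oOm bOm Ox R00 vOm.
pose U : set V := [set y | Om (y + x)].
have mOm : mesV Om := mesV_open oOm.
have [d d0 dOm] := (nbhs_enormP x Om).1 (open_nbhs_nbhs (conj oOm Ox)).
have [r r0 rOm] := enorm_bounded bOm.
(* [r] + |x| bounds the translated set; adding [d] ensures d < D. *)
pose D := d + r + enorm x.
have dD : d < D by rewrite /D -addrA ltrDl ltr_wpDr ?enorm_ge0.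
have sqOm : bounded_sq Om by exists (r ^+ 2) => y /rOm; rewrite enorm_lt ?(ltW r0)// => /ltW.
have oU : open U.
  rewrite openE => y Uy; apply/nbhs_enormP.
  have [e e0 He] := (nbhs_enormP _ Om).1 (open_nbhs_nbhs (conj oOm Uy)).
  by exists e => // z; rewrite /eball /= => ze; apply: He; rewrite /eball /= opprD addrACA subrr addr0.
have dU : eball 0 d `<=` U.
  by move=> y; rewrite /eball /= subr0 => yd; apply: dOm; rewrite /eball /= addrK.
have UD : U `<=` eball 0 D.
  move=> y /rOm yr; rewrite /eball /= subr0.
  have := enormB (y + x) x; rewrite addrK /D => h.
  by move: (enorm y) (enorm (y + x)) (enorm x) h yr => *; lra.
have vU : vol U = R0 ^+ N * om by rewrite vol_shift.
have vY : vol (U `+` eball 0 R0) = vol (Om `+` eball x R0).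
  rewrite -(@vol_shift (Om `+` eball x R0) x).
  - congr vol; apply/seteqP; split => y /=; rewrite /eball /= subr0 addrK//.
  - by apply: mesVU; apply: mesVD => //; exact: mesV_eball.
  have [b1 H1] := sqOm; have [b2 H2] := bounded_sq_eball x R0.
  exists (Num.max b1 b2) => y [[/H1 h _]|[/H2 h _]]; first by rewrite le_max h.
  by rewrite le_max h orbT.
apply/ler_addgt0Pr => e e0.
have [u [cu ddu ug u0]] := core U d D R0 e oU d0 dD dU UD R00 vU e0.
rewrite -lerBlDr -gamE// -vY vOm -vU; apply: le_trans u0 _.
pose w y := u (y - x).
have cw y : enorm (y - x) <= D -> {for y, continuous w}.
  move=> yD; apply/continuous_enormP => e1 e10.
  have [del del0 H] := (continuous_enormP _ _).1 (cu (y - x) yD) e1 e10.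
  by exists del => // z zy; apply: H; rewrite opprB addrA subrK.
have clD y : closure Om y -> enorm (y - x) <= D.
  have cD : closed (eclosed_ball x D) by exact: closed_eclosed_ball.
  move=> cy; suff : eclosed_ball x D y by [].
  apply: cD; move: cy; apply: closureS => z Oz.
  have : U (z - x) by rewrite /U /= subrK.
  by move/UD; rewrite /eball /eclosed_ball /= subr0 => /ltW.
have notOm y : ~ Om y -> d <= enorm (y - x).
  by move=> nO; rewrite leNgt; apply/negP => yd; apply: nO; exact: dOm.
have -> : u 0 = w x by rewrite /w subrr.
rewrite /regular_part; apply: (@perron_ge _ _ Om _ w (gam (d ^+ 2))) => //.
- move=> z [_ /notOm zd]; rewrite enormBC -gamE ?(lt_le_trans d0)//.
  apply: gam_le => //; first by rewrite exprn_gt0.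
  by rewrite lerXn2r ?nnegrE ?enorm_ge0// ltW.
split.
- by apply: continuous_in_subspaceT => y /set_mem/clD; exact: cw.
- apply: (subharmonic_of_dd N2).
    by move=> y Oy; apply: cw; apply: clD; exact: subset_closure.
  move=> y Oy e1 e10; have Uy : U (y - x) by rewrite /U /= subrK.
  have [del del0 H] := ddu (y - x) Uy e1 e10.
  exists del => // h h0 hd; apply: le_trans (H h h0 hd) _.
  rewrite le_eqVlt; apply/orP; left; apply/eqP; rewrite /dd /w.
  by apply: eq_bigr => i _; rewrite (addrAC y (- x)) (addrAC y (- x)).
- move=> z [cz nz]; have zd := notOm z nz.
  rewrite enormBC -gamE ?(lt_le_trans d0)// enormE.
  by apply: ug; [exact: lt_le_trans zd|exact: clD].
Qed.

End harmonic_radius_bound.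

Theorem corollary3p5 (R : realType) (N : nat) (hN : (2 <= N)%N) :
  exists c : R, 0 < c /\
    forall Omega : set 'rV[R]_N,
      Omega !=set0 -> open Omega -> bounded_set Omega ->
      vol Omega `^ (2 / N%:R) / harmonic_radius Omega ^+ 2
        - omegaN R N `^ (2 / N%:R)
      >= c * fraenkel Omega ^+ 2.
Proof.
have [c0 c00 Hreg] := regular_part_ge R hN.
have [c c_gt0 Hinv] := gammaN_inv_bound hN c00.
have o0 := omegaN_gt0 R N.
have n0 : (N%:R : R) != 0 by rewrite pnatr_eq0 -lt0n (leq_trans _ hN).
exists (omegaN R N `^ (2 / N%:R) * c); split; first by rewrite mulr_gt0// powR_gt0.
move=> Om [x0 Ox0] oOm bOm.
have mOm : mesV Om := mesV_open oOm.
have [r r0 rOm] := enorm_bounded bOm.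
have sqOm : bounded_sq Om by exists (r ^+ 2) => y /rOm; rewrite enorm_lt ?(ltW r0)// => /ltW.
have v0 : 0 < vol Om.
  have [d d0 dOm] := (nbhs_enormP x0 Om).1 (open_nbhs_nbhs (conj oOm Ox0)).
  apply: (@lt_le_trans _ _ (vol (eball x0 d))).
    by rewrite vol_eball// mulr_gt0// exprn_gt0.
  by apply: le_vol => //; exact: mesV_eball.
pose R0 := (vol Om / omegaN R N) `^ (N%:R)^-1.
have R00 : 0 < R0 by rewrite powR_gt0// divr_gt0.
have R0N : R0 ^+ N = vol Om / omegaN R N.
  by rewrite -powR_mulrn ?powR_ge0// -powRrM mulVf// powRr1// divr_ge0// ltW.
have vOm : vol Om = R0 ^+ N * omegaN R N by rewrite R0N divfK// gt_eqF.
pose F := [set a | exists c r, [/\ 0 < r, vol (eball c r) = vol Om &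
                 a = vol (Om `+` eball c r) / vol Om]].
have F0 a : F a -> 0 <= a.
  by move=> [y [s [_ _ ->]]]; rewrite divr_ge0 ?vol_ge0.
have Fx x : F (vol (Om `+` eball x R0) / vol Om).
  by exists x, R0; split=> //; rewrite vol_eball.
have lbF : has_lbound F by exists 0 => a; exact: F0.
pose A := fraenkel Om.
have A0 : 0 <= A.
  apply: lb_le_inf => [|a]; last exact: F0.
  by exists (vol (Om `+` eball x0 R0) / vol Om); exact: Fx.
have Ax x : A <= vol (Om `+` eball x R0) / vol Om by exact: (ge_inf lbF).
(* The set and the ball have the same volume, so their symmetric difference has at most twice that
   volume; this is the range of [a] in [gammaN_inv_bound]. *)
have A2 : A <= 2.
  apply: le_trans (Ax x0) _; rewrite ler_pdivrMr//.
  have mB : mesV (eball x0 R0) by exact: mesV_eball.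
  have tO := tame_indic mOm sqOm; have tB := tame_eball x0 R0.
  have mY : mesV (Om `+` eball x0 R0) by apply: mesVU; apply: mesVD.
  have -> : 2 * vol Om = vol Om + vol (eball x0 R0) by rewrite vol_eball// -vOm; ring.
  rewrite -(intV_indic mY) -(intV_indic mOm) -(intV_indic mB) -intVD//.
  apply: le_intV.
  - apply: tame_indic => //; have [b1 H1] := sqOm; have [b2 H2] := bounded_sq_eball x0 R0.
    exists (Num.max b1 b2) => y [[/H1 h _]|[/H2 h _]]; first by rewrite le_max h.
    by rewrite le_max h orbT.
  - exact: tameD.
  move=> y; rewrite /setY !indicE in_setU !in_setD.
  by case: (y \in Om); case: (y \in eball x0 R0) => /=; lra.
pose H := [set gammaN_inv N (regular_part Om x x) | x in Om].
(* Replacing the asymmetry about [x] by the infimum [A] makes the bound uniform in [x], so that it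
   passes to the supremum over the points of [Om]. *)
have HH s : H s -> 0 < s /\ s ^+ 2 * (1 + c * A ^+ 2) <= R0 ^+ 2.
  move=> [x Ox <-]; apply: Hinv => //; first by rewrite A0.
  apply: le_trans (Hreg Om x R0 oOm bOm Ox R00 vOm); rewrite lerD2l ler_wpM2l//.
    by rewrite mulr_ge0 ?(ltW c00)// divr_ge0// exprn_ge0// ltW.
  by rewrite lerXn2r ?nnegrE// (le_trans A0).
have k0 : 0 < 1 + c * A ^+ 2 by rewrite ltr_pwDl// mulr_ge0 ?sqr_ge0// ltW.
have Hub s : H s -> s <= Num.sqrt (R0 ^+ 2 / (1 + c * A ^+ 2)).
  move=> /HH[s0 Hs]; rewrite -(ger0_norm (ltW s0)) -sqrtr_sqr ler_wsqrtr//.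
  by rewrite ler_pdivlMr.
have h0 : H (gammaN_inv N (regular_part Om x0 x0)) by exists x0.
have I0 : 0 < harmonic_radius Om.
  apply: (lt_le_trans (HH _ h0).1); apply: ub_le_sup => //.
  by exists (Num.sqrt (R0 ^+ 2 / (1 + c * A ^+ 2))) => s; exact: Hub.
have I1 : harmonic_radius Om <= Num.sqrt (R0 ^+ 2 / (1 + c * A ^+ 2)).
  apply: ge_sup; last by move=> s; exact: Hub.
  by exists (gammaN_inv N (regular_part Om x0 x0)).
have I2 : harmonic_radius Om ^+ 2 * (1 + c * A ^+ 2) <= R0 ^+ 2.
  rewrite -ler_pdivlMr// -(@sqr_sqrtr _ (R0 ^+ 2 / _)).
    by rewrite lerXn2r ?nnegrE ?sqrtr_ge0// ltW.
  by rewrite divr_ge0 ?sqr_ge0// ltW.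
(* In terms of [R0] the factor omegaN^(2/N) comes out of every term, and the claim reduces to R0^2 /
   I^2 - 1 >= c A^2, which is [I2]. *)
have -> : vol Om `^ (2 / N%:R) = omegaN R N `^ (2 / N%:R) * R0 ^+ 2.
  rewrite vOm mulrC powRM ?exprn_ge0 ?(ltW R00) ?(ltW o0)//; congr (_ * _).
  rewrite -[X in X `^ _]powR_mulrn ?(ltW R00)// -powRrM mulrCA divff// mulr1.
  by rewrite powR_mulrn ?(ltW R00).
rewrite -/A -mulrA -[X in _ <= _ - X]mulr1 -mulrA -mulrBr.
apply: ler_wpM2l; first exact: powR_ge0.
by rewrite lerBrDl ler_pdivlMr ?exprn_gt0// mulrC.
Qed.
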